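(* Let $\Omega$ be an open bounded subset of $\mathbb{R}^2$ with Lipschitz boundary. Assume that $F:\mathcal{K}^2\to[0,+\infty)$ satisfies the following conditions. (H1) Domain monotonicity: for all $\Omega_1,\Omega_2\in\mathcal{K}^2$, $\Omega_1\subseteq\Omega_2$ implies $F(\Omega_1)\ge F(\Omega_2)$. (H2) Homogeneity: there exists $\alpha>0$ such that $F(tK)=t^{-\alpha}F(K)$ for every $t>0$ and every $K\in\mathcal{K}^2$. (H3) Behaviour on polygons: setting, for every integer $n\ge 3$, $$\gamma(n):=\min\{F(P)\,|P|^{\alpha/2} : P \text{ an } n\text{-gon in } \mathcal{K}^2\},$$ one has (i) $\gamma(6)=F(H)$; (ii) for every $k\in\mathbb{N}$ and all integers $n_1,\dots,n_k\ge 3$, $$\frac1k\sum_{i=1}^k n_i\le 6\ \Longrightarrow\ \frac1k\sum_{i=1}^k\gamma(n_i)^{2/(\alpha+2)}\ge\gamma(6)^{2/(\alpha+2)}.$$ For $k\in\mathbb{N}$ let $$m_k(\Omega)=\inf\Big\{\sum_{i=1}^kF(E_i) : \{E_i\}\in\mathcal{C}_k(\Omega)\Big\}.$$ Then $$\lim_{k\to+\infty}\frac{|\Omega|^{\alpha/2}}{k^{(\alpha+2)/2}}\,m_k(\Omega)=F(H).$$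
   Context: $\mathcal{K}^2$ is the family of convex bodies in $\mathbb{R}^2$, i.e. convex compact subsets of the plane with nonempty interior. $|\cdot|$ denotes area (Lebesgue measure). $H$ is the regular hexagon of unit area. An $n$-gon in $\mathcal{K}^2$ is a convex polygon with $n$ sides. $\mathcal{C}_k(\Omega)$ is the class of convex $k$-clusters of $\Omega$: families $\{E_i\}_{i=1,\dots,k}$ of subsets of $\mathbb{R}^2$ such that $E_i\in\mathcal{K}^2$ for every $i$, $E_i\subseteq\Omega$ for every $i$, and $|E_i\cap E_j|=0$ for every $i\ne j$.
   Formalization: The regular hexagon H of unit area is fixed only up to congruence and F is not assumed invariant, so (H3)(i) is required for every such hexagon and the limit is stated for every one (with a single fixed H the claim can fail); Ω is assumed nonempty. *)

(* Defs.v *)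
From HB Require Import structures.
From mathcomp Require Import all_boot all_order all_algebra.
From mathcomp Require Import all_classical all_reals all_analysis.

Set Implicit Arguments.
Unset Strict Implicit.
Unset Printing Implicit Defensive.

Import Order.TTheory GRing.Theory Num.Theory.
Import numFieldNormedType.Exports.

Local Open Scope classical_set_scope.
Local Open Scope ring_scope.

(* [R^o] rather than [R], so that the product is a module over [R]; its norm is
   the max norm, which enters below only through topology and boundedness. *)
Notation plane R := (R^o * R^o)%type.

Section Planar.
Variable R : realType.
Implicit Types (A K P H Omega : set (plane R)) (a b c : plane R).

Definition area A : \bar R :=
  ((@lebesgue_measure R) \x (@lebesgue_measure R))%E A.

Definition convex_body K : Prop :=
  [/\ @convex_set R (plane R) K, compact K & interior K !=set0].

Definition scale (t : R) A : set (plane R) := [set t *: x | x in A].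

Definition convex_hull A : set (plane R) :=
  smallest (@convex_set R (plane R)) A.

(* Twice the signed area of the triangle [a b c]: positive iff [c] lies
   strictly to the left of the line oriented from [a] to [b]. *)
Definition orient a b c : R :=
  (b.1 - a.1) * (c.2 - a.2) - (b.2 - a.2) * (c.1 - a.1).

(* [v] lists the vertices counterclockwise, and the [n] sides are the segments
   from [v i] to [v (ordS i)], indices being taken modulo [n].  Strictness of
   the inequality makes the vertices distinct and no two sides aligned. *)
Definition is_ngon (n : nat) P : Prop :=
  (3 <= n)%N /\
  exists v : 'I_n -> plane R,
    (forall i j, j != i -> j != ordS i -> 0 < orient (v i) (v (ordS i)) (v j))
    /\ P = convex_hull (range v).

Definition regular_hexagon H : Prop :=
  exists (c : plane R) (r theta : R), 0 < r /\
    H = convex_hull (range (fun i : 'I_6 =>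
          (c.1 + r * cos (theta + i%:R * (pi / 3)),
           c.2 + r * sin (theta + i%:R * (pi / 3))) : plane R)).

Definition unit_regular_hexagon H : Prop :=
  regular_hexagon H /\ area H = 1%E.

(* Near each boundary point, in the orthonormal coordinates
   [(s, t) = (y . e, y . e^perp)] attached to a unit vector [e], the set is the
   strict epigraph [f s < t] of a Lipschitz function of one variable. *)
Definition lipschitz_boundary Omega : Prop :=
  forall x, (closure Omega `\` interior Omega) x ->
  exists (e : plane R) (f : R^o -> R^o),
    [/\ e.1 ^+ 2 + e.2 ^+ 2 = 1,
        lipschitz f &
        \forall y \near x,
          Omega y <-> f (y.1 * e.1 + y.2 * e.2) < - y.1 * e.2 + y.2 * e.1].

Definition convex_cluster Omega (k : nat) (E : 'I_k -> set (plane R)) : Prop :=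
  [/\ forall i, convex_body (E i),
      forall i, E i `<=` Omega &
      forall i j, i != j -> area (E i `&` E j) = 0%E].

Definition min_energy (F : set (plane R) -> R) Omega (k : nat) : \bar R :=
  ereal_inf [set (\sum_(i < k) F (E i))%:E | E in @convex_cluster Omega k].

Definition is_min (S : set R) (m : R) : Prop := S m /\ lbound S m.

End Planar.

(* Main.v *)
Require Import Defs.
From HB Require Import structures.
From mathcomp Require Import all_boot all_order all_algebra.
From mathcomp Require Import all_classical all_reals all_analysis.
From mathcomp Require Import zify ring lra.

Set Implicit Arguments.
Unset Strict Implicit.
Unset Printing Implicit Defensive.

Import Order.TTheory GRing.Theory Num.Theory.
Import numFieldNormedType.Exports.

Local Open Scope classical_set_scope.
Local Open Scope ring_scope.

(** The limit is a form of the hexagonal honeycomb theorem for convex cells.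
    With [s = alpha / 2], both bounds compare the minimal energy of [k] cells
    with [k `^ (s + 1) * area Omega `^ (- s) * gamma 6], the energy of [k]
    regular hexagons sharing the area of [Omega].

    Upper bound.  The cells of a fine honeycomb which are contained in an open
    set exhaust its area ([hexagon_tiling]).  For [d < 1] and large [k], at
    least [k] hexagons of area [d * area Omega / k] fit in [Omega], and
    homogeneity gives their energy ([energy_upper_bound]).

    Lower bound.  The cells of a cluster are first enlarged to polygons with six
    sides on the average.  So that the polygons do not spill out of [Omega], the
    complement of [Omega] in a large square is filled, up to an area [e], by a
    number of hexagons which does not depend on [k] ([exterior_filling]); this
    uses that a Lipschitz boundary has area zero ([boundary_null]).  All these
    bodies are enlarged together, with no overlap and inside the square
    ([cover_in_rectangle]); the polygons around the cells then have total area
    at most [area Omega + e], and their mean number of sides is 6 up to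
    [O(1 / k)].  By monotonicity each cell has at least the energy of its
    polygon, at least [gamma n] times the area to the power [- s].  The
    assumption on the means of [gamma], applied after adding boundedly many
    triangles to the list, and the inequality [power_mean] conclude
    ([cluster_lower_bound]); finally [e] tends to 0 after [k] tends to infinity.

    Enlarging cells is the geometric core ([sweep_cover]).  A vertical line
    sweeps the plane from left to right.  At each abscissa, the convex cells
    that it meets are ordered from bottom to top.  During an episode, a maximal
    range of abscissas where two given cells are neighbours in this order, one
    line separating these two cells is used as a common side of their
    enlargements; the cells also get vertical walls at their two ends.
    An episode starts because a cell begins or ends there.  Charging starts and
    ends of episodes to these cells, every cell gets at most three charges at
    each end, and twice the number of episodes is at most the number of charges
    ([side_count]).  To save the walls of the cells with three charges at one
    end, these cells are allowed to stick out there, as a wedge between the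
    lines under and over them, into the gap which their beginning closes or
    their end opens.  When such wedges make the line of the gap superfluous all
    along, this line is omitted, which is consistent because the dependencies
    between episodes are well founded ([depends_rank], [kernel_exists]).  When
    the line is needed at some abscissa, the wedges coming from the two ends of
    the gap stop on either side of it, so they do not overlap.

    The polyhedra obtained are bounded; cutting a square by their half-planes
    one after the other shows that they are polygons in the sense of [is_ngon],
    with at most as many sides as half-planes ([polyhedron_ngon]). *)

(** * Sweeping a family of intervals *)

(** A set whose membership condition refers to the set itself exists when the
    condition on an element only looks at elements of smaller rank: iterating
    the condition from any set stabilizes rank by rank. *)
Lemma kernel_exists (V : finType) (Phi : {set V} -> V -> bool) (rk : V -> nat) :
  (forall (K K' : {set V}) e,
     (forall f, (rk f < rk e)%N -> (f \in K) = (f \in K')) -> Phi K e = Phi K' e) ->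
  exists K : {set V}, forall e, (e \in K) = Phi K e.
Proof.
move=> ext.
pose S (K : {set V}) := finset (Phi K).
pose K n := iter n S (finset pred0).
have stab n : forall e, (rk e < n)%N -> (e \in K n.+1) = (e \in K n).
  elim: n => // n IH e en; rewrite !inE; apply: ext => f fe.
  by apply: IH; apply: leq_trans fe _; rewrite -ltnS.
pose N := (\max_e rk e).+1.
exists (K N) => e; rewrite -(stab N e) ?inE // ltnS.
exact: (@leq_bigmax _ rk e).
Qed.

(** A vertical line sweeps the plane.  Its positions are grouped into strips
    [0, ..., T] separated by the events at which cells begin or end: the cell
    [i] is met in the strips [A i, ..., (B i).-1], and [bel i j] says that [i]
    lies below [j]. *)
Section SweepCombinatorics.
Local Open Scope nat_scope.
Variables (I : finType) (A B : I -> nat) (T : nat) (bel : rel I).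

Definition present i t := A i <= t < B i.

Definition adjacent t l u :=
  [&& present l t, present u t, bel l u &
      [forall m, ~~ [&& present m t, bel l m & bel m u]]].

(** Transitivity and totality are only asked of cells met by a common line; cells
    met by no common line are not comparable. *)
Definition sweep_order : Prop :=
  [/\ forall i, ~~ bel i i,
      forall t i j k, present i t -> present j t -> present k t ->
        bel i j -> bel j k -> bel i k &
      forall t i j, present i t -> present j t -> i != j -> bel i j || bel j i].

Hypothesis ord : sweep_order.
Hypothesis A_gt0 : forall i, 0 < A i.
Hypothesis B_le : forall i, B i <= T.

Let bel_irr i : bel i i = false.
Proof. by case: ord => /(_ i) /negbTE. Qed.

Let bel_tr t i j k : present i t -> present j t -> present k t ->
  bel i j -> bel j k -> bel i k.
Proof. by case: ord => _ + _; apply. Qed.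

Let bel_tot t i j : present i t -> present j t -> i != j -> bel i j || bel j i.
Proof. by case: ord => _ _; apply. Qed.

Lemma adjacentP t l u : reflect
  [/\ present l t, present u t, bel l u &
      forall m, present m t -> bel l m -> bel m u -> False]
  (adjacent t l u).
Proof.
apply: (iffP and4P) => -[pl pu lu h]; split=> //.
  by move=> m pm lm mu; move/forallP: h => /(_ m) /negP; apply; apply/and3P.
by apply/forallP => m; apply/negP => /and3P[]; exact: h.
Qed.

Lemma adjacent_uniqr t l u u' : adjacent t l u -> adjacent t l u' -> u = u'.
Proof.
move=> /adjacentP[pl pu lu h] /adjacentP[_ pu' lu' h'].
apply/eqP; apply/negPn/negP => ne.
by case/orP: (bel_tot pu pu' ne) => ?; [exact: (h' u)|exact: (h u')].
Qed.

Lemma adjacent_uniql t l l' u : adjacent t l u -> adjacent t l' u -> l = l'.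
Proof.
move=> /adjacentP[pl pu lu h] /adjacentP[pl' _ lu' h'].
apply/eqP; apply/negPn/negP => ne.
by case/orP: (bel_tot pl pl' ne) => ?; [exact: (h l')|exact: (h' l)].
Qed.

Lemma upper_neighbour t l u : present l t -> present u t -> bel l u ->
  exists2 m, adjacent t l m & (m == u) || bel m u.
Proof.
move=> pl pu lu.
pose S m := [pred k | [&& present k t, bel l k & bel k m]].
pose Q m := [&& present m t, bel l m & (m == u) || bel m u].
have Qu : Q u by rewrite /Q pu lu eqxx.
have [m /and3P[pm lm mu] mmin] : exists2 m, Q m & forall k, Q k -> #|S m| <= #|S k|.
  by case: (arg_minnP (fun m => #|S m|) Qu) => m Qm mle; exists m.
exists m => //; apply/adjacentP; split=> // k pk lk km.
have ku : bel k u.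
  by case/orP: mu => [/eqP <- //|mu]; exact: (bel_tr pk pm pu km mu).
have := mmin k; rewrite /Q pk lk ku orbT => /(_ isT).
rewrite leqNgt => /negP; apply; apply: proper_card; apply/properP; split.
  apply/fintype.subsetP => j; rewrite !inE => /and3P[pj -> jk] /=.
  by rewrite pj (bel_tr pj pk pm jk km).
by exists k; rewrite !inE ?bel_irr ?andbF // pk lk.
Qed.

Notation ep := ((I * I) * ('I_T.+1 * 'I_T.+1))%type.
Implicit Types (e f : ep).
Definition elow e := e.1.1.
Definition eupp e := e.1.2.
Definition estart e : nat := e.2.1.
Definition eend e : nat := e.2.2.

(** An episode [((l, u), (t, t'))] is a maximal run of strips, from [t] to
    [t' - 1], in which [u] is the upper neighbour of [l].  Nothing is present in
    the strip 0, so that [0.-1 = 0] is harmless. *)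
Definition is_episode e :=
  [&& estart e < eend e,
      [forall r : 'I_T.+1, (estart e <= r < eend e) ==> adjacent r (elow e) (eupp e)],
      ~~ adjacent (estart e).-1 (elow e) (eupp e) &
      ~~ adjacent (eend e) (elow e) (eupp e)].

Lemma present_bound i t : present i t -> 0 < t < T.
Proof. by move=> /andP[a b]; rewrite (leq_trans (A_gt0 i) a) (leq_trans b). Qed.

Lemma is_episodeP e : reflect
  [/\ estart e < eend e,
      forall r, estart e <= r < eend e -> adjacent r (elow e) (eupp e),
      ~~ adjacent (estart e).-1 (elow e) (eupp e) &
      ~~ adjacent (eend e) (elow e) (eupp e)] (is_episode e).
Proof.
apply: (iffP and4P) => -[h1 h2 h3 h4]; split=> //.
  move=> r hr; have rT : r < T.+1.
    by case/andP: hr => _ /ltn_trans; apply; exact: ltn_ord.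
  by move/forallP: h2 => /(_ (Ordinal rT)); rewrite /= hr.
by apply/forallP => r; apply/implyP; exact: h2.
Qed.

Lemma episode_first e : is_episode e -> adjacent (estart e) (elow e) (eupp e).
Proof. by case/is_episodeP => se ae _ _; apply: ae; rewrite leqnn. Qed.

Lemma episode_last e : is_episode e -> adjacent (eend e).-1 (elow e) (eupp e).
Proof. by case/is_episodeP => se ae _ _; apply: ae; lia. Qed.

Lemma episode_inj e f t : is_episode e -> is_episode f ->
  elow e = elow f -> eupp e = eupp f ->
  estart e <= t < eend e -> estart f <= t < eend f -> e = f.
Proof.
move=> /is_episodeP[se ae pe ne] /is_episodeP[sf af pf nf] el eu te tf.
have st e1 f1 : (forall r, estart e1 <= r < eend e1 -> adjacent r (elow e) (eupp e)) ->
   ~~ adjacent (estart f1).-1 (elow e) (eupp e) -> estart e1 <= t < eend e1 ->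
   estart f1 <= t < eend f1 -> 0 < estart f1 -> estart f1 <= estart e1.
  move=> h nh te1 tf1 s0; rewrite leqNgt; apply: contra nh => lt; apply: h; lia.
have en e1 f1 : (forall r, estart e1 <= r < eend e1 -> adjacent r (elow e) (eupp e)) ->
   ~~ adjacent (eend f1) (elow e) (eupp e) -> estart e1 <= t < eend e1 ->
   estart f1 <= t < eend f1 -> eend e1 <= eend f1.
  move=> h nh te1 tf1; rewrite leqNgt; apply: contra nh => lt; apply: h; lia.
rewrite -el -eu in af pf nf.
have s0 g : (forall r, estart g <= r < eend g -> adjacent r (elow e) (eupp e)) ->
   estart g < eend g -> 0 < estart g.
  move=> h sg; have /adjacentP[/present_bound] := h (estart g) ltac:(lia).
  by case/andP.
have S : estart e = estart f.
  by apply/eqP; rewrite eqn_leq (st f e) // ?(st e f) //; exact: s0.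
have E : eend e = eend f by apply/eqP; rewrite eqn_leq (en f e) // ?(en e f).
case: e f {se ae pe ne te sf af pf nf tf st en s0} el eu S E
  => [[l u] [s t1]] [[l' u'] [s' t1']].
rewrite /elow /eupp /estart /eend /= => -> -> S E.
by rewrite (val_inj S) (val_inj E).
Qed.

Lemma episode_exists t l u : adjacent t l u ->
  exists e, [/\ is_episode e, elow e = l, eupp e = u & estart e <= t < eend e].
Proof.
move=> atlu; have /adjacentP[/present_bound /andP[t0 tT] _ _ _] := atlu.
have exs : exists s, [&& s <= t & [forall r : 'I_T.+1, (s <= r <= t) ==> adjacent r l u]].
  exists t; rewrite leqnn; apply/forallP => r; apply/implyP => h.
  by have -> : (r : nat) = t by lia.
have [s /andP[st /forallP hs] smin] := ex_minnP exs.
have exe : exists e : nat, (t < e) && ~~ adjacent e l u.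
  exists T; rewrite tT; apply/negP => /adjacentP[/present_bound]; lia.
have [e /andP[te he] emin] := ex_minnP exe.
have eT : e <= T.
  by apply: emin; rewrite tT; apply/negP => /adjacentP[/present_bound]; lia.
have sT : s < T.+1 by lia.
have eT' : e < T.+1 by lia.
exists ((l, u), (Ordinal sT, Ordinal eT')); split=> //=; last first.
  by rewrite /estart /eend /= st te.
apply/is_episodeP; rewrite /estart /eend /elow /eupp /=; split=> //; first lia.
- move=> r hr; case: (leqP r t) => rt.
    have rT : r < T.+1 by lia.
    by have := hs (Ordinal rT); rewrite /= rt; case/andP: hr => -> _.
  apply/negPn/negP => nr.
  by have := emin r; rewrite rt nr => /(_ isT); lia.
- apply/negP => hp.
  have s0 : 0 < s.
    by rewrite lt0n; apply/negP => /eqP s0; move: hp; rewrite s0 => /adjacentP[/present_bound].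
  suff : s <= s.-1 by lia.
  apply: smin; apply/andP; split; first lia.
  apply/forallP => r; apply/implyP => hr.
  case: (ltnP r s) => rs; first by have -> : (r : nat) = s.-1 by lia.
  by have := hs r; rewrite rs; case/andP: hr => _ ->.
Qed.

(** Every start of an episode has a cause, the cell to which it is charged: the
    upper cell if it begins there ([opens_lower], the episode then lies under
    the new cell), or else the lower cell if it begins there ([opens_upper]), or
    else the cell ending there which used to lie between the two ([opens_end]).
    The ends of episodes are charged in the mirrored way.  At its left end a
    cell can thus be charged with the two starts under and over it and with the
    end of the gap into which it comes ([closes_start]). *)
Definition opens_lower e i := (eupp e == i) && (A i == estart e).
Definition opens_upper e i :=
  [&& elow e == i, A i == estart e & A (eupp e) != estart e].
Definition opens_end e i :=
  [&& A (elow e) != estart e, A (eupp e) != estart e &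
      adjacent (estart e).-1 (elow e) i].
Definition closes_lower e i := (eupp e == i) && (B i == eend e).
Definition closes_upper e i :=
  [&& elow e == i, B i == eend e & B (eupp e) != eend e].
Definition closes_start e i :=
  [&& B (elow e) != eend e, B (eupp e) != eend e &
      adjacent (eend e) (elow e) i].

Lemma opens_exists e : is_episode e ->
  exists i, [|| opens_lower e i, opens_upper e i | opens_end e i].
Proof.
move=> ee; have /is_episodeP[se ae pe ne] := ee.
have /adjacentP[pl pu lu _] := episode_first ee.
case: (boolP (A (eupp e) == estart e)) => Au.
  by exists (eupp e); rewrite /opens_lower eqxx Au.
case: (boolP (A (elow e) == estart e)) => Al.
  by exists (elow e); rewrite /opens_upper eqxx Au Al orbT.
have pl' : present (elow e) (estart e).-1.
  by move: pl Al; rewrite /present; lia.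
have pu' : present (eupp e) (estart e).-1.
  by move: pu Au; rewrite /present; lia.
have [m am _] := upper_neighbour pl' pu' lu.
by exists m; rewrite /opens_end Au Al am !orbT.
Qed.

Lemma closes_exists e : is_episode e ->
  exists i, [|| closes_lower e i, closes_upper e i | closes_start e i].
Proof.
move=> ee; have /is_episodeP[se ae pe ne] := ee.
have [pl pu lu] : [/\ present (elow e) (eend e).-1, present (eupp e) (eend e).-1 &
    bel (elow e) (eupp e)].
  by have /adjacentP[] := episode_last ee.
case: (boolP (B (eupp e) == eend e)) => Au.
  by exists (eupp e); rewrite /closes_lower eqxx Au.
case: (boolP (B (elow e) == eend e)) => Al.
  by exists (elow e); rewrite /closes_upper eqxx Au Al orbT.
have pl' : present (elow e) (eend e).
  by move: pl Al; rewrite /present; lia.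
have pu' : present (eupp e) (eend e).
  by move: pu Au; rewrite /present; lia.
have [m am _] := upper_neighbour pl' pu' lu.
by exists m; rewrite /closes_start Au Al am !orbT.
Qed.

Lemma episode_inj_upper e f t : is_episode e -> is_episode f -> eupp e = eupp f ->
  estart e <= t < eend e -> estart f <= t < eend f -> e = f.
Proof.
move=> ee ef uu te tf; apply: (episode_inj ee ef _ uu te tf).
have /is_episodeP[_ ae _ _] := ee; have /is_episodeP[_ af _ _] := ef.
by have := ae t te; rewrite uu => a1; exact: (adjacent_uniql a1 (af t tf)).
Qed.

Lemma episode_inj_lower e f t : is_episode e -> is_episode f -> elow e = elow f ->
  estart e <= t < eend e -> estart f <= t < eend f -> e = f.
Proof.
move=> ee ef ll te tf; apply: (episode_inj ee ef ll _ te tf).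
have /is_episodeP[_ ae _ _] := ee; have /is_episodeP[_ af _ _] := ef.
by have := ae t te; rewrite ll => a1; exact: (adjacent_uniqr a1 (af t tf)).
Qed.

Let episode_starts e t : is_episode e -> t = estart e -> estart e <= t < eend e.
Proof. by move=> /is_episodeP[se _ _ _] ->; rewrite leqnn. Qed.

Let episode_ends e t : is_episode e -> t = eend e -> estart e <= t.-1 < eend e.
Proof. by move=> /is_episodeP[se _ _ _] ->; lia. Qed.

Lemma opens_lower_inj e f i : is_episode e -> is_episode f ->
  opens_lower e i -> opens_lower f i -> e = f.
Proof.
move=> ee ef /andP[/eqP ue /eqP se] /andP[/eqP uf /eqP sf].
apply: (episode_inj_upper (t := A i)) => //; first (by rewrite ue); exact: episode_starts.
Qed.

Lemma opens_upper_inj e f i : is_episode e -> is_episode f ->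
  opens_upper e i -> opens_upper f i -> e = f.
Proof.
move=> ee ef /and3P[/eqP ue /eqP se _] /and3P[/eqP uf /eqP sf _].
apply: (episode_inj_lower (t := A i)) => //; first (by rewrite ue); exact: episode_starts.
Qed.

Lemma closes_lower_inj e f i : is_episode e -> is_episode f ->
  closes_lower e i -> closes_lower f i -> e = f.
Proof.
move=> ee ef /andP[/eqP ue /eqP se] /andP[/eqP uf /eqP sf].
apply: (episode_inj_upper (t := (B i).-1)) => //; first (by rewrite ue); exact: episode_ends.
Qed.

Lemma closes_upper_inj e f i : is_episode e -> is_episode f ->
  closes_upper e i -> closes_upper f i -> e = f.
Proof.
move=> ee ef /and3P[/eqP ue /eqP se _] /and3P[/eqP uf /eqP sf _].
apply: (episode_inj_lower (t := (B i).-1)) => //; first (by rewrite ue); exact: episode_ends.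
Qed.

(** The neighbour over [elow e] one strip before [e] starts is neither present
    when [e] starts nor equal to [eupp e]: it ends there, between the two. *)
Lemma opens_end_time e i : is_episode e -> opens_end e i ->
  [/\ B i = estart e, A i < B i & bel (elow e) i && bel i (eupp e)].
Proof.
move=> ee /and3P[Al Au /adjacentP[pl pi li hi]].
have /is_episodeP[se ae pe ne] := ee.
have /adjacentP[pl1 pu1 lu h] := episode_first ee.
have pu : present (eupp e) (estart e).-1 by move: pu1 Au; rewrite /present; lia.
have iu : bel i (eupp e).
  have ne' : i != eupp e.
    by apply: contra pe => /eqP <-; apply/adjacentP.
  case/orP: (bel_tot pi pu ne') => // ui; by case: (hi _ pu lu ui).
have npi : ~~ present i (estart e) by apply/negP => pi'; case: (h i pi' li iu).
by rewrite li iu; move: pi npi; rewrite /present => pi npi; split=> //; clear -pi npi; lia.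
Qed.

Lemma closes_start_time e i : is_episode e -> closes_start e i ->
  [/\ A i = eend e, A i < B i & bel (elow e) i && bel i (eupp e)].
Proof.
move=> ee /and3P[Al Au /adjacentP[pl pi li hi]].
have /is_episodeP[se ae pe ne] := ee.
have /adjacentP[pl1 pu1 lu h] := episode_last ee.
have pu : present (eupp e) (eend e) by move: pu1 Au; rewrite /present; lia.
have iu : bel i (eupp e).
  have ne' : i != eupp e.
    by apply: contra ne => /eqP <-; apply/adjacentP.
  case/orP: (bel_tot pi pu ne') => // ui; by case: (hi _ pu lu ui).
have npi : ~~ present i (eend e).-1 by apply/negP => pi'; case: (h i pi' li iu).
by rewrite li iu; move: pi npi; rewrite /present => pi npi; split=> //; clear -pi npi; lia.
Qed.

Lemma opens_end_inj e f i : is_episode e -> is_episode f ->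
  opens_end e i -> opens_end f i -> e = f.
Proof.
move=> ee ef oe of'; have [se _ _] := opens_end_time ee oe.
have [sf _ _] := opens_end_time ef of'.
case/and3P: oe => _ _; rewrite -se => al; case/and3P: of' => _ _; rewrite -sf => al'.
by apply: (episode_inj_lower (t := B i)) (adjacent_uniql al al') _ _ => //; exact: episode_starts.
Qed.

Lemma closes_start_inj e f i : is_episode e -> is_episode f ->
  closes_start e i -> closes_start f i -> e = f.
Proof.
move=> ee ef oe of'; have [se _ _] := closes_start_time ee oe.
have [sf _ _] := closes_start_time ef of'.
case/and3P: oe => _ _; rewrite -se => al; case/and3P: of' => _ _; rewrite -sf => al'.
by apply: (episode_inj_lower (t := (A i).-1)) (adjacent_uniql al al') _ _ => //; exact: episode_ends.
Qed.

(** The sides of the enlarged cells come from a set [K] of episodes, each giving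
    one side to each of its two cells, and from vertical walls. *)
Section Count.
Variable K : {set ep}.
Hypothesis Kep : forall e, e \in K -> is_episode e.

Definition used (tag : ep -> I -> bool) i := [exists e in K, tag e i].

(** Doing without the wall exactly when the left end of the cell carries its
    maximal number of charges is what bounds the charges and the wall at each
    end by 3, hence the number of sides by 6 per cell. *)
Definition left_wall i :=
  ~~ [&& used opens_lower i, used opens_upper i & used closes_start i].

Definition right_wall i :=
  ~~ [&& used closes_lower i, used closes_upper i & used opens_end i].

Lemma card_tagged (tag : ep -> I -> bool) :
  (forall e f i, is_episode e -> is_episode f -> tag e i -> tag f i -> e = f) ->
  \sum_(e in K) \sum_i tag e i <= \sum_i used tag i.
Proof.
move=> inj; rewrite exchange_big /=; apply: leq_sum => i _.
case: (boolP (used tag i)) => [/existsP[e /andP[eK te]]|nu].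
  rewrite (bigD1 e) //= big1 ?addn0 ?leq_b1 // => f /andP[fK ne].
  apply/eqP; rewrite eqb0; apply: contra ne => tf; apply/eqP.
  by apply: (inj _ _ i) => //; exact: Kep.
rewrite big1 // => e eK; apply/eqP; rewrite eqb0; apply: contra nu => te.
by apply/existsP; exists e; rewrite eK.
Qed.

Lemma card_le_tags (t1 t2 t3 : ep -> I -> bool) :
  (forall e, is_episode e -> exists i, [|| t1 e i, t2 e i | t3 e i]) ->
  (forall e f i, is_episode e -> is_episode f -> t1 e i -> t1 f i -> e = f) ->
  (forall e f i, is_episode e -> is_episode f -> t2 e i -> t2 f i -> e = f) ->
  (forall e f i, is_episode e -> is_episode f -> t3 e i -> t3 f i -> e = f) ->
  #|K| <= \sum_i (used t1 i + used t2 i + used t3 i).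
Proof.
move=> ex i1 i2 i3; rewrite !big_split /=.
apply: (leq_trans _ (leq_add (leq_add (card_tagged i1) (card_tagged i2)) (card_tagged i3))).
rewrite -sum1_card -!big_split /=; apply: leq_sum => e eK.
have [i ti] := ex _ (Kep eK).
rewrite -!big_split /= (bigD1 i) //=; apply: leq_trans (leq_addr _ _).
by case/or3P: ti => ->; lia.
Qed.

Lemma card_by_end (g : ep -> I) :
  \sum_i #|[pred e in K | g e == i]| = #|K|.
Proof.
rewrite -sum1_card (partition_big g xpredT) //=; apply: eq_bigr => i _.
by rewrite -sum1_card; apply: eq_bigl => e; rewrite inE.
Qed.

(** [K] has at most as many episodes as starts are charged, and at most as many
    as ends are charged, so that [2 * #|K|] sides and the walls amount to at
    most 3 at each end of each cell. *)
Lemma side_count :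
  \sum_i (#|[pred e in K | elow e == i]| + #|[pred e in K | eupp e == i]| +
          (left_wall i + right_wall i)) <= 6 * #|I|.
Proof.
rewrite !big_split /= !card_by_end.
have := card_le_tags opens_exists opens_lower_inj opens_upper_inj opens_end_inj.
have := card_le_tags closes_exists closes_lower_inj closes_upper_inj closes_start_inj.
set s1 := \sum_i _; set s2 := \sum_i _ => h1 h2.
set w1 := \sum_i left_wall i; set w2 := \sum_i right_wall i.
have : s1 + s2 + (w1 + w2) <= 6 * #|I|.
  rewrite mulnC -sum_nat_const -!big_split /=; apply: leq_sum => i _.
  rewrite /left_wall /right_wall.
  by do 6 case: (used _ i).
by clearbody s1 s2 w1 w2 => hs; apply: leq_trans hs; rewrite leq_add2r leq_add.
Qed.
End Count.

Lemma present_next i t : 0 < t -> present i t.-1 -> B i != t -> present i t.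
Proof. by rewrite /present; lia. Qed.

Lemma present_prev i t : present i t -> A i != t -> present i t.-1.
Proof. by rewrite /present; lia. Qed.

(** A cell [i] without a left wall sticks out, between the episodes [f] under
    and over it, into the gap of the episode [e] which its beginning closes. *)
Definition depends e f :=
  [exists i, closes_start e i && (opens_lower f i || opens_upper f i)] ||
  [exists i, opens_end e i && (closes_lower f i || closes_upper f i)].

(** Chains of dependencies never turn back: an episode reached through
    [closes_start] starts with the beginning of one of its cells, hence has no
    [opens_end] charge, and the chain moves on to the right.  The rank is the
    room left to the chain in its direction. *)
Definition episode_rank e :=
  let l := (A (elow e) == estart e) || (A (eupp e) == estart e) in
  let r := (B (elow e) == eend e) || (B (eupp e) == eend e) in
  if l && r then 0 else if l then T - estart e else if r then eend e : nat else T.+1.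

Lemma depends_rank e f : is_episode e -> is_episode f -> depends e f ->
  episode_rank f < episode_rank e.
Proof.
move=> ee ef.
have /is_episodeP[se _ _ _] := ee; have /is_episodeP[sf _ _ _] := ef.
have eT : eend e <= T by rewrite -ltnS; exact: ltn_ord.
have fT : eend f <= T by rewrite -ltnS; exact: ltn_ord.
case/orP => /existsP[i /andP[ti]] hf.
  have [Ai _ _] := closes_start_time ee ti; case/and3P: ti => nl nu _.
  have lf : (A (elow f) == estart f) || (A (eupp f) == estart f).
    by case/orP: hf => [/andP[/eqP -> ->]|/and3P[/eqP -> -> _]]; rewrite ?orbT.
  have sfe : estart f = eend e.
    by case/orP: hf => [/andP[_ /eqP]|/and3P[_ /eqP]]; lia.
  rewrite /episode_rank lf (negbTE nl) (negbTE nu) /= andbF.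
  move: ((A (elow e) == _) || _) ((B (elow f) == _) || _) => [] [] /=;
    clear -se sf eT fT sfe; lia.
have [Bi _ _] := opens_end_time ee ti; case/and3P: ti => nl nu _.
have rf : (B (elow f) == eend f) || (B (eupp f) == eend f).
  by case/orP: hf => [/andP[/eqP -> ->]|/and3P[/eqP -> -> _]]; rewrite ?orbT.
have sfe : eend f = estart e.
  by case/orP: hf => [/andP[_ /eqP]|/and3P[_ /eqP]]; lia.
rewrite /episode_rank rf (negbTE nl) (negbTE nu) /= andbT.
move: ((B (elow e) == _) || _) ((A (elow f) == _) || _) => [] [] /=;
  clear -se sf eT fT sfe; lia.
Qed.

(** When the three charges at the left end of [i] are used, the episodes under
    and over [i] have as other cells the two cells of the gap which [i] closes:
    no other cell lies between these two just before and just after. *)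
Lemma left_wedge e e1 e2 i : is_episode e -> is_episode e1 -> is_episode e2 ->
  closes_start e i -> opens_lower e1 i -> opens_upper e2 i ->
  [/\ eupp e1 = i, elow e2 = i, elow e1 = elow e, eupp e2 = eupp e & A i = eend e].
Proof.
move=> ee ee1 ee2 ci /andP[/eqP u1 /eqP s1] /and3P[/eqP l2 /eqP s2 Au2].
have [Ai _ /andP[li iu]] := closes_start_time ee ci; case/and3P: ci => Bl Bu.
have /is_episodeP[he ae pe ne] := ee.
have /is_episodeP[he1 ae1 _ _] := ee1; have /is_episodeP[he2 ae2 _ _] := ee2.
rewrite -Ai => ali; split=> //.
  apply: (@adjacent_uniql (A i) _ _ i) => //.
  by rewrite -[X in adjacent _ _ X]u1 s1; exact: episode_first.
have a2 : adjacent (A i) i (eupp e2).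
  by rewrite -[X in adjacent _ X _]l2 s2; exact: episode_first.
apply/eqP; apply/negPn/negP => ne2.
have /adjacentP[pi pu2 iu2 h2] := a2; have /adjacentP[pl _ _ _] := ali.
have /adjacentP[pl' pu' lu h] := episode_last ee.
have pu : present (eupp e) (A i).
  by rewrite Ai; apply: present_next => //; exact: leq_ltn_trans (leq0n _) he.
have pu2' : present (eupp e2) (eend e).-1.
  by rewrite -Ai; apply: present_prev; rewrite // s2.
case/orP: (bel_tot pu2 pu ne2) => [u2u|uu2]; last exact: (h2 _ pu iu uu2).
exact: (h _ pu2' (bel_tr pl pi pu2 li iu2) u2u).
Qed.

Lemma right_wedge e f1 f2 i : is_episode e -> is_episode f1 -> is_episode f2 ->
  opens_end e i -> closes_lower f1 i -> closes_upper f2 i ->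
  [/\ eupp f1 = i, elow f2 = i, elow f1 = elow e, eupp f2 = eupp e & B i = estart e].
Proof.
move=> ee ee1 ee2 ci /andP[/eqP u1 /eqP s1] /and3P[/eqP l2 /eqP s2 Au2].
have [Bi _ /andP[li iu]] := opens_end_time ee ci; case/and3P: ci => Al Au.
have /is_episodeP[he ae pe ne] := ee.
have /is_episodeP[he1 ae1 _ _] := ee1; have /is_episodeP[he2 ae2 _ _] := ee2.
rewrite -Bi => ali; split=> //.
  apply: (@adjacent_uniql (B i).-1 _ _ i) => //.
  by rewrite -[X in adjacent _ _ X]u1 s1; exact: episode_last.
have a2 : adjacent (B i).-1 i (eupp f2).
  by rewrite -[X in adjacent _ X _]l2 s2; exact: episode_last.
apply/eqP; apply/negPn/negP => ne2.
have /adjacentP[pi pu2 iu2 h2] := a2; have /adjacentP[pl _ _ _] := ali.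
have /adjacentP[pl' pu' lu h] := episode_first ee.
have pu : present (eupp e) (B i).-1.
  by rewrite Bi; exact: present_prev.
have pu2' : present (eupp f2) (estart e).
  rewrite -Bi; apply: present_next; rewrite // ?s2 //.
  exact: leq_ltn_trans (leq0n _) he2.
case/orP: (bel_tot pu2 pu ne2) => [u2u|uu2]; last exact: (h2 _ pu iu uu2).
exact: (h _ pu2' (bel_tr pl pi pu2 li iu2) u2u).
Qed.
End SweepCombinatorics.

Lemma lower_neighbour (I : finType) (A B : I -> nat) (bel : rel I) t l u :
  sweep_order A B bel -> present A B l t -> present A B u t -> bel l u ->
  exists2 m, adjacent A B bel t m u & (m == l) || bel l m.
Proof.
move=> [irr tr tot] pl pu lu.
have ord : sweep_order A B (fun i j => bel j i).
  split=> // [t' i j k pi pj pk ji kj|t' i j pi pj ij]; first exact: (tr t' k j i).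
  by rewrite orbC; exact: (tot t').
have [m /adjacentP[_ pm mu h] ml] := upper_neighbour ord pu pl lu.
by exists m => //; apply/adjacentP; split=> // k pk mk ku; exact: (h k).
Qed.

(** * Enlarging cells to polyhedra *)

Section HalfPlanes.
Variable R : realType.

(** Half-planes are encoded by the coefficients [((c, a), b)] of the affine
    function [c + a x + b y], which is nonnegative on them. *)
Definition hval (h : R * R * R) (z : plane R) : R := h.1.1 + h.1.2 * z.1 + h.2 * z.2.

Definition polyhedron (s : seq (R * R * R)) : set (plane R) :=
  [set z | all (fun h => 0 <= hval h z) s].

Lemma polyhedronP s z : polyhedron s z <-> forall h, h \in s -> 0 <= hval h z.
Proof. by split=> [/allP|h]; [|apply/allP]. Qed.

Lemma affine_le_between (p1 q1 p2 q2 x c x' : R) : (x < c) || (c < x) ->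
  (x <= x' <= c) || (c <= x' <= x) ->
  p1 * x + q1 <= p2 * x + q2 -> p1 * c + q1 <= p2 * c + q2 ->
  p1 * x' + q1 <= p2 * x' + q2.
Proof.
have key u v : u < v -> u <= x' <= v -> p1 * u + q1 <= p2 * u + q2 ->
    p1 * v + q1 <= p2 * v + q2 -> p1 * x' + q1 <= p2 * x' + q2.
  move=> uv /andP[ux xv] hu hv; rewrite -subr_ge0 -(pmulr_rge0 _ (_ : 0 < v - u)) ?subr_gt0 //.
  have -> : (v - u) * (p2 * x' + q2 - (p1 * x' + q1)) =
      (p2 * v + q2 - (p1 * v + q1)) * (x' - u) + (p2 * u + q2 - (p1 * u + q1)) * (v - x').
    by ring.
  by rewrite addr_ge0 // mulr_ge0 ?subr_ge0.
case/orP => lt /orP[] h h1 h2; [exact: key lt h h1 h2|lra|lra|exact: key lt h h2 h1].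
Qed.

Definition ordered_at (P Q : set (plane R)) x :=
  (forall y y', P (x, y) -> Q (x, y') -> y <= y') \/
  (forall y y', P (x, y) -> Q (x, y') -> y' <= y).

Definition spanned_at (I : Type) (E : I -> set (plane R)) x y := exists j j' y1 y2,
  [/\ E j (x, y1), E j' (x, y2) & y1 <= y <= y2].
End HalfPlanes.

(** The cells [E i] have abscissas in [[a i, b i]], and [l i j] gives the slope
    and intercept of a line separating two cells which lie one below the other. *)
Section SweepCover.
Variables (R : realType) (I : finType) (E : I -> set (plane R)).
Variables (a b : I -> R) (bel : rel I) (l : I -> I -> R * R).

Hypothesis ltab : forall i, a i < b i.
Hypothesis E_range : forall i z, E i z -> a i <= z.1 <= b i.
Hypothesis E_slice : forall i x, a i <= x <= b i -> exists y, E i (x, y).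
Hypothesis bel_irr : forall i, ~~ bel i i.
Hypothesis bel_tr : forall x i j k, a i < x < b i -> a j < x < b j ->
  a k < x < b k -> bel i j -> bel j k -> bel i k.
Hypothesis bel_tot : forall x i j, a i < x < b i -> a j < x < b j ->
  i != j -> bel i j || bel j i.
Hypothesis E_below : forall i j z, bel i j -> E i z -> z.2 <= (l i j).1 * z.1 + (l i j).2.
Hypothesis E_above : forall i j z, bel i j -> E j z -> (l i j).1 * z.1 + (l i j).2 <= z.2.

(** Numbers the strips; it is constant between two consecutive events. *)
Definition erank (x : R) : nat :=
  #|[pred p : I * bool | (if p.2 then a p.1 else b p.1) <= x]|.
Let T := #|{: I * bool}|.
Let A i := erank (a i).
Let B i := erank (b i).
Definition is_event (x : R) := exists i, x = a i \/ x = b i.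

Let erank_mono x y : x <= y -> (erank x <= erank y)%N.
Proof.
move=> xy; apply/subset_leq_card/fintype.subsetP => p; rewrite !inE => px.
exact: le_trans px xy.
Qed.

Let erank_lt (p : I * bool) x :
  x < (if p.2 then a p.1 else b p.1) ->
  (erank x < erank (if p.2 then a p.1 else b p.1))%N.
Proof.
move=> xp; apply/proper_card/properP; split.
  by apply/fintype.subsetP => q; rewrite !inE => /le_trans; apply; exact: ltW.
by exists p; rewrite !inE // -ltNge.
Qed.

Let A_le i x : (A i <= erank x)%N = (a i <= x).
Proof.
case: (leP (a i) x) => [|xa]; first exact: erank_mono.
by apply/negbTE; rewrite -ltnNge; exact: (@erank_lt (i, true)).
Qed.

Let B_le i x : (B i <= erank x)%N = (b i <= x).
Proof.
case: (leP (b i) x) => [|xa]; first exact: erank_mono.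
by apply/negbTE; rewrite -ltnNge; exact: (@erank_lt (i, false)).
Qed.

Let presentE i x : present A B i (erank x) = (a i <= x < b i).
Proof. by rewrite /present A_le ltnNge B_le -ltNge. Qed.

Let present_lt i j t : present A B i t -> present A B j t -> a i < b j.
Proof.
move=> /andP[Ai _] /andP[_ Bj]; rewrite ltNge -B_le -ltnNge.
exact: leq_ltn_trans Ai Bj.
Qed.

Let A_gt0 i : (0 < A i)%N.
Proof. by apply/card_gt0P; exists (i, true); rewrite inE /=. Qed.

Let B_leT i : (B i <= T)%N.
Proof. exact: max_card. Qed.

(** The last beginning comes before the first end; take an abscissa between. *)
Let common_point (s : seq I) t : (0 < size s)%N ->
  (forall i, i \in s -> present A B i t) ->
  exists x, forall i, i \in s -> a i < x < b i.
Proof.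
case: s => // i0 s _ pr.
have [im ims amax] : exists2 i, i \in i0 :: s & forall j, j \in i0 :: s -> a j <= a i.
  case: (@arg_maxP _ R I i0 (mem (i0 :: s)) a); first exact: mem_head.
  by move=> i ii ai; exists i.
have [jm jms bmin] : exists2 i, i \in i0 :: s & forall j, j \in i0 :: s -> b i <= b j.
  case: (@arg_minP _ R I i0 (mem (i0 :: s)) b); first exact: mem_head.
  by move=> i ii ai; exists i.
have ab := present_lt (pr _ ims) (pr _ jms).
exists ((a im + b jm) / 2) => i ii.
by have := amax i ii; have := bmin i ii; lra.
Qed.

Let sord : sweep_order A B bel.
Proof.
split=> [i|t i j k pi pj pk|t i j pi pj ij]; first exact: bel_irr.
  have [|x hx] := @common_point [:: i; j; k] t isT.
    by move=> m; rewrite !inE => /or3P[] /eqP ->.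
  by apply: (bel_tr (x := x)); apply: hx; rewrite !inE eqxx ?orbT.
have [|x hx] := @common_point [:: i; j] t isT.
  by move=> m; rewrite !inE => /orP[] /eqP ->.
by apply: (bel_tot (x := x)) => //; apply: hx; rewrite !inE eqxx ?orbT.
Qed.

Notation ep := ((I * I) * ('I_T.+1 * 'I_T.+1))%type.
Notation is_ep := (is_episode A B bel).

Let line (e : ep) x := (l (elow e) (eupp e)).1 * x + (l (elow e) (eupp e)).2.

(** The enlarged cell [i] which closes the gap of [e], having no left wall, fills
    there the wedge between the lines of the episodes under and over it.  Where
    these lines are in this order, they already separate the cells of [e], and
    the line of [e] is superfluous. *)
Let lwedge (K : {set ep}) (e : ep) x := exists i e1 e2,
  [/\ is_ep e1, is_ep e2, e1 \in K, e2 \in K &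
   [/\ closes_start A B bel e i, opens_lower A e1 i, opens_upper A e2 i & line e1 x <= line e2 x]].
Let rwedge (K : {set ep}) (e : ep) x := exists i f1 f2,
  [/\ is_ep f1, is_ep f2, f1 \in K, f2 \in K &
   [/\ opens_end A B bel e i, closes_lower B f1 i, closes_upper B f2 i & line f1 x <= line f2 x]].

(** An episode is kept as soon as its line is needed at one abscissa. *)
Let Phi (K : {set ep}) (e : ep) : bool :=
  is_ep e && `[< exists x, [/\ (estart e <= erank x < eend e)%N,
     ~ lwedge K e x & ~ rwedge K e x] >].

Let kept_exists : exists K : {set ep}, forall e, (e \in K) = Phi K e.
Proof.
apply: (@kernel_exists ep Phi (@episode_rank I A B T)) => K K' e KK'.
rewrite /Phi; case: (boolP (is_ep e)) => //= ee.
have dep f : is_ep f -> depends A B bel e f -> (f \in K) = (f \in K').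
  by move=> ef df; apply: KK'; exact: (depends_rank sord).
have imp (K1 K2 : {set ep}) : (forall f, is_ep f -> depends A B bel e f -> (f \in K1) = (f \in K2)) ->
    (exists x, [/\ (estart e <= erank x < eend e)%N, ~ lwedge K1 e x & ~ rwedge K1 e x]) ->
    exists x, [/\ (estart e <= erank x < eend e)%N, ~ lwedge K2 e x & ~ rwedge K2 e x].
  move=> d [x [xe nl nr]]; exists x; split=> //.
    move=> [i [e1 [e2 [ee1 ee2 k1 k2 [c1 c2 c3 c4]]]]]; apply: nl; exists i, e1, e2.
    by split=> //; rewrite d // /depends; apply/orP; left; apply/existsP;
      exists i; rewrite c1 ?c2 ?c3 ?orbT.
  move=> [i [e1 [e2 [ee1 ee2 k1 k2 [c1 c2 c3 c4]]]]]; apply: nr; exists i, e1, e2.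
  by split=> //; rewrite d // /depends; apply/orP; right; apply/existsP;
    exists i; rewrite c1 ?c2 ?c3 ?orbT.
by apply/asboolP/asboolP; apply: imp => f ef df; rewrite dep.
Qed.

Let K : {set ep} := sval (cid kept_exists).

Let KE e : (e \in K) = Phi K e.
Proof. exact: (svalP (cid kept_exists)). Qed.

Let Kep e : e \in K -> is_ep e.
Proof. by rewrite KE => /andP[]. Qed.

Let upper_side (e : ep) : R * R * R :=
  ((l (elow e) (eupp e)).2, (l (elow e) (eupp e)).1, -1).
Let lower_side (e : ep) : R * R * R :=
  (- (l (elow e) (eupp e)).2, - (l (elow e) (eupp e)).1, 1).

Let sides i : seq (R * R * R) :=
  [seq upper_side e | e <- enum [pred e in K | elow e == i]] ++
  [seq lower_side e | e <- enum [pred e in K | eupp e == i]] ++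
  (if left_wall A B bel K i then [:: (- a i, 1, 0)] else [::]) ++
  (if right_wall A B bel K i then [:: (b i, -1, 0)] else [::]).

Let size_sides : (\sum_i size (sides i) <= 6 * #|I|)%N.
Proof.
apply: leq_trans _ (side_count sord A_gt0 B_leT Kep).
apply: leq_sum => i _; rewrite /sides !size_cat !size_map -!cardE addnA.
by case: left_wall; case: right_wall.
Qed.

Let P i := polyhedron (sides i).

Let P_upper e z : e \in K -> P (elow e) z -> z.2 <= line e z.1.
Proof.
move=> eK /polyhedronP /(_ (upper_side e)); rewrite /sides !mem_cat map_f.
  by move=> /(_ isT); rewrite /hval /line /=; lra.
by rewrite mem_enum inE eK eqxx.
Qed.

Let P_lower e z : e \in K -> P (eupp e) z -> line e z.1 <= z.2.
Proof.
move=> eK /polyhedronP /(_ (lower_side e)); rewrite /sides !mem_cat [X in _ || (X || _)]map_f.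
  by rewrite orbT => /(_ isT); rewrite /hval /line /=; lra.
by rewrite mem_enum inE eK eqxx.
Qed.

Let P_left i z : P i z -> left_wall A B bel K i -> a i <= z.1.
Proof.
move=> /polyhedronP /(_ (- a i, 1, 0)) + lw; rewrite /sides !mem_cat lw !inE eqxx !orbT.
by move=> /(_ isT); rewrite /hval /=; lra.
Qed.

Let P_right i z : P i z -> right_wall A B bel K i -> z.1 <= b i.
Proof.
move=> /polyhedronP /(_ (b i, -1, 0)) + lw; rewrite /sides !mem_cat lw !inE eqxx !orbT.
by move=> /(_ isT); rewrite /hval /=; lra.
Qed.

Let episode_bel (e : ep) : is_ep e -> bel (elow e) (eupp e).
Proof. by move=> /episode_first/adjacentP[]. Qed.

Let EP i : E i `<=` P i.
Proof.
move=> z Ez; apply/polyhedronP => h; rewrite /sides !mem_cat => /or4P[].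
- case/mapP => e; rewrite mem_enum inE => /andP[/Kep/episode_bel be /eqP ei] ->.
  by have := E_below be; rewrite ei => /(_ z Ez); rewrite /hval /= ei; lra.
- case/mapP => e; rewrite mem_enum inE => /andP[/Kep/episode_bel be /eqP ei] ->.
  by have := E_above be; rewrite ei => /(_ z Ez); rewrite /hval /= ei; lra.
- by case: left_wall => //; rewrite inE => /eqP ->; rewrite /hval /=; have := E_range Ez; lra.
- by case: right_wall => //; rewrite inE => /eqP ->; rewrite /hval /=; have := E_range Ez; lra.
Qed.

Let slice_point i x : present A B i (erank x) -> exists y, E i (x, y).
Proof. by rewrite presentE => h; apply: E_slice; lra. Qed.

(** At an abscissa where the line of the episode is superfluous, the two sides
    of a wedge take its place. *)
Let adjacent_sep x i j y y' : adjacent A B bel (erank x) i j ->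
  P i (x, y) -> P j (x, y') -> y <= y'.
Proof.
move=> /(episode_exists A_gt0 B_leT)[e [ee <- <- xe]] Py Py'.
case: (boolP (e \in K)) => [eK|].
  exact: le_trans (P_upper eK Py) (P_lower eK Py').
rewrite KE /Phi ee /= => /asboolPn/forallNP/(_ x) nx.
have [[i0 [e1 [e2 [ee1 ee2 k1 k2 [c1 c2 c3 c4]]]]]|nl] := pselect (lwedge K e x).
  have [u1 l2 l1 u2 _] := left_wedge sord ee ee1 ee2 c1 c2 c3.
  rewrite -l1 in Py; rewrite -u2 in Py'.
  exact: le_trans (P_upper k1 Py) (le_trans c4 (P_lower k2 Py')).
have [[i0 [e1 [e2 [ee1 ee2 k1 k2 [c1 c2 c3 c4]]]]]|nr] := pselect (rwedge K e x).
  have [u1 l2 l1 u2 _] := right_wedge sord ee ee1 ee2 c1 c2 c3.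
  rewrite -l1 in Py; rewrite -u2 in Py'.
  exact: le_trans (P_upper k1 Py) (le_trans c4 (P_lower k2 Py')).
by case: nx.
Qed.

Let below_point x i j y y' : present A B i (erank x) -> present A B j (erank x) ->
  bel i j -> P i (x, y) -> E j (x, y') -> y <= y'.
Proof.
move=> pi pj ij Py Ey'.
have [m am] := upper_neighbour sord pi pj ij.
have /adjacentP[_ pm im _] := am.
case/orP => [/eqP mj|mj].
  by rewrite mj in am; exact: (adjacent_sep am Py (EP Ey')).
have [ym Em] := slice_point pm.
apply: le_trans (adjacent_sep am Py (EP Em)) _.
exact: le_trans (E_below mj Em) (E_above mj Ey').
Qed.

Let above_point x i j y y' : present A B i (erank x) -> present A B j (erank x) ->
  bel i j -> E i (x, y) -> P j (x, y') -> y <= y'.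
Proof.
move=> pi pj ij Ey Py'.
have [m am] := lower_neighbour sord pi pj ij.
have /adjacentP[pm _ im _] := am.
case/orP => [/eqP mj|mj].
  by rewrite mj in am; exact: (adjacent_sep am (EP Ey) Py').
have [ym Em] := slice_point pm.
apply: le_trans _ (adjacent_sep am (EP Em) Py').
exact: le_trans (E_below mj Ey) (E_above mj Em).
Qed.

(** Two present cells are separated through a chain of neighbours: the one next
    to [i] separates its enlargement, and the original cells between are
    ordered. *)
Let present_sep x i j y y' : present A B i (erank x) -> present A B j (erank x) ->
  bel i j -> P i (x, y) -> P j (x, y') -> y <= y'.
Proof.
move=> pi pj ij Py Py'.
have [m am] := upper_neighbour sord pi pj ij.
have /adjacentP[_ pm im _] := am.
case/orP => [/eqP mj|mj].
  by rewrite mj in am; exact: (adjacent_sep am Py Py').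
have [ym Em] := slice_point pm.
exact: le_trans (adjacent_sep am Py (EP Em)) (above_point pm pj mj Em Py').
Qed.

(** The part of an enlarged cell to the left of the original one lies in the
    gap of the episode [e] closed by this cell.  The lines under and over it are
    in the right order both at the tip and at [a i], hence in between; so every
    abscissa at which the line of [e] is needed is left of the tip. *)
Let left_tip x y0 i : P i (x, y0) -> x < a i -> exists e : ep,
  [/\ e \in K, adjacent A B bel (erank x) (elow e) (eupp e),
      (estart e <= erank x < eend e)%N, closes_start A B bel e i &
      [/\ forall y y', P i (x, y) -> P (elow e) (x, y') -> y' <= y,
         forall y y', P i (x, y) -> P (eupp e) (x, y') -> y <= y' &
         forall x', (estart e <= erank x' < eend e)%N -> ~ lwedge K e x' -> x' < x]].
Proof.
move=> Py xa.
have nlw : ~~ left_wall A B bel K i.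
  by apply/negP => lw; have := P_left Py lw; rewrite /= leNgt xa.
move: nlw; rewrite negbK => /and3P[/existsP[e1 /andP[k1 c2]] /existsP[e2 /andP[k2 c3]]
  /existsP[e /andP[eK c1]]].
have ee := Kep eK; have ee1 := Kep k1; have ee2 := Kep k2.
have [u1 l2 l1 u2 Ai] := left_wedge sord ee ee1 ee2 c1 c2 c3.
have L1 y : P i (x, y) -> line e1 x <= y by rewrite -u1 => /(P_lower k1).
have L2 y : P i (x, y) -> y <= line e2 x by rewrite -l2 => /(P_upper k2).
have key x' : (estart e <= erank x' < eend e)%N -> ~ lwedge K e x' -> x' < x.
  move=> xe nl; rewrite ltNge; apply/negP => xx'; apply: nl.
  exists i, e1, e2; split=> //; split=> //.
  have xa' : x' < a i by rewrite ltNge -A_le -ltnNge Ai; case/andP: xe.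
  have [y1 E0] : exists y1, E i (a i, y1).
    by apply: E_slice; rewrite lexx ltW.
  have M1 : line e1 (a i) <= y1.
    by rewrite -{1}u1 in E0; exact: (P_lower k1 (EP E0)).
  have M2 : y1 <= line e2 (a i).
    by rewrite -{1}l2 in E0; exact: (P_upper k2 (EP E0)).
  apply: (affine_le_between _ _ (le_trans (L1 _ Py) (L2 _ Py)) (le_trans M1 M2)).
    by rewrite xa.
  by rewrite xx' (ltW xa').
have xe : (estart e <= erank x < eend e)%N.
  rewrite -Ai (ltnNge (erank x)) A_le -ltNge xa andbT.
  have := eK; rewrite KE => /andP[_ /asboolP[x' [xe' nl _]]].
  by move: xe' (erank_mono (ltW (key _ xe' nl))); clear; lia.
exists e; split=> //.
  by have /is_episodeP[_ ae _ _] := ee; exact: ae.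
split=> // y y' /[dup] /L1 h1 /L2 h2.
- by rewrite -l1 => /(P_upper k1) /= h; exact: le_trans h h1.
- by rewrite -u2 => /(P_lower k2) /= h; exact: le_trans h2 h.
Qed.

Let right_tip x y0 i : P i (x, y0) -> b i < x -> exists e : ep,
  [/\ e \in K, adjacent A B bel (erank x) (elow e) (eupp e),
      (estart e <= erank x < eend e)%N, opens_end A B bel e i &
      [/\ forall y y', P i (x, y) -> P (elow e) (x, y') -> y' <= y,
         forall y y', P i (x, y) -> P (eupp e) (x, y') -> y <= y' &
         forall x', (estart e <= erank x' < eend e)%N -> ~ rwedge K e x' -> x < x']].
Proof.
move=> Py xa.
have nlw : ~~ right_wall A B bel K i.
  by apply/negP => lw; have := P_right Py lw; rewrite /= leNgt xa.
move: nlw; rewrite negbK => /and3P[/existsP[e1 /andP[k1 c2]] /existsP[e2 /andP[k2 c3]]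
  /existsP[e /andP[eK c1]]].
have ee := Kep eK; have ee1 := Kep k1; have ee2 := Kep k2.
have [u1 l2 l1 u2 Bi] := right_wedge sord ee ee1 ee2 c1 c2 c3.
have L1 y : P i (x, y) -> line e1 x <= y by rewrite -u1 => /(P_lower k1).
have L2 y : P i (x, y) -> y <= line e2 x by rewrite -l2 => /(P_upper k2).
have key x' : (estart e <= erank x' < eend e)%N -> ~ rwedge K e x' -> x < x'.
  move=> xe nl; rewrite ltNge; apply/negP => xx'; apply: nl.
  exists i, e1, e2; split=> //; split=> //.
  have xa' : b i <= x' by rewrite -B_le Bi; case/andP: xe.
  have [y1 E0] : exists y1, E i (b i, y1).
    by apply: E_slice; rewrite lexx ltW.
  have M1 : line e1 (b i) <= y1.
    by rewrite -{1}u1 in E0; exact: (P_lower k1 (EP E0)).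
  have M2 : y1 <= line e2 (b i).
    by rewrite -{1}l2 in E0; exact: (P_upper k2 (EP E0)).
  apply: (affine_le_between _ _ (le_trans (L1 _ Py) (L2 _ Py)) (le_trans M1 M2)).
    by rewrite xa orbT.
  by rewrite xx' xa' orbT.
have xe : (estart e <= erank x < eend e)%N.
  rewrite -Bi B_le (ltW xa) /=.
  have := eK; rewrite KE => /andP[_ /asboolP[x' [xe' _ nl]]].
  by move: xe' (erank_mono (ltW (key _ xe' nl))); clear; lia.
exists e; split=> //.
  by have /is_episodeP[_ ae _ _] := ee; exact: ae.
split=> // y y' /[dup] /L1 h1 /L2 h2.
- by rewrite -l1 => /(P_upper k1) /= h; exact: le_trans h h1.
- by rewrite -u2 => /(P_lower k2) /= h; exact: le_trans h2 h.
Qed.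

Let tip x y0 i : P i (x, y0) -> ~ is_event x -> ~~ present A B i (erank x) -> exists e : ep,
  [/\ e \in K, adjacent A B bel (erank x) (elow e) (eupp e),
      (estart e <= erank x < eend e)%N,
      (x < a i) && closes_start A B bel e i || (b i < x) && opens_end A B bel e i &
      [/\ forall y y', P i (x, y) -> P (elow e) (x, y') -> y' <= y,
         forall y y', P i (x, y) -> P (eupp e) (x, y') -> y <= y' &
         forall x', (estart e <= erank x' < eend e)%N ->
           ~ lwedge K e x' -> ~ rwedge K e x' ->
           if x < a i then x' < x else x < x']].
Proof.
move=> Py nx; rewrite presentE negb_and -ltNge -leNgt => /orP[xa|bx].
  have [e [h1 h2 h3 h4 [h5 h6 h7]]] := left_tip Py xa.
  by exists e; split=> //; rewrite ?xa ?h4 //; split=> // x' hx' nl _; exact: h7.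
have bx' : b i < x.
  by rewrite lt_neqAle bx andbT; apply/eqP => bi; apply: nx; exists i; right.
have [e [h1 h2 h3 h4 [h5 h6 h7]]] := right_tip Py bx'.
exists e; split=> //; rewrite ?bx' ?h4 ?orbT //; split=> // x' hx' _ nl.
by rewrite ltNge (ltW (lt_trans (ltab i) bx')) /=; exact: h7.
Qed.

Let tip_bound x y i : P i (x, y) -> ~ is_event x ->
  (exists y', E i (x, y')) \/ spanned_at E x y.
Proof.
move=> Py nx; case: (boolP (present A B i (erank x))) => [/slice_point|np]; first by left.
right; have [e [_ /adjacentP[pl pu _ _] _ _ [h1 h2 _]]] := tip Py nx np.
have [y1 E1] := slice_point pl; have [y2 E2] := slice_point pu.
exists (elow e), (eupp e), y1, y2; split=> //.
by rewrite (h1 _ _ Py (EP E1)) (h2 _ _ Py (EP E2)).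
Qed.

Let gap_side x (e : ep) j : adjacent A B bel (erank x) (elow e) (eupp e) ->
  present A B j (erank x) ->
  (forall y, P j (x, y) -> exists2 y', P (elow e) (x, y') & y <= y') \/
  (forall y, P j (x, y) -> exists2 y', P (eupp e) (x, y') & y' <= y).
Proof.
move=> /adjacentP[pl pu lu h] pj.
case: (eqVneq j (elow e)) => [->|jl]; first by left => y Py; exists y.
case: (eqVneq j (eupp e)) => [->|ju]; first by right => y Py; exists y.
have [_ _ tot] := sord.
case/orP: (tot _ _ _ pj pl jl) => [jl'|lj].
  left => y Py; have [y1 E1] := slice_point pl; exists y1; first exact: EP.
  exact: (below_point pj pl jl' Py E1).
case/orP: (tot _ _ _ pj pu ju) => [ju'|uj]; first by case: (h _ pj lj ju').
right => y Py; have [y1 E1] := slice_point pu; exists y1; first exact: EP.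
exact: (above_point pu pj uj E1 Py).
Qed.

Let tip_present_sep x i j : ~ is_event x -> ~~ present A B i (erank x) ->
  present A B j (erank x) -> ordered_at (P i) (P j) x.
Proof.
move=> nx np pj.
have [[y0 P0]|nP] := pselect (exists y, P i (x, y)); last first.
  by left => y y' Py; case: nP; exists y.
have [e [_ ae _ _ [h1 h2 _]]] := tip P0 nx np.
case: (gap_side ae pj) => h; [right|left] => y y' Py /h[y1 P1 yy1].
  exact: le_trans yy1 (h1 _ _ Py P1).
exact: le_trans (h2 _ _ Py P1) yy1.
Qed.

Let tips_ordered x (e e' : ep) y y' :
  adjacent A B bel (erank x) (elow e) (eupp e) ->
  adjacent A B bel (erank x) (elow e') (eupp e') ->
  bel (elow e) (elow e') ->
  (forall y1, P (eupp e) (x, y1) -> y <= y1) ->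
  (forall y1, P (elow e') (x, y1) -> y1 <= y') -> y <= y'.
Proof.
move=> /adjacentP[pl pu lu h] /adjacentP[pl' _ _ _] ll' hy hy'.
have [y1 E1] := slice_point pl'.
apply: le_trans (hy' _ (EP E1)).
case: (eqVneq (eupp e) (elow e')) => [ue|ne]; first by apply: hy; rewrite ue; exact: EP.
have [_ _ tot] := sord.
case/orP: (tot _ _ _ pu pl' ne) => [ul|lu']; last by case: (h _ pl' ll' lu').
have [y2 E2] := slice_point pu.
apply: le_trans (hy _ (EP E2)) _.
exact: le_trans (E_below ul E2) (E_above ul E1).
Qed.

(** Two tips in different gaps are ordered as the gaps.  Two tips in the same
    gap come from opposite ends of the same episode [e]; it is kept because of
    an abscissa at which its line is needed, and the tips stop on either side of
    this abscissa. *)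
Let tip_tip_sep x i j : ~ is_event x -> i != j -> ~~ present A B i (erank x) ->
  ~~ present A B j (erank x) -> ordered_at (P i) (P j) x.
Proof.
move=> nx ij npi npj.
have [[y0 P0]|nP] := pselect (exists y, P i (x, y)); last first.
  by left => y y' Py; case: nP; exists y.
have [[y0' P0']|nP] := pselect (exists y, P j (x, y)); last first.
  by left => y y' _ Py; case: nP; exists y'.
have [e [ke ae xe te [h1 h2 h3]]] := tip P0 nx npi.
have [e' [ke' ae' xe' te' [h1' h2' h3']]] := tip P0' nx npj.
have [_ _ tot] := sord.
case: (eqVneq (elow e) (elow e')) => [ll|nl].
  have uu : eupp e = eupp e'.
    by rewrite ll in ae; exact: (adjacent_uniqr sord ae ae').
  have ee' : e = e' by apply: (episode_inj (t := erank x) A_gt0 B_leT (Kep ke) (Kep ke')).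
  rewrite -{}ee' {e' ae' xe' ke' ll uu h1' h2'} in te' h3' *.
  have := ke; rewrite KE => /andP[_ /asboolP[x' [xx' nlw nrw]]].
  have := h3 _ xx' nlw nrw; have := h3' _ xx' nlw nrw.
  case/orP: te => /andP[xi ti]; case/orP: te' => /andP[xj tj].
  - case/and3P: ti => _ _ ti; case/and3P: tj => _ _ tj.
    by move: ij; rewrite (adjacent_uniqr sord ti tj) eqxx.
  - rewrite xi [x < a j]ltNge (ltW (lt_trans (ltab j) xj)) /=.
    by move=> + h; rewrite ltNge (ltW h).
  - rewrite xj [x < a i]ltNge (ltW (lt_trans (ltab i) xi)) /=.
    by move=> h; rewrite ltNge (ltW h).
  - case/and3P: ti => _ _ ti; case/and3P: tj => _ _ tj.
    by move: ij; rewrite (adjacent_uniqr sord ti tj) eqxx.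
have [/adjacentP[pl _ _ _] /adjacentP[pl' _ _ _]] := (ae, ae').
case/orP: (tot _ _ _ pl pl' nl) => ll; [left|right] => y y' Py Py'.
  by apply: (tips_ordered ae ae' ll) => y1; [exact: h2|exact: h1'].
by apply: (tips_ordered ae' ae ll) => y1; [exact: h2'|exact: h1].
Qed.

Let cells_ordered x i j : ~ is_event x -> i != j -> ordered_at (P i) (P j) x.
Proof.
move=> nx ij; case: (boolP (present A B i (erank x))) => pi;
  case: (boolP (present A B j (erank x))) => pj.
- have [_ _ tot] := sord.
  case/orP: (tot _ _ _ pi pj ij) => b_; [left|right] => y y' Py Py'.
    exact: (present_sep pi pj b_ Py Py').
  exact: (present_sep pj pi b_ Py' Py).
- case: (tip_present_sep nx pj pi) => h; [right|left] => y y' Py Py'; exact: h.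
- exact: tip_present_sep.
- exact: tip_tip_sep.
Qed.

(** Six sides per cell are enough, as an episode gives two sides and every cell
    is charged with at most three starts and three ends.  The last property
    keeps the polyhedra bounded when they are surrounded by other cells. *)
Lemma sweep_cover : exists hs : I -> seq (R * R * R),
  [/\ forall i, E i `<=` polyhedron (hs i),
      (\sum_i size (hs i) <= 6 * #|I|)%N,
      forall x i j, ~ is_event x -> i != j -> ordered_at (polyhedron (hs i)) (polyhedron (hs j)) x &
      forall x y i, ~ is_event x -> polyhedron (hs i) (x, y) ->
        (exists y', E i (x, y')) \/ spanned_at E x y].
Proof.
exists sides; split; [exact: EP|exact: size_sides|exact: cells_ordered|].
by move=> x y i nx Py; exact: tip_bound Py nx.
Qed.
End SweepCover.

(** * Convex sets in the plane *)

Section PlaneConvexity.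
Variable R : realType.
Implicit Types (K : set (plane R)) (z w : plane R) (t : R).

Definition segpt t z w : plane R :=
  ((1 - t) * z.1 + t * w.1, (1 - t) * z.2 + t * w.2).

Lemma convex_setE K : @convex_set R (plane R) K <->
  (forall t z w, 0 <= t <= 1 -> K z -> K w -> K (segpt t z w)).
Proof.
split=> [cK t z w /andP[t0 t1] Kz Kw|h z w p].
  have := cK w z (Itv01 t0 t1); rewrite !inE => /(_ Kw Kz).
  congr K; rewrite /conv/= /segpt; congr pair; rewrite /= addrC //.
rewrite !inE => Kz Kw; have := h p%:num w z _ Kw Kz.
have -> : 0 <= p%:num <= 1 by rewrite ge0 le1.
move=> /(_ isT); congr K.
by rewrite /conv/= /segpt; congr pair; rewrite /= addrC.
Qed.

Definition sqr z (e : R) : set (plane R) :=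
  [set w | z.1 - e <= w.1 <= z.1 + e /\ z.2 - e <= w.2 <= z.2 + e].

(** Interior points, in a form that linear arithmetic can use. *)
Definition inner K z := exists2 e, 0 < e & sqr z e `<=` K.

Lemma interior_inner K z : interior K z <-> inner K z.
Proof.
split=> [/nbhs_ballP[e /= e0 eK]|[e e0 eK]].
  exists (e / 2); first by rewrite divr_gt0.
  move=> w [/andP[w1 w2] /andP[w3 w4]]; apply: eK; split => /=.
    by rewrite -ball_normE /= ltr_distl; apply/andP; split; lra.
  by rewrite -ball_normE /= ltr_distl; apply/andP; split; lra.
apply/nbhs_ballP; exists e => //= w [/=].
rewrite -!ball_normE /= !ltr_distl => /andP[w1 w2] /andP[w3 w4]; apply: eK.
by split; apply/andP; split; lra.
Qed.

Lemma inner_sub K z : inner K z -> K z.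
Proof. by case=> e e0; apply; split; apply/andP; split; lra. Qed.

Lemma inner_seg K t z w : @convex_set R (plane R) K -> 0 <= t < 1 ->
  inner K z -> K w -> inner K (segpt t z w).
Proof.
move=> /convex_setE cK /andP[t0 t1] [e e0 eK] Kw.
have t10 : 0 < 1 - t by lra.
exists ((1 - t) * e); first by rewrite mulr_gt0.
move=> v [/andP[v1 v2] /andP[v3 v4]]; rewrite /segpt /= in v1 v2 v3 v4.
pose u : plane R := ((v.1 - t * w.1) / (1 - t), (v.2 - t * w.2) / (1 - t)).
have -> : v = segpt t u w.
  rewrite [LHS]surjective_pairing /segpt /u /=; congr pair; rewrite mulrC divfK ?subrK //; lra.
apply: cK => //; first lra.
by apply: eK; split; rewrite /u /= ler_pdivrMr // ler_pdivlMr //; apply/andP; split; lra.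
Qed.

Lemma seg_at_abscissa K z w x : @convex_set R (plane R) K -> K z -> K w ->
  z.1 <= x <= w.1 -> exists y, K (x, y).
Proof.
move=> /convex_setE cK Kz Kw /andP[zx xw].
have [zw|zw] := eqVneq z.1 w.1.
  exists z.2; suff -> : (x, z.2) = z by [].
  by rewrite [RHS]surjective_pairing; congr pair; apply/eqP; rewrite eq_le; apply/andP; split; lra.
have zw' : 0 < w.1 - z.1 by rewrite subr_gt0 lt_neqAle zw; lra.
pose t := (x - z.1) / (w.1 - z.1).
have t01 : 0 <= t <= 1 by rewrite /t divr_ge0 ?ler_pdivrMr //; lra.
exists (segpt t z w).2; have := cK _ _ _ t01 Kz Kw.
rewrite [segpt t z w]surjective_pairing /=; congr K; congr pair.
have -> : (1 - t) * z.1 + t * w.1 = z.1 + t * (w.1 - z.1) by ring.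
by rewrite /t divfK ?gt_eqF //; ring.
Qed.

Lemma inner_at_abscissa K z w v x : @convex_set R (plane R) K -> K z -> K w ->
  inner K v -> z.1 < x < w.1 -> exists y, inner K (x, y).
Proof.
move=> cK Kz Kw iv /andP[zx xw].
have key u : K u -> (v.1 <= x < u.1) || (u.1 < x <= v.1) -> exists y, inner K (x, y).
  move=> Ku h; pose t := (x - v.1) / (u.1 - v.1).
  have nz : u.1 - v.1 != 0 by apply/eqP => e; case/orP: h; lra.
  have t01 : 0 <= t < 1.
    rewrite /t; case/orP: h => h.
      have p : 0 < u.1 - v.1 by lra.
      by rewrite divr_ge0 ?ltr_pdivrMr //; lra.
    have p : 0 < v.1 - u.1 by lra.
    rewrite -(opprB v.1) -mulrNN -invrN opprK opprB.
    by rewrite divr_ge0 ?ltr_pdivrMr //; lra.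
  exists (segpt t v u).2; have := inner_seg cK t01 iv Ku.
  rewrite [segpt t v u]surjective_pairing /=; congr (inner K); congr pair.
  have -> : (1 - t) * v.1 + t * u.1 = v.1 + t * (u.1 - v.1) by ring.
  by rewrite /t divfK //; ring.
case: (leP v.1 x) => vx; first by apply: (key w) => //; rewrite vx xw.
by apply: (key z) => //; rewrite zx (ltW vx) orbT.
Qed.

(** If the vertical order of two convex sets were reversed between two
    abscissas, the segments joining the points of each set would cross, at a
    point inner to both. *)
Lemma vertical_order K1 K2 x0 y1 y2 :
  @convex_set R (plane R) K1 -> @convex_set R (plane R) K2 ->
  (forall z, inner K1 z -> inner K2 z -> False) ->
  inner K1 (x0, y1) -> inner K2 (x0, y2) -> y1 < y2 ->
  forall x y y', K1 (x, y) -> K2 (x, y') -> y <= y'.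
Proof.
move=> c1 c2 dis i1 i2 y12 x y y' k1 k2; rewrite leNgt; apply/negP => yy'.
pose t := (y2 - y1) / ((y2 - y1) + (y - y')).
have d0 : 0 < (y2 - y1) + (y - y') by lra.
have t01 : 0 <= t < 1 by rewrite /t divr_ge0 ?ltr_pdivrMr //; lra.
apply: (dis (segpt t (x0, y1) (x, y))); first exact: inner_seg.
have -> : segpt t (x0, y1) (x, y) = segpt t (x0, y2) (x, y').
  rewrite /segpt /=; congr pair; apply/eqP; rewrite -subr_eq0.
  have -> : (1 - t) * y1 + t * y - ((1 - t) * y2 + t * y') =
     t * ((y2 - y1) + (y - y')) - (y2 - y1) by ring.
  have tE : t * ((y2 - y1) + (y - y')) = y2 - y1 by rewrite /t divfK // gt_eqF.
  by rewrite tE subrr.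
exact: inner_seg.
Qed.

(** As both sets meet a vertical line at inner points, a separating line cannot
    be vertical.  Its slope is the supremum of the slopes of the segments going
    to the right from [K2] to [K1]; these are at most the slopes of the segments
    going to the right from [K1] to [K2], by [vertical_order] at an
    abscissa common to the two segments joining their ends in each set. *)
Lemma separating_line K1 K2 x0 y1 y2 :
  @convex_set R (plane R) K1 -> @convex_set R (plane R) K2 ->
  (forall z, inner K1 z -> inner K2 z -> False) ->
  inner K1 (x0, y1) -> inner K2 (x0, y2) -> y1 < y2 ->
  exists l : R * R, (forall z, K1 z -> z.2 <= l.1 * z.1 + l.2) /\
                    (forall z, K2 z -> l.1 * z.1 + l.2 <= z.2).
Proof.
move=> c1 c2 dis i1 i2 y12; have vo := vertical_order c1 c2 dis i1 i2 y12.
have cross z w z' w' : K1 z -> K2 w -> K1 z' -> K2 w' -> w.1 < z.1 -> z'.1 < w'.1 ->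
    (z.2 - w.2) / (z.1 - w.1) <= (w'.2 - z'.2) / (w'.1 - z'.1).
  move=> kz kw kz' kw' wz zw.
  have d1 : 0 < z.1 - w.1 by lra.
  have d2 : 0 < w'.1 - z'.1 by lra.
  set e1 := z.1 - w.1 in d1 *; set e2 := w'.1 - z'.1 in d2 *.
  pose t := e1 / (e1 + e2).
  have t01 : 0 <= t <= 1 by rewrite /t divr_ge0 ?ler_pdivrMr //; lra.
  have e12 : 0 < e1 + e2 by lra.
  have tE : (e1 + e2) * t = e1 by rewrite /t mulrC divfK // gt_eqF.
  have xx : (1 - t) * z.1 + t * z'.1 = (1 - t) * w.1 + t * w'.1.
    apply/eqP; rewrite -subr_eq0.
    have -> : (1 - t) * z.1 + t * z'.1 - ((1 - t) * w.1 + t * w'.1) =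
       e1 - (e1 + e2) * t by rewrite /e1 /e2; ring.
    by rewrite tE subrr.
  have /convex_setE /(_ _ _ _ t01 kz kz') := c1.
  have /convex_setE /(_ _ _ _ t01 kw kw') := c2.
  rewrite /segpt xx => h2 h1.
  have tu u : (e1 + e2) * t * u = e1 * u by rewrite tE.
  rewrite ler_pdivrMr // [leRHS]mulrAC ler_pdivlMr //.
  have := ler_wpM2l (ltW e12) (vo _ _ _ h1 h2).
  by have := tu z.2; have := tu z'.2; have := tu w.2; have := tu w'.2; lra.
have [e e0 eK] := i1; have k2 := inner_sub i2.
have k1 := inner_sub i1.
have kr : K1 (x0 + e, y1) by apply: eK; split; apply/andP; split => /=; lra.
have kl : K1 (x0 - e, y1) by apply: eK; split; apply/andP; split => /=; lra.
pose S := [set p : R | exists z w, [/\ K1 z, K2 w, w.1 < z.1 & p = (z.2 - w.2) / (z.1 - w.1)]].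
have S0 : S !=set0.
  by eexists; exists (x0 + e, y1), (x0, y2); split; [exact: kr|exact: k2|move=> /=; lra|reflexivity].
have Sub z w : K1 z -> K2 w -> z.1 < w.1 -> ubound S ((w.2 - z.2) / (w.1 - z.1)).
  by move=> kz kw zw _ [z' [w' [kz' kw' wz' ->]]]; exact: cross.
have supS : has_sup S.
  by split=> //; eexists; apply: (Sub _ _ kl k2) => /=; lra.
pose p := sup S.
have key z w : K1 z -> K2 w -> z.2 - p * z.1 <= w.2 - p * w.1.
  move=> kz kw; case: (ltgtP z.1 w.1) => zw.
  - have : p <= (w.2 - z.2) / (w.1 - z.1) by apply: ge_sup => //; exact: Sub.
    by rewrite ler_pdivlMr; lra.
  - have : (z.2 - w.2) / (z.1 - w.1) <= p.
      by apply: ub_le_sup; [case: supS|exists z, w].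
    by rewrite ler_pdivrMr; lra.
  - have : z.2 <= w.2.
      by apply: (vo z.1); [rewrite -surjective_pairing|rewrite zw -surjective_pairing].
    by rewrite zw; lra.
pose Q := [set q : R | exists2 z, K1 z & q = z.2 - p * z.1].
have Q0 : Q !=set0 by eexists; exists (x0, y1).
have Qub w : K2 w -> ubound Q (w.2 - p * w.1).
  by move=> kw _ [z kz ->]; exact: key.
exists (p, sup Q); split=> z kz /=.
  have : z.2 - p * z.1 <= sup Q.
    by apply: ub_le_sup; [exists (y2 - p * x0); exact: (Qub _ k2)|exists z].
  by lra.
have : sup Q <= z.2 - p * z.1 by apply: ge_sup => //; exact: Qub.
by lra.
Qed.

Lemma convex_body_range K : convex_body K -> exists z w,
  [/\ K z, K w, z.1 < w.1 & forall v, K v -> z.1 <= v.1 <= w.1].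
Proof.
move=> [cK coK [v0 /interior_inner iv]].
have K0 : K !=set0 by exists v0; exact: inner_sub.
have cf : {within K, continuous (fst : plane R -> R)}.
  by apply: continuous_subspaceT => x; exact: cvg_fst.
have [z Kz zmin] := compact_EVT_min K0 coK cf.
have [w Kw wmax] := compact_EVT_max K0 coK cf.
exists z, w; rewrite !inE in Kz Kw *; split=> //; last first.
  by move=> v Kv; rewrite zmin ?wmax // inE.
have [e e0 eK] := iv.
have l1 : K (v0.1 - e, v0.2) by apply: eK; split; apply/andP; split => /=; lra.
have l2 : K (v0.1 + e, v0.2) by apply: eK; split; apply/andP; split => /=; lra.
have := zmin (v0.1 - e, v0.2); have := wmax (v0.1 + e, v0.2).
by rewrite !inE => /(_ l2) /= h1 /(_ l1) /= h2; lra.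
Qed.
End PlaneConvexity.

(** * Enlarging disjoint convex bodies *)

(** One cell is below another when this holds of their inner points on some
    common vertical line; by [vertical_order] the line does not matter. *)
Lemma convex_bodies_cover (R : realType) (I : finType) (E : I -> set (plane R)) :
  (forall i, convex_body (E i)) ->
  (forall i j z, i != j -> inner (E i) z -> inner (E j) z -> False) ->
  exists (hs : I -> seq (R * R * R)) (ev : seq R),
  [/\ forall i, E i `<=` polyhedron (hs i),
      (\sum_i size (hs i) <= 6 * #|I|)%N,
      forall x i j, x \notin ev -> i != j -> ordered_at (polyhedron (hs i)) (polyhedron (hs j)) x &
      forall x y i, x \notin ev -> polyhedron (hs i) (x, y) ->
        (exists y', E i (x, y')) \/ spanned_at E x y].
Proof.
move=> cE dis.
have cvx i : @convex_set R (plane R) (E i) by case: (cE i).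
have /choice[f Hf] : forall i, exists f : plane R * plane R,
    [/\ E i f.1, E i f.2, f.1.1 < f.2.1 & forall v, E i v -> f.1.1 <= v.1 <= f.2.1].
  move=> i; by have [z [w ?]] := convex_body_range (cE i); exists (z, w).
pose a i := (f i).1.1; pose b i := (f i).2.1.
pose bel : rel I := fun i j => (i != j) && `[< exists x y y',
  [/\ inner (E i) (x, y), inner (E j) (x, y') & y < y'] >].
have belP i j : reflect (i != j /\ exists x y y',
    [/\ inner (E i) (x, y), inner (E j) (x, y') & y < y']) (bel i j).
  apply: (iffP andP) => -[ij]; first by move=> /asboolP.
  by move=> h; split=> //; apply/asboolP.
have inn i x : a i < x < b i -> exists y, inner (E i) (x, y).
  have [k1 k2 _ _] := Hf i; have [_ _ [v /interior_inner iv]] := cE i.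
  exact: (inner_at_abscissa (cvx i) k1 k2 iv).
have bel_lt i j x y y' : bel i j -> inner (E i) (x, y) -> inner (E j) (x, y') -> y < y'.
  move=> /belP[ij [x0 [y1 [y2 [i1 i2 y12]]]]] iy jy'.
  have : y <= y'.
    apply: (vertical_order _ _ _ i1 i2 y12); [exact: cvx|exact: cvx| |exact: inner_sub iy|exact: inner_sub jy'].
    by move=> z; exact: (dis i j z).
  rewrite le_eqVlt => /orP[/eqP e|//].
  by case: (dis i j (x, y)) => //; rewrite e.
have /choice[l Hl] : forall p : I * I, exists l : R * R, bel p.1 p.2 ->
    (forall z, E p.1 z -> z.2 <= l.1 * z.1 + l.2) /\
    (forall z, E p.2 z -> l.1 * z.1 + l.2 <= z.2).
  move=> [i j] /=.
  case: (boolP (bel i j)) => [/belP[ij [x0 [y1 [y2 [i1 i2 y12]]]]]|_]; last by exists (0, 0).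
  have [|l hl] := separating_line (cvx i) (cvx j) _ i1 i2 y12; last by exists l.
  by move=> z; exact: dis.
have := @sweep_cover R I E a b bel (fun i j => l (i, j)).
have ab i : a i < b i by case: (Hf i).
have rg i z : E i z -> a i <= z.1 <= b i by case: (Hf i) => _ _ _; apply.
have sl i x : a i <= x <= b i -> exists y, E i (x, y).
  by have [k1 k2 _ _] := Hf i; exact: (seg_at_abscissa (cvx i)).
have irr i : ~~ bel i i by rewrite /bel eqxx.
move=> /(_ ab rg sl irr).
have tr x i j k : a i < x < b i -> a j < x < b j -> a k < x < b k ->
    bel i j -> bel j k -> bel i k.
  move=> /inn[yi Yi] /inn[yj Yj] /inn[yk Yk] ij jk.
  have l1 := bel_lt _ _ _ _ _ ij Yi Yj; have l2 := bel_lt _ _ _ _ _ jk Yj Yk.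
  apply/belP; split; last by exists x, yi, yk; split=> //; exact: lt_trans l1 l2.
  apply/eqP => ik; rewrite -ik in Yk jk.
  by have := lt_trans (bel_lt _ _ _ _ _ jk Yj Yi) l1; rewrite ltxx.
have tot x i j : a i < x < b i -> a j < x < b j -> i != j -> bel i j || bel j i.
  move=> /inn[yi Yi] /inn[yj Yj] ij.
  have [lt|lt|e] := ltgtP yi yj.
  - by apply/orP; left; apply/belP; split=> //; exists x, yi, yj.
  - by apply/orP; right; apply/belP; split; [rewrite eq_sym|exists x, yj, yi].
  - by case: (dis i j (x, yi)) => //; rewrite e.
move=> /(_ tr tot).
move=> /(_ (fun i j z h => (Hl (i, j) h).1 z) (fun i j z h => (Hl (i, j) h).2 z)).
move=> [hs [h1 h2 h3 h4]].
exists hs, ([seq a i | i <- enum I] ++ [seq b i | i <- enum I]).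
have ne x : x \notin [seq a i | i <- enum I] ++ [seq b i | i <- enum I] -> ~ is_event a b x.
  move=> nx [i xi]; move: nx; rewrite mem_cat negb_or => /andP[].
  by case: xi => ->; rewrite map_f ?mem_enum.
split=> //; first by move=> x i j /ne; exact: h3.
by move=> x y i /ne; exact: h4.
Qed.

(** * Polygons as counterclockwise lists of vertices *)

Section Polygons.
Variable R : realType.
Implicit Types (s t : seq (plane R)) (x y z a b c d : plane R) (h : R * R * R).

Lemma orient_cycle a b c : orient a b c = orient b c a.
Proof. by rewrite /orient; ring. Qed.

Lemma orient_swap a b c : orient b a c = - orient a b c.
Proof. by rewrite /orient; ring. Qed.

Lemma orient_aab a b : orient a a b = 0.
Proof. by rewrite /orient; ring. Qed.

Lemma orient_aba a b : orient a b a = 0.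
Proof. by rewrite /orient; ring. Qed.

Lemma orient_abb a b : orient a b b = 0.
Proof. by rewrite /orient; ring. Qed.

Lemma orient_segl u a b c d : orient (segpt u a b) c d = (1 - u) * orient a c d + u * orient b c d.
Proof. by rewrite /orient /segpt /=; ring. Qed.

Lemma orient_segm u a b c d : orient c (segpt u a b) d = (1 - u) * orient c a d + u * orient c b d.
Proof. by rewrite /orient /segpt /=; ring. Qed.

Lemma orient_segr u a b c d : orient c d (segpt u a b) = (1 - u) * orient c d a + u * orient c d b.
Proof. by rewrite /orient /segpt /=; ring. Qed.

Lemma hval_seg u a b h : hval h (segpt u a b) = (1 - u) * hval h a + u * hval h b.
Proof. by rewrite /hval /segpt /=; ring. Qed.

Definition side_plane a b : R * R * R :=
  (- (b.1 - a.1) * a.2 + (b.2 - a.2) * a.1, - (b.2 - a.2), b.1 - a.1).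

Lemma hval_side a b x : hval (side_plane a b) x = orient a b x.
Proof. by rewrite /hval /orient /=; ring. Qed.

(** Affine dependency of four points of the plane. *)
Lemma hval_quad h a b c d :
  orient b c d * hval h a + orient a b d * hval h c =
  orient a c d * hval h b + orient a b c * hval h d.
Proof. by rewrite /orient /hval; ring. Qed.

Lemma halfplane_convex h : @convex_set R (plane R) [set z | 0 <= hval h z].
Proof.
apply/convex_setE => u z w /andP[u0 u1] /= hz hw.
by rewrite hval_seg addr_ge0 ?mulr_ge0 //; lra.
Qed.

(** The barycentric coordinates of [x] are the three orientations. *)
Lemma triangle_point (K : set (plane R)) a b c x : @convex_set R (plane R) K ->
  K a -> K b -> K c -> 0 < orient a b c ->
  0 <= orient a b x -> 0 <= orient b c x -> 0 <= orient c a x -> K x.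
Proof.
move=> /convex_setE cK Ka Kb Kc D0 xc xa xb.
set D := orient a b c in D0.
have DE : D = orient b c x + orient c a x + orient a b x by rewrite /D /orient; ring.
set A := orient b c x in xa DE; set B := orient c a x in xb DE; set C := orient a b x in xc DE.
have E1 : D * x.1 = A * a.1 + B * b.1 + C * c.1.
  by rewrite /D /A /B /C /orient; ring.
have E2 : D * x.2 = A * a.2 + B * b.2 + C * c.2.
  by rewrite /D /A /B /C /orient; ring.
have [BC0|BC0] := eqVneq (B + C) 0.
  suff -> : x = a by [].
  have [B0 C0] : B = 0 /\ C = 0 by lra.
  have AD : A = D by lra.
  rewrite [x]surjective_pairing [a]surjective_pairing; congr pair.
    by apply: (mulfI (lt0r_neq0 D0)); rewrite E1 B0 C0 AD; ring.
  by apply: (mulfI (lt0r_neq0 D0)); rewrite E2 B0 C0 AD; ring.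
have BCp : 0 < B + C by rewrite lt_neqAle eq_sym BC0 addr_ge0.
pose t := C / (B + C); pose u := (B + C) / D.
have t01 : 0 <= t <= 1 by rewrite /t divr_ge0 ?ler_pdivrMr //; lra.
have u01 : 0 <= u <= 1 by rewrite /u divr_ge0 ?ler_pdivrMr //; lra.
have := cK _ _ _ u01 Ka (cK _ _ _ t01 Kb Kc); congr K.
have D00 := lt0r_neq0 D0.
have AE : A = D - B - C by lra.
rewrite [RHS]surjective_pairing /segpt /=; congr pair.
  apply: (mulfI D00); rewrite E1 AE /u /t; field.
  by rewrite D00 BC0.
apply: (mulfI D00); rewrite E2 AE /u /t; field.
by rewrite D00 BC0.
Qed.

Notation "s '`[' i ]" := (nth ((0, 0) : plane R) s i) (at level 2, format "s '`[' i ]").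

(** Asking for all triples of vertices, and not just for the consecutive ones,
    excludes lists winding several times and passes to sublists. *)
Definition turns_left s :=
  forall i j k, (i < j < k)%N -> (k < size s)%N -> 0 < orient s`[i] s`[j] s`[k].

Definition edge_region s : set (plane R) :=
  [set x | forall i, (i < size s)%N -> 0 <= orient s`[i] s`[i.+1 %% size s] x].

Lemma edge_region_convex s : @convex_set R (plane R) (edge_region s).
Proof.
apply/convex_setE => u z w /andP[u0 u1] hz hw i si.
by rewrite orient_segr addr_ge0 ?mulr_ge0 ?hz ?hw //; lra.
Qed.

Lemma turns_left_edge s i j : turns_left s -> (i < size s)%N -> (j < size s)%N ->
  j != i -> j != (i.+1 %% size s)%N -> 0 < orient s`[i] s`[i.+1 %% size s] s`[j].
Proof.
move=> ts si sj ji; have [Si|] := ltnP i.+1 (size s).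
  rewrite modn_small // => ji'; case: (ltngtP j i) ji => // [lt|gt] _.
    by rewrite -orient_cycle; apply: ts => //; lia.
  by apply: ts; lia.
move=> Si; have -> : i.+1 = size s by lia.
rewrite modnn => j0; rewrite orient_cycle; apply: ts; lia.
Qed.

Lemma vertex_in_region s z : turns_left s -> z \in s -> edge_region s z.
Proof.
move=> ts /(nthP ((0, 0) : plane R))[j sj <-] i si.
have [->|ji] := eqVneq j i; first by rewrite orient_aba.
have [->|ji'] := eqVneq j (i.+1 %% size s)%N; first by rewrite orient_abb.
exact/ltW/turns_left_edge.
Qed.

(** Triangulate as a fan from the first vertex: [x] lies in the triangle on the
    first side whose far end is to the left of, or on, the ray through [x]. *)
Lemma region_fan s (K : set (plane R)) : turns_left s -> (3 <= size s)%N ->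
  @convex_set R (plane R) K -> (forall z, z \in s -> K z) -> edge_region s `<=` K.
Proof.
move=> ts s3 cK sK x xs.
pose g j := orient s`[0] s`[j] x.
have exj : exists j, (0 < j)%N && (g j.+1 <= 0).
  exists (size s).-2; have := xs (size s).-1 ltac:(lia).
  have -> : (size s).-1.+1 = size s by lia.
  have -> : (size s).-2.+1 = (size s).-1 by lia.
  by rewrite modnn orient_swap /g oppr_ge0 => ->; lia.
have [j /andP[j0 gj] jmin] := ex_minnP exj.
have js : (j.+1 < size s)%N.
  rewrite -(ltn_predK s3) ltnS ltnNge; apply/negP => h.
  have := jmin (size s).-2; have := xs (size s).-1 ltac:(lia).
  have -> : (size s).-1.+1 = size s by lia.
  have -> : (size s).-2.+1 = (size s).-1 by lia.
  by rewrite modnn orient_swap /g oppr_ge0 => -> /(_ ltac:(lia)); lia.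
have gj0 : 0 <= g j.
  have [j1|j1] := eqVneq j 1%N.
    by have := xs 0%N ltac:(lia); rewrite modn_small ?j1 //; lia.
  rewrite leNgt; apply/negP => gneg; have := jmin j.-1.
  have -> : j.-1.+1 = j by lia.
  by rewrite (ltW gneg) => /(_ ltac:(lia)); lia.
apply: (triangle_point (a := s`[0]) (b := s`[j]) (c := s`[j.+1]) cK) => //.
- by apply/sK/mem_nth; exact: leq_trans s3.
- by apply/sK/mem_nth; exact: ltnW.
- exact/sK/mem_nth.
- by apply: ts; lia.
- by have := xs j ltac:(lia); rewrite modn_small.
- by rewrite orient_swap oppr_ge0.
Qed.

Lemma region_hull s : turns_left s -> (3 <= size s)%N ->
  edge_region s = convex_hull [set z | z \in s].
Proof.
move=> ts s3; apply/seteqP; split.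
  by move=> x xs C [cC sC]; exact: (region_fan ts s3 cC).
move=> x; apply; split; first exact: edge_region_convex.
by move=> z /= zs; exact: vertex_in_region.
Qed.

Lemma turns_left_rot n s : turns_left s -> turns_left (rot n s).
Proof.
elim: n s => [|n IH] s ts; first by rewrite rot0.
have [sn|sn] := leqP (size s) n.+1; first by rewrite rot_oversize.
rewrite -add1n rotD ?add1n; last exact: ltnW.
move: (rot n s) (IH s ts) => {sn ts}s ts.
case: s ts => [|a s] ts; first by rewrite rot_oversize.
rewrite rot1_cons => i j k ijk; rewrite size_rcons ltnS => ks.
rewrite !nth_rcons; have -> : (i < size s)%N by lia.
have -> : (j < size s)%N by lia.
move: ks; rewrite leq_eqVlt => /orP[/eqP ke|ks].
  rewrite ke ltnn eqxx -orient_cycle.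
  by apply: (ts 0%N i.+1 j.+1) => /=; lia.
by rewrite ks; apply: (ts i.+1 j.+1 k.+1) => /=; lia.
Qed.

Lemma region_rot n s : turns_left s -> (3 <= size s)%N ->
  edge_region (rot n s) = edge_region s.
Proof.
move=> ts s3; rewrite !region_hull ?size_rot //; last exact: turns_left_rot.
by congr convex_hull; apply/seteqP; split=> z /=; rewrite mem_rot.
Qed.

Lemma is_ngon_region s : turns_left s -> (3 <= size s)%N ->
  is_ngon (size s) (edge_region s).
Proof.
move=> ts s3; split=> //; exists (fun i : 'I_(size s) => s`[i]); split.
  by move=> i j ji jSi; apply: turns_left_edge.
rewrite region_hull //; congr convex_hull; apply/seteqP; split=> z /=.
  by move=> /(nthP ((0, 0) : plane R))[j sj <-]; exists (Ordinal sj).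
by case=> i _ <-; exact: mem_nth.
Qed.
End Polygons.

(** * Cutting a polygon by a half-plane *)

Section PolygonCut.
Variable R : realType.
Implicit Types (s t : seq (plane R)) (x y z a b c d : plane R) (h : R * R * R).
Notation "s '`[' i ]" := (nth ((0, 0) : plane R) s i) (at level 2, format "s '`[' i ]").

Lemma crossing h a b : 0 < hval h a -> hval h b <= 0 ->
  exists u, [/\ 0 < u <= 1, hval h (segpt u a b) = 0 & hval h b < 0 -> u < 1].
Proof.
move=> ha hb; have d0 : 0 < hval h a - hval h b by lra.
exists (hval h a / (hval h a - hval h b)); split.
- by rewrite divr_gt0 // ler_pdivrMr //; lra.
- by rewrite hval_seg; field; rewrite lt0r_neq0.
- by move=> hb'; rewrite ltr_pdivrMr //; lra.
Qed.

(** A second change of sign would contradict the affine dependency [hval_quad]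
    of the first vertex, the vertices at the two changes and the last one. *)
Lemma signs_alternate_once h s : turns_left s -> (0 < size s)%N ->
  0 < hval h s`[0] -> hval h s`[(size s).-1] <= 0 ->
  exists m, [/\ (0 < m < size s)%N, forall i, (i < m)%N -> 0 < hval h s`[i] &
    forall i, (m <= i < size s)%N -> hval h s`[i] <= 0].
Proof.
move=> ts s0 h0 hl.
have exm : exists m, (m < size s)%N && (hval h s`[m] <= 0).
  by exists (size s).-1; rewrite hl andbT prednK.
have [m /andP[ms hm] mmin] := ex_minnP exm.
have m0 : (0 < m)%N.
  by rewrite lt0n; apply/eqP => m0; move: hm; rewrite m0 leNgt h0.
exists m; split; first by rewrite m0.
  move=> i im; rewrite ltNge; apply/negP => hi.
  by have := mmin i; rewrite hi (ltn_trans im ms) leqNgt im => /(_ isT).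
move=> k /andP[mk ks]; rewrite leNgt; apply/negP => hk.
have nmk : (m < k)%N.
  by rewrite ltn_neqAle mk andbT; apply/eqP => e; move: hk; rewrite -e ltNge hm.
have nkl : (k < (size s).-1)%N.
  have : k != (size s).-1 by apply/eqP => e; move: hk; rewrite e ltNge hl.
  by move: ks s0; lia.
have sl : ((size s).-1 < size s)%N by rewrite prednK.
have := hval_quad h s`[0] s`[m] s`[k] s`[(size s).-1].
have o1 := ts m k (size s).-1; rewrite nmk nkl sl in o1.
have o2 := ts 0%N m (size s).-1; rewrite m0 (ltn_trans nmk nkl) sl in o2.
have o3 := ts 0%N k (size s).-1; rewrite (ltn_trans m0 nmk) nkl sl in o3.
have o4 := ts 0%N m k; rewrite m0 nmk ks in o4.
move: (o1 isT isT) (o2 isT isT) (o3 isT isT) (o4 isT isT) => {}o1 {}o2 {}o3 {}o4 q.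
have p1 := mulr_gt0 o1 h0; have p2 := mulr_gt0 o2 hk.
have p3 := mulr_ge0_le0 (ltW o3) hm; have p4 := mulr_ge0_le0 (ltW o4) hl.
by lra.
Qed.

(** The first [m] vertices are in the open half-plane; the others are replaced
    by the points [q] and [r] at which the boundary line crosses the sides
    leaving and entering these [m] vertices. *)
Section Cut.
Variables (s : seq (plane R)) (h : R * R * R) (m : nat).
Hypothesis ts : turns_left s.
Hypothesis s3 : (3 <= size s)%N.
Hypothesis ms : (0 < m < size s)%N.
Hypothesis hpos : forall i, (i < m)%N -> 0 < hval h s`[i].
Hypothesis exneg : exists2 i, (i < size s)%N & hval h s`[i] < 0.
Variables (u v : R).
Let p := s`[m.-1].
Let p0 := s`[0].
Let q := segpt u p s`[m].
Let r := segpt v p0 s`[(size s).-1].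
Hypothesis u01 : 0 < u <= 1.
Hypothesis v01 : 0 < v <= 1.
Hypothesis hq : hval h q = 0.
Hypothesis hr : hval h r = 0.
Hypothesis u1 : hval h s`[m] < 0 -> u < 1.
Hypothesis v1 : hval h s`[(size s).-1] < 0 -> v < 1.

Let u_gt0 : 0 < u. Proof. by case/andP: u01. Qed.
Let v_gt0 : 0 < v. Proof. by case/andP: v01. Qed.
Let u_ge0 : 0 <= u. Proof. exact: ltW. Qed.
Let v_ge0 : 0 <= v. Proof. exact: ltW. Qed.
Let u_le1 : 0 <= 1 - u. Proof. by rewrite subr_ge0; case/andP: u01. Qed.
Let v_le1 : 0 <= 1 - v. Proof. by rewrite subr_ge0; case/andP: v01. Qed.

Let s' := take m s ++ [:: q; r].
Let m0 : (0 < m)%N. Proof. by case/andP: ms. Qed.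
Let mlt : (m < size s)%N. Proof. by case/andP: ms. Qed.

Let size_s' : size s' = m.+2.
Proof. by rewrite size_cat size_take mlt /= addn2. Qed.

Let nth_lt i : (i < m)%N -> s'`[i] = s`[i].
Proof. by move=> im; rewrite nth_cat size_take mlt im nth_take. Qed.

Let nth_q : s'`[m] = q.
Proof. by rewrite nth_cat size_take mlt ltnn subnn. Qed.

Let nth_r : s'`[m.+1] = r.
Proof. by rewrite nth_cat size_take mlt ltnNge leqnSn subSnn. Qed.

Let wk i j k : (i <= j <= k)%N -> (k < size s)%N -> 0 <= orient s`[i] s`[j] s`[k].
Proof.
move=> /andP[ij jk] ks.
have [->|ne] := eqVneq i j; first by rewrite orient_aab.
have [->|ne'] := eqVneq j k; first by rewrite orient_abb.
by apply/ltW/ts => //; rewrite !ltn_neqAle ne ij ne'.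
Qed.

Let last_lt : ((size s).-1 < size s)%N.
Proof. by rewrite prednK // (leq_trans _ s3). Qed.

Let m_last : (m <= (size s).-1)%N.
Proof. by rewrite -ltnS prednK // (leq_trans _ s3). Qed.

Let orient_pq i j : (i < j < m)%N -> 0 < orient s`[i] s`[j] q.
Proof.
move=> /andP[ij jm]; rewrite orient_segr.
have w1 : 0 <= orient s`[i] s`[j] p.
  by apply: wk; rewrite ?(leq_ltn_trans (leq_pred m)) // ltnW //= -ltnS prednK.
have w2 : 0 < orient s`[i] s`[j] s`[m] by apply: ts => //; rewrite ij.
apply: ltr_wpDl; first by rewrite mulr_ge0.
by rewrite mulr_gt0.
Qed.

Let orient_pr i j : (i < j < m)%N -> 0 < orient s`[i] s`[j] r.
Proof.
move=> /andP[ij jm]; rewrite orient_segr.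
have w1 : 0 <= orient s`[i] s`[j] p0.
  rewrite orient_cycle orient_cycle; apply: wk; first by rewrite leq0n ltnW.
  exact: ltn_trans mlt.
have w2 : 0 < orient s`[i] s`[j] s`[(size s).-1].
  by apply: ts => //; rewrite ij (leq_trans jm).
apply: ltr_wpDl; first by rewrite mulr_ge0.
by rewrite mulr_gt0.
Qed.

(** The delicate case is when the last vertex is the only one cut off: both
    crossing points are on sides meeting at this vertex, and they are distinct
    because it is strictly outside, by [exneg]. *)
Let orient_qr i : (i < m)%N -> 0 < orient s`[i] q r.
Proof.
move=> im; rewrite /q orient_segm /r !orient_segr.
have a1 : 0 <= orient s`[i] p p0.
  rewrite orient_cycle orient_cycle; apply: wk; first by rewrite leq0n -ltnS prednK.
  exact: leq_ltn_trans (leq_pred m) _.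
have im1 : (i <= m.-1)%N by rewrite -ltnS prednK.
have m1m : (m.-1 < m)%N by rewrite prednK.
have a2 : 0 <= orient s`[i] p s`[(size s).-1].
  by apply: wk => //; rewrite im1 (leq_trans (leq_pred m)).
have a3 : 0 <= orient s`[i] s`[m] p0.
  by rewrite orient_cycle orient_cycle; apply: wk => //; rewrite leq0n ltnW.
have a4 : 0 <= orient s`[i] s`[m] s`[(size s).-1].
  by apply: wk => //; rewrite (ltnW im).
have /andP[u0 u1'] := u01; have /andP[v0 v1'] := v01.
have [mN|mN] := eqVneq m (size s).-1; last first.
  have a4' : 0 < orient s`[i] s`[m] s`[(size s).-1].
    by apply: ts => //; rewrite im ltn_neqAle mN.
  have t1 : 0 <= (1 - u) * ((1 - v) * orient s`[i] p p0 + v * orient s`[i] p s`[(size s).-1]).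
    by apply: mulr_ge0 => //; apply: addr_ge0; apply: mulr_ge0.
  have t2 : 0 <= u * ((1 - v) * orient s`[i] s`[m] p0).
    by apply: mulr_ge0 => //; apply: mulr_ge0.
  have t3 : 0 < u * (v * orient s`[i] s`[m] s`[(size s).-1]).
    by apply: mulr_gt0 => //; apply: mulr_gt0.
  by lra.
have hm : hval h s`[m] < 0.
  have [k ks hk] := exneg.
  have [km|mk] := ltnP k m; first by move: (hpos km); rewrite ltNge (ltW hk).
  suff -> : m = k by [].
  by apply/eqP; rewrite eqn_leq mk /= mN -ltnS prednK // (leq_trans _ s3).
have uu : 0 < 1 - u by rewrite subr_gt0; exact: u1.
have vv : 0 < 1 - v by rewrite subr_gt0; apply: v1; rewrite -mN.
rewrite -mN orient_abb mulr0 addr0.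
rewrite -mN in a2.
have t0 : 0 <= (1 - u) * ((1 - v) * orient s`[i] p p0).
  by apply: mulr_ge0 => //; apply: mulr_ge0.
have [i0|i0] := eqVneq i 0%N.
  have m2 : (1 < m)%N by rewrite mN ltn_predRL.
  have a2' : 0 < orient s`[i] p s`[m].
    by apply: ts => //; rewrite i0 m1m andbT ltn_predRL.
  have t1 : 0 < (1 - u) * (v * orient s`[i] p s`[m]) by apply: mulr_gt0 => //; apply: mulr_gt0.
  have t2 : 0 <= u * ((1 - v) * orient s`[i] s`[m] p0) by apply: mulr_ge0 => //; apply: mulr_ge0.
  by lra.
have a3' : 0 < orient s`[i] s`[m] p0.
  by rewrite orient_cycle orient_cycle; apply: ts => //; rewrite lt0n i0.
have t1 : 0 <= (1 - u) * (v * orient s`[i] p s`[m]) by apply: mulr_ge0 => //; apply: mulr_ge0.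
have t2 : 0 < u * ((1 - v) * orient s`[i] s`[m] p0) by apply: mulr_gt0 => //; apply: mulr_gt0.
by lra.
Qed.

Lemma cut_turns_left : turns_left s'.
Proof.
move=> i j k /andP[ij jk]; rewrite size_s' => km.
have [km'|km'] := ltnP k m.
  rewrite !nth_lt //; first (by apply: ts; [rewrite ij|exact: ltn_trans mlt]).
    exact: ltn_trans km'.
  exact: ltn_trans ij (ltn_trans jk km').
have [kE|kE] : k = m \/ k = m.+1 by clear -km km'; lia.
  rewrite kE in jk *; rewrite nth_q !nth_lt //; last exact: ltn_trans jk.
  by apply: orient_pq; rewrite ij.
rewrite kE nth_r; rewrite kE ltnS leq_eqVlt in jk.
case/orP: jk => [/eqP jE|jm].
  by rewrite jE nth_q nth_lt -?jE //; apply: orient_qr; rewrite -jE.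
by rewrite !nth_lt ?(ltn_trans ij) //; apply: orient_pr; rewrite ij.
Qed.

Lemma cut_region : edge_region s' = edge_region s `&` [set z | 0 <= hval h z].
Proof.
have ts' := cut_turns_left.
have vr i : (i < size s)%N -> edge_region s s`[i].
  by move=> si; apply: vertex_in_region => //; exact: mem_nth.
have sl w a b : 0 < w <= 1 -> edge_region s a -> edge_region s b -> edge_region s (segpt w a b).
  move=> w01; have /convex_setE := @edge_region_convex R s; apply; lra.
have pm : (m.-1 < m)%N by rewrite prednK.
have qr : edge_region s q by apply: sl => //; apply: vr => //; exact: ltn_trans mlt.
have rr : edge_region s r by apply: sl => //; apply: vr => //; exact: ltn_trans mlt.
apply/seteqP; split.
  apply: region_fan => //; first by rewrite size_s' !ltnS.
    have /convex_setE c1 := @edge_region_convex R s.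
    have /convex_setE c2 := @halfplane_convex R h.
    by apply/convex_setE => w a b w01 [a1 a2] [b1 b2]; split; [exact: c1|exact: c2].
  move=> z; rewrite mem_cat !inE => /or3P[|/eqP ->|/eqP ->].
  - move=> /(nthP ((0, 0) : plane R))[j]; rewrite size_take mlt => jm <-.
    rewrite nth_take //; split; first by apply: vr; exact: ltn_trans mlt.
    exact/ltW/hpos.
  - by split=> //=; rewrite hq.
  - by split=> //=; rewrite hr.
move=> x [xs /= hx] i; rewrite size_s' => im.
have [im'|im'] := ltnP i.+1 m.
  rewrite modn_small; last exact: (ltn_trans im' (leqnSn _)).
  rewrite !nth_lt //; last exact: ltnW.
  have := xs i; rewrite modn_small; last exact: ltn_trans mlt.
  by apply; apply: ltn_trans mlt; exact: ltnW.
have [iE|[iE|iE]] : i = m.-1 \/ i = m \/ i = m.+1 by clear -im im'; lia.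
- rewrite iE prednK // modn_small // nth_q nth_lt // /q orient_segm orient_aab mulr0 add0r.
  rewrite mulr_ge0 //.
  have := xs m.-1; rewrite prednK // modn_small //; apply; exact: ltnW.
- rewrite iE modn_small // nth_q nth_r.
  have hp : 0 < hval h s`[0] by exact: hpos.
  have op : 0 < orient q r s`[0] by rewrite -orient_cycle; exact: orient_qr.
  (* the new side lies on the boundary line of the half-plane *)
  have E : orient q r x * hval h s`[0] = orient q r s`[0] * hval h x.
    have e1 : h.1.2 * (r.1 - q.1) + h.2 * (r.2 - q.2) = 0.
      have -> : h.1.2 * (r.1 - q.1) + h.2 * (r.2 - q.2) = hval h r - hval h q.
        by rewrite /hval; ring.
      by rewrite hq hr subrr.
    have hE y : hval h y = h.1.2 * (y.1 - q.1) + h.2 * (y.2 - q.2).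
      by rewrite -[LHS]subr0 -hq /hval; ring.
    apply/eqP; rewrite -subr_eq0 !hE /orient.
    set A := x.1 - q.1; set B := x.2 - q.2; set C := _.1 - q.1; set D := _.2 - q.2.
    have -> : (C * B - D * A) * (h.1.2 * (s`[0].1 - q.1) + h.2 * (s`[0].2 - q.2)) -
      (C * (s`[0].2 - q.2) - D * (s`[0].1 - q.1)) * (h.1.2 * A + h.2 * B) =
      (h.1.2 * C + h.2 * D) * (B * (s`[0].1 - q.1) - A * (s`[0].2 - q.2)) by ring.
    by rewrite e1 mul0r.
  by rewrite -(pmulr_lge0 _ hp) E mulr_ge0 // ltW.
- rewrite iE modnn nth_r nth_lt // /r orient_segl orient_aab mulr0 add0r.
  rewrite mulr_ge0 //.
  have := xs (size s).-1; rewrite prednK ?modnn; last by rewrite (leq_trans _ s3).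
  by apply.
Qed.
End Cut.
End PolygonCut.

(** * Bounded polyhedra are polygons *)

Section PolyhedronPolygon.
Variable R : realType.
Implicit Types (s t : seq (plane R)) (x y z a b c d : plane R) (h : R * R * R).
Notation "s '`[' i ]" := (nth ((0, 0) : plane R) s i) (at level 2, format "s '`[' i ]").

Lemma hval_bary h a b c x : orient a b c * hval h x =
  orient b c x * hval h a + orient c a x * hval h b + orient a b x * hval h c.
Proof. by rewrite /orient /hval; ring. Qed.

Lemma hval_zero h a b c : 0 < orient a b c ->
  hval h a = 0 -> hval h b = 0 -> hval h c = 0 -> h = (0, 0, 0).
Proof.
move=> o ha hb hc.
have z x : hval h x = 0.
  apply: (mulfI (lt0r_neq0 o)); rewrite hval_bary ha hb hc; ring.
move: (z (0, 0)) (z (1, 0)) (z (0, 1)); case: h {ha hb hc z} => -[k0 k1] k2.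
rewrite /hval /= => e0 e1 e2; congr (_, _, _); lra.
Qed.

Lemma inner_setI (A B : set (plane R)) z : inner A z -> inner B z -> inner (A `&` B) z.
Proof.
move=> [e e0 eA] [f f0 fB]; exists (Num.min e f); first by rewrite lt_min e0.
move=> w [/andP[w1 w2] /andP[w3 w4]].
have me : Num.min e f <= e by rewrite ge_min lexx.
have mf : Num.min e f <= f by rewrite ge_min lexx orbT.
by split; [apply: eA|apply: fB]; split; apply/andP; split; lra.
Qed.

Lemma inner_subset (A B : set (plane R)) z : A `<=` B -> inner A z -> inner B z.
Proof. by move=> AB [e e0 eA]; exists e => //; exact: subset_trans AB. Qed.

Lemma inner_halfplane h z : 0 < hval h z -> inner [set w | 0 <= hval h w] z.
Proof.
move=> hz; pose N := 1 + `|h.1.2| + `|h.2|.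
have N0 : 0 < N by rewrite /N; have := normr_ge0 h.1.2; have := normr_ge0 h.2; lra.
exists (hval h z / N); first by rewrite divr_gt0.
set e := _ / _; have e0 : 0 < e by rewrite divr_gt0.
move=> w [/andP[w1 w2] /andP[w3 w4]] /=.
have -> : hval h w = hval h z + (h.1.2 * (w.1 - z.1) + h.2 * (w.2 - z.2)).
  by rewrite /hval; ring.
have b1 : `|h.1.2 * (w.1 - z.1)| <= `|h.1.2| * e.
  by rewrite normrM ler_wpM2l // ler_norml; apply/andP; split; lra.
have b2 : `|h.2 * (w.2 - z.2)| <= `|h.2| * e.
  by rewrite normrM ler_wpM2l // ler_norml; apply/andP; split; lra.
have : N * e = hval h z by rewrite /e mulrC divfK // lt0r_neq0.
move: b1 b2; rewrite !ler_norml /N => /andP[b1 _] /andP[b2 _] NE; lra.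
Qed.

Lemma inner_polyhedron (hs : seq (R * R * R)) z :
  (forall h, h \in hs -> h = (0, 0, 0) \/ 0 < hval h z) -> inner (polyhedron hs) z.
Proof.
elim: hs => [|h hs IH] H; first by exists 1.
have -> : polyhedron (h :: hs) = [set w | 0 <= hval h w] `&` polyhedron hs.
  by apply/seteqP; split=> w /=; [move/andP|move=> [? ?]; apply/andP].
apply: inner_setI.
  have [->|] := H h (mem_head _ _); last exact: inner_halfplane.
  by exists 1 => // w _ /=; rewrite /hval /=; lra.
by apply: IH => g gs; apply: H; rewrite inE gs orbT.
Qed.

(** Past [z], away from [c], the function would be negative. *)
Lemma inner_halfplane_gt0 h z c : inner [set w | 0 <= hval h w] z -> hval h z = 0 ->
  0 < hval h c -> False.
Proof.
move=> [e e0 eK] hz hc.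
pose N := 1 + `|c.1 - z.1| + `|c.2 - z.2|.
have N0 : 0 < N by rewrite /N; have := normr_ge0 (c.1 - z.1); have := normr_ge0 (c.2 - z.2); lra.
pose d := e / N; have d0 : 0 < d by rewrite divr_gt0.
have dN : d * N = e by rewrite /d divfK // lt0r_neq0.
have small (r : R) : `|r| <= N -> - e <= - d * r <= e.
  move=> rN; rewrite -ler_norml mulNr normrN normrM (gtr0_norm d0) -dN ler_wpM2l //.
  exact: ltW.
have n1 : `|c.1 - z.1| <= N by rewrite /N; have := normr_ge0 (c.2 - z.2); lra.
have n2 : `|c.2 - z.2| <= N by rewrite /N; have := normr_ge0 (c.1 - z.1); lra.
have /andP[s1 s2] := small _ n1; have /andP[s3 s4] := small _ n2.
have : 0 <= hval h (segpt (- d) z c).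
  by apply: eK; split; rewrite /segpt /=; apply/andP; split; lra.
rewrite hval_seg hz mulr0 add0r mulNr oppr_ge0 leNgt => /negP; apply.
exact: mulr_gt0.
Qed.

Lemma region_cut s h : turns_left s -> (3 <= size s)%N ->
  (exists z, inner (edge_region s `&` [set z | 0 <= hval h z]) z) ->
  exists s', [/\ turns_left s', (3 <= size s')%N &
    edge_region s' = edge_region s `&` [set z | 0 <= hval h z]].
Proof.
move=> ts s3 [z iz].
case: (boolP (has (fun w => hval h w < 0) s)) => [/hasP[w0 ws hw0]|/hasPn nn]; last first.
  exists s; split=> //; apply/esym/setIidPl.
  apply: region_fan => //; first exact: halfplane_convex.
  by move=> w /nn; rewrite -leNgt.
have [/hasP[w1 w1s hw1]|/hasPn np] := boolP (has (fun w => 0 < hval h w) s); last first.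
  exfalso; pose g : R * R * R := (- h.1.1, - h.1.2, - h.2).
  have gE w : hval g w = - hval h w by rewrite /hval /=; ring.
  have sub : edge_region s `<=` [set w | 0 <= hval g w].
    apply: region_fan => //; first exact: halfplane_convex.
    by move=> w /np; rewrite -leNgt /= gE oppr_ge0.
  have [zs hz] := inner_sub iz.
  apply: (@inner_halfplane_gt0 g z w0); last by rewrite gE oppr_gt0.
    by apply: inner_subset iz => w [/sub].
  apply/eqP; rewrite eq_le; apply/andP; split; last exact: sub.
  by rewrite gE oppr_le0.
have s0 : (0 < size s)%N by exact: leq_trans s3.
(* rotate so that the positive vertices come first *)
have [n [m [t0 tl]]] : exists n m, 0 < hval h (rot n (rot m s))`[0] /\
    hval h (rot n (rot m s))`[(size s).-1] <= 0.
  pose m := index w0 s; pose t := rot m s.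
  have t0 : t`[0] = w0.
    by rewrite /t /rot nth_cat size_drop subn_gt0 index_mem ws nth_drop addn0 nth_index.
  pose n := find (fun w => 0 < hval h w) t.
  have nt : (n < size t)%N by rewrite -has_find; apply/hasP; exists w1; rewrite ?mem_rot.
  have n0 : (0 < n)%N.
    rewrite lt0n; apply/negP => /eqP n0.
    have : 0 < hval h t`[n] by apply: (nth_find _ (a := fun w => 0 < hval h w)); rewrite has_find.
    by rewrite n0 t0 ltNge (ltW hw0).
  exists n, m; rewrite -/t; split.
    rewrite /rot nth_cat size_drop subn_gt0 nt nth_drop addn0.
    by apply: (nth_find _ (a := fun w => 0 < hval h w)); rewrite has_find.
  have st : size t = size s by rewrite size_rot.
  rewrite -st /rot nth_cat size_drop.
  have -> : ((size t).-1 < size t - n)%N = false by clear -n0 nt; lia.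
  have -> : ((size t).-1 - (size t - n) = n.-1)%N by clear -n0 nt; lia.
  rewrite nth_take; last by rewrite prednK.
  by rewrite leNgt; apply: (negbT (before_find _ (a := fun w => 0 < hval h w) _)); rewrite prednK.
set t := rot n (rot m s) in t0 tl.
have tt : turns_left t by do 2 apply: turns_left_rot.
have st : size t = size s by rewrite !size_rot.
have rt : edge_region t = edge_region s.
  by rewrite !region_rot ?size_rot //; exact: turns_left_rot.
rewrite -rt; rewrite -st in tl s3 s0.
have [k [kt kpos kneg]] := signs_alternate_once tt s0 t0 tl.
have /andP[k0 kt'] := kt.
have exneg : exists2 i, (i < size t)%N & hval h t`[i] < 0.
  have w0t : w0 \in t by rewrite !mem_rot.
  by exists (index w0 t); rewrite ?index_mem ?nth_index.
have hk1 : 0 < hval h t`[k.-1] by apply: kpos; rewrite prednK.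
have hk : hval h t`[k] <= 0 by apply: kneg; rewrite leqnn.
have [u [u01 hq u1]] := crossing hk1 hk.
have [v [v01 hr v1]] := crossing t0 tl.
exists (take k t ++ [:: segpt u t`[k.-1] t`[k]; segpt v t`[0] t`[(size t).-1]]); split.
- exact: (cut_turns_left tt s3 kt kpos exneg u01 v01 u1 v1).
- by rewrite size_cat size_take kt' /= addn2 !ltnS.
- exact: (cut_region tt s3 kt kpos exneg u01 v01 hq hr u1 v1).
Qed.

Lemma square_region W : 0 < W -> exists s, [/\ turns_left s, (3 <= size s)%N &
  edge_region s = sqr ((0, 0) : plane R) W].
Proof.
move=> W0; exists ([:: (- W, - W); (W, - W); (W, W); (- W, W)] : seq (plane R)); split=> //.
  move=> i j k /andP[ij jk] /= k4.
  have ww : 0 < W * W by rewrite mulr_gt0.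
  move: k4 jk ij; case: k => [|[|[|[|k]]]] // _; case: j => [|[|[|j]]] // _;
    case: i => [|[|i]] // _; rewrite /orient /=; lra.
apply/seteqP; split=> x.
  move=> xs; have := xs 0%N isT; have := xs 1%N isT; have := xs 2%N isT; have := xs 3%N isT.
  rewrite /orient /=.
  rewrite !(subrr, mul0r, mulr0, addr0, subr0, sub0r) !opprK => h3 h2 h1 h0.
  have W2 : 0 < W + W by lra.
  split; apply/andP; split; rewrite ?sub0r ?add0r /=.
  - have : 0 <= (W + W) * (x.1 + W) by move: h3; rewrite /=; lra.
    by rewrite pmulr_rge0 //; lra.
  - have : 0 <= (W + W) * (W - x.1) by move: h1; rewrite /=; lra.
    by rewrite pmulr_rge0 //; lra.
  - have : 0 <= (W + W) * (x.2 + W) by move: h0; rewrite /=; lra.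
    by rewrite pmulr_rge0 //; lra.
  - have : 0 <= (W + W) * (W - x.2) by move: h2; rewrite /=; lra.
    by rewrite pmulr_rge0 //; lra.
move=> [/= /andP[a1 a2] /andP[a3 a4]] i.
have p1 : 0 <= (W + W) * (x.1 + W) by rewrite mulr_ge0 //; lra.
have p2 : 0 <= (W + W) * (W - x.1) by rewrite mulr_ge0 //; lra.
have p3 : 0 <= (W + W) * (x.2 + W) by rewrite mulr_ge0 //; lra.
have p4 : 0 <= (W + W) * (W - x.2) by rewrite mulr_ge0 //; lra.
by case: i => [|[|[|[|i]]]] //= _; rewrite /orient /=; lra.
Qed.

Lemma polyhedron_region W hs : 0 < W ->
  (exists z, inner (sqr ((0, 0) : plane R) W `&` polyhedron hs) z) ->
  exists s, [/\ turns_left s, (3 <= size s)%N &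
    edge_region s = sqr ((0, 0) : plane R) W `&` polyhedron hs].
Proof.
move=> W0; elim: hs => [|h hs IH].
  have [s [ts s3 sE]] := square_region W0.
  by exists s; split=> //; rewrite sE; apply/esym/setIidPl.
have -> : polyhedron (h :: hs) = polyhedron hs `&` [set w | 0 <= hval h w].
  by apply/seteqP; split=> w /=; [move/andP => [? ?]|move=> [? ?]; apply/andP].
rewrite setIA => -[z iz].
have [|s [ts s3 sE]] := IH; first by exists z; apply: inner_subset iz => w [].
rewrite -sE; apply: region_cut => //; exists z; by rewrite sE.
Qed.

(** The midpoint of a side of the polygon is not an inner point, so one of the
    half-planes has it on its boundary; being nonnegative at both ends, the
    affine function vanishes on the side. *)
Lemma side_tight s hs i : turns_left s -> (3 <= size s)%N -> (i < size s)%N ->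
  edge_region s = polyhedron hs ->
  exists j : 'I_(size hs), let h := nth (0, 0, 0) hs j in
   [/\ h != (0, 0, 0), hval h s`[i] = 0 & hval h s`[i.+1 %% size s] = 0].
Proof.
move=> ts s3 si sE; have s0 : (0 < size s)%N by exact: leq_trans s3.
pose a := s`[i]; pose b := s`[i.+1 %% size s]; pose mid := segpt (1 / 2) a b.
have aP : edge_region s a by apply: vertex_in_region => //; exact: mem_nth.
have bP : edge_region s b by apply: vertex_in_region => //; apply: mem_nth; rewrite ltn_mod.
have mP : edge_region s mid.
  by have /convex_setE := @edge_region_convex R s; apply => //; lra.
have [/existsP[j /andP[jn /eqP jm]]|nj] := boolP [exists j : 'I_(size hs),
    (nth (0, 0, 0) hs j != (0, 0, 0)) && (hval (nth (0, 0, 0) hs j) mid == 0)].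
  exists j => h; split=> //; rewrite sE in aP bP;
    have := (polyhedronP hs a).1 aP h (mem_nth _ (ltn_ord j));
    have := (polyhedronP hs b).1 bP h (mem_nth _ (ltn_ord j));
    move: jm; rewrite -/h /mid hval_seg -/a -/b; lra.
exfalso.
have im : inner (edge_region s) mid.
  rewrite sE; apply: inner_polyhedron => h hhs.
  have [->|hn] := eqVneq h (0, 0, 0); [by left|right].
  rewrite lt_neqAle; apply/andP; split; last by rewrite sE in mP; exact: ((polyhedronP hs mid).1 mP).
  apply: contra nj; rewrite eq_sym => hm; apply/existsP.
  have ih : (index h hs < size hs)%N by rewrite index_mem.
  by exists (Ordinal ih); rewrite /= nth_index // hn.
(* the third vertex is strictly on the left of the side *)
have [j [sj ji ji']] : exists j, [/\ (j < size s)%N, j != i & j != (i.+1 %% size s)%N].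
  have [|h] := ltnP i.+2 (size s).
    move=> h; exists i.+2; rewrite modn_small; last exact: ltnW.
    by split=> //; [rewrite gtn_eqF|rewrite gtn_eqF].
  have [e|ne] := eqVneq i.+1 (size s).
    exists 1%N; rewrite e modnn; split=> //; first exact: leq_trans s3.
    by rewrite ltn_eqF // -ltnS e.
  exists 0%N; rewrite modn_small; last by rewrite ltn_neqAle ne.
  by split=> //; rewrite ltn_eqF //; clear -h s3; lia.
apply: (@inner_halfplane_gt0 (side_plane a b) mid s`[j]).
- by apply: inner_subset im => x xs /=; rewrite hval_side; exact: xs.
- by rewrite hval_side /mid orient_segr orient_aba orient_abb; ring.
- by rewrite hval_side; exact: turns_left_edge.
Qed.

(** Two sides have three distinct ends, which are not aligned; a nonzero affine
    function vanishes on at most one side. *)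
Lemma side_number s hs : turns_left s -> (3 <= size s)%N ->
  edge_region s = polyhedron hs -> (size s <= size hs)%N.
Proof.
move=> ts s3 sE.
have /choice[f Hf] : forall i : 'I_(size s), exists j : 'I_(size hs), let h := nth (0, 0, 0) hs j in
   [/\ h != (0, 0, 0), hval h s`[i] = 0 & hval h s`[i.+1 %% size s] = 0].
  by move=> i; exact: side_tight.
suff fi : injective f.
  by have := leq_card f fi; rewrite !card_ord.
move=> i i' fii'; apply/eqP/negPn/negP => ne.
have [hn z1 z2] := Hf i; have [_ z3 z4] := Hf i'; rewrite -fii' in z3 z4.
have key j : (j < size s)%N -> j != i -> j != (i.+1 %% size s)%N ->
    hval (nth (0, 0, 0) hs (f i)) s`[j] = 0 -> False.
  move=> sj ji ji' zj; move/negP: hn; apply; apply/eqP.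
  exact: (hval_zero (turns_left_edge ts (ltn_ord i) sj ji ji')).
have ne' : (i' : nat) != i by apply: contra ne => /eqP e; apply/eqP/val_inj.
have [e|n1] := eqVneq (i' : nat) (i.+1 %% size s)%N; last exact: (key i').
apply: (key (i'.+1 %% size s)%N) => //; first by rewrite ltn_mod (leq_trans _ s3).
  rewrite e; have := ltn_ord i => si; have [|h] := ltnP i.+1 (size s).
    move=> h; rewrite [(i.+1 %% _)%N]modn_small //.
    have [h2|h2] := ltnP i.+2 (size s); first by rewrite modn_small // gtn_eqF.
    have -> : i.+2 = size s by clear -h h2; lia.
    by rewrite modnn ltn_eqF //; clear -s3 h2; lia.
  have -> : i.+1 = size s by clear -si h; lia.
  by rewrite modnn modn_small ?ltn_eqF //; clear -s3 h; lia.
rewrite -e; have := ltn_ord i' => si'; have [|h] := ltnP i'.+1 (size s).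
  by move=> h; rewrite modn_small // gtn_eqF.
have -> : i'.+1 = size s by clear -si' h; lia.
by rewrite modnn ltn_eqF //; clear -s3 h; lia.
Qed.

(** Starting from a large square, cut by the half-planes one after the other. *)
Lemma polyhedron_ngon W hs : 0 < W -> polyhedron hs `<=` sqr ((0, 0) : plane R) W ->
  (exists z, inner (polyhedron hs) z) ->
  exists2 n, (n <= size hs)%N & is_ngon n (polyhedron hs).
Proof.
move=> W0 bd [z iz].
have PE : sqr ((0, 0) : plane R) W `&` polyhedron hs = polyhedron hs by exact/setIidPr.
have [|s [ts s3]] := @polyhedron_region W hs W0; first by exists z; rewrite PE.
rewrite PE => sE; exists (size s); first exact: side_number.
by rewrite -sE; exact: is_ngon_region.
Qed.
End PolyhedronPolygon.

(** * Polygons are convex bodies *)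

Section FiniteHull.
Variable R : realType.
Implicit Types (s : seq (plane R)) (a b c z w : plane R).

Lemma convex_hull_convex (A : set (plane R)) : @convex_set R (plane R) (convex_hull A).
Proof.
apply/convex_setE => t z w t01 hz hw C [cC AC].
by have /convex_setE := cC; apply => //; [exact: hz|exact: hw].
Qed.

Lemma segpt_continuous a : continuous (fun p : R^o * plane R => segpt p.1 a p.2).
Proof.
move=> p.
have cont (f : plane R -> R^o) : continuous f ->
    (1 - q.1) * f a + q.1 * f q.2 @[q --> p] --> (1 - p.1) * f a + p.1 * f p.2.
  move=> cf; apply: cvgD; apply: cvgM.
  - by apply: cvgB; [exact: cvg_cst|exact: cvg_fst].
  - exact: cvg_cst.
  - exact: cvg_fst.
  - by apply: cvg_comp; [exact: cvg_snd|exact: cf].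
exact: (cvg_pair (cont fst (fun z => cvg_fst)) (cont snd (fun z => cvg_snd))).
Qed.

Lemma cone_convex a (C : set (plane R)) : @convex_set R (plane R) C ->
  @convex_set R (plane R) [set segpt p.1 a p.2 | p in `[0, 1]%classic `*` C].
Proof.
move=> /convex_setE cC; apply/convex_setE => t z w /andP[t0 t1].
move=> [[u z'] /= [u01 Cz] <-] [[v w'] /= [v01 Cw] <-] /=.
rewrite in_itv /= in u01 v01; move: u01 v01 => /andP[u0 u1] /andP[v0 v1].
pose T := (1 - t) * u + t * v.
have A1 : 0 <= (1 - t) * u by rewrite mulr_ge0 //; lra.
have A2 : 0 <= t * v by rewrite mulr_ge0.
have [T0|T0] := eqVneq T 0.
  exists (0, z'); first by split=> //=; rewrite in_itv /= lexx ler01.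
  have e1 : (1 - t) * u = 0 by rewrite /T in T0; lra.
  have e2 : t * v = 0 by rewrite /T in T0; lra.
  rewrite /segpt /=; congr pair; rewrite !(subr0, mul1r, mul0r, addr0).
    have -> : (1 - t) * ((1 - u) * a.1 + u * z'.1) + t * ((1 - v) * a.1 + v * w'.1) =
      a.1 + ((1 - t) * u) * (z'.1 - a.1) + (t * v) * (w'.1 - a.1) by ring.
    by rewrite e1 e2; ring.
  have -> : (1 - t) * ((1 - u) * a.2 + u * z'.2) + t * ((1 - v) * a.2 + v * w'.2) =
      a.2 + ((1 - t) * u) * (z'.2 - a.2) + (t * v) * (w'.2 - a.2) by ring.
  by rewrite e1 e2; ring.
have Tp : 0 < T by rewrite lt_neqAle eq_sym T0 addr_ge0.
have T1 : T <= 1.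
  have B1 : 0 <= (1 - t) * (1 - u) by rewrite mulr_ge0 //; lra.
  have B2 : 0 <= t * (1 - v) by rewrite mulr_ge0 ?subr_ge0.
  by rewrite /T; lra.
exists (T, segpt (t * v / T) z' w').
  split=> /=; first by rewrite in_itv /= ltW.
  apply: cC => //; rewrite divr_ge0 ?ler_pdivrMr ?(ltW Tp) //= mul1r /T; lra.
have E : 1 - t * v / T = (1 - t) * u / T.
  by apply: (mulIf T0); rewrite mulrBl !divfK // /T; ring.
rewrite /segpt /= E; congr pair.
  transitivity ((1 - T) * a.1 + (1 - t) * u * z'.1 + t * v * w'.1); first by field.
  by rewrite /T; ring.
transitivity ((1 - T) * a.2 + (1 - t) * u * z'.2 + t * v * w'.2); first by field.
by rewrite /T; ring.
Qed.

(** Adding a point to a finite set replaces its hull by the cone over it, an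
    image of the compact [[0, 1]] times the hull. *)
Lemma finite_hull_compact s : compact (convex_hull [set z | z \in s]).
Proof.
suff [C [coC cC sC minC]] : exists C : set (plane R), [/\ compact C,
    @convex_set R (plane R) C, (forall z, z \in s -> C z) &
    forall D, @convex_set R (plane R) D -> (forall z, z \in s -> D z) -> C `<=` D].
  suff -> : convex_hull [set z | z \in s] = C by [].
  apply/seteqP; split; first by move=> z; apply; split.
  by move=> z Cz D [cD sD]; exact: minC Cz.
elim: s => [|a s [C [coC cC sC minC]]].
  exists set0; split; first exact: compact0.
  - by apply/convex_setE => t z w _ [].
  - by move=> z; rewrite in_nil.
  - by move=> D _ _ z [].
case: s sC minC => [|b s] sC minC.
  exists [set a]; split.
  - exact: compact_set1.
  - apply/convex_setE => t z w t01 -> ->.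
    suff -> : segpt t a a = a by [].
    by rewrite [RHS]surjective_pairing /segpt; congr pair; ring.
  - by move=> z; rewrite inE => /eqP ->.
  - by move=> D cD sD z ->; apply: sD; rewrite inE.
exists [set segpt p.1 a p.2 | p in (`[0, 1]%classic : set R^o) `*` C]; split.
- apply: continuous_compact; first by apply: continuous_subspaceT => p; exact: segpt_continuous.
  by apply: compact_setX => //; exact: segment_compact.
- exact: cone_convex.
- move=> z; rewrite inE => /orP[/eqP ->|zs].
    exists (0, b) => /=; first by split=> /=; [rewrite in_itv /= lexx ler01|apply: sC; rewrite mem_head].
    by rewrite [RHS]surjective_pairing /segpt; congr pair => /=; ring.
  exists (1, z) => /=; first by split=> /=; [rewrite in_itv /= lexx ler01|exact: sC].
  by rewrite [RHS]surjective_pairing /segpt; congr pair => /=; ring.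
- move=> D cD sD _ [[t z] /= [+ Cz] <-]; rewrite in_itv /= => t01.
  have /convex_setE := cD; apply=> //; first by apply: sD; rewrite mem_head.
  by apply: minC Cz => // w ws; apply: sD; rewrite inE ws orbT.
Qed.

Lemma triangle_inner a b c (K : set (plane R)) : @convex_set R (plane R) K ->
  K a -> K b -> K c -> 0 < orient a b c -> exists z, inner K z.
Proof.
move=> cK Ka Kb Kc o.
pose z : plane R := ((a.1 + b.1 + c.1) / 3, (a.2 + b.2 + c.2) / 3).
exists z.
have o1 : orient a b z = orient a b c / 3 by rewrite /orient /z /=; field.
have o2 : orient b c z = orient a b c / 3 by rewrite /orient /z /=; field.
have o3 : orient c a z = orient a b c / 3 by rewrite /orient /z /=; field.
apply: (@inner_subset _ (polyhedron [:: side_plane a b; side_plane b c; side_plane c a])).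
  move=> x /= /and4P[]; rewrite !hval_side => h1 h2 h3 _.
  exact: (triangle_point cK Ka Kb Kc).
by apply: inner_polyhedron => h; rewrite !inE => /or3P[] /eqP ->; right;
  rewrite hval_side ?o1 ?o2 ?o3 divr_gt0.
Qed.

Lemma ngon_convex_body n (P : set (plane R)) : is_ngon n P -> convex_body P.
Proof.
move=> [n3 [v [vo ->]]]; split; first exact: convex_hull_convex.
  have -> : range v = [set z | z \in codom v].
    apply/seteqP; split=> z /=; first by case=> i _ <-; exact: codom_f.
    by move=> /codomP[i ->]; exists i.
  exact: finite_hull_compact.
have n0 : (0 < n)%N by exact: leq_trans n3.
have n1 : (1 < n)%N by exact: leq_trans n3.
have mem i : convex_hull (range v) (v i) by move=> C [_ sC]; apply: sC; exists i.
have [z iz] : exists z, inner (convex_hull (range v)) z.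
  apply: (triangle_inner (@convex_hull_convex _) (mem (Ordinal n0)) (mem (ordS (Ordinal n0)))
    (mem (Ordinal n3))).
  by apply: vo => //; rewrite -val_eqE /= modn_small.
by exists z; apply/interior_inner.
Qed.
End FiniteHull.

(** * Area *)

Section AreaMeasure.
Variable R : realType.
Implicit Types (A B G K : set (plane R)) (z w : plane R).

Notation mR := (measurableTypeR R).
Definition area_measure : {measure set (mR * mR)%type -> \bar R} :=
  ((@lebesgue_measure R) \x (@lebesgue_measure R))%E.

Definition planar_measurable A : Prop := measurable (A : set (mR * mR)).

Lemma area_measureE A : area A = area_measure A.
Proof. by []. Qed.

Lemma measurable_rect (x1 x2 y1 y2 : R) :
  planar_measurable [set z : plane R | x1 <= z.1 <= x2 /\ y1 <= z.2 <= y2].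
Proof.
rewrite /planar_measurable.
have -> : [set z : plane R | x1 <= z.1 <= x2 /\ y1 <= z.2 <= y2] =
   (`[x1, x2]%classic : set mR) `*` (`[y1, y2]%classic : set mR).
  by apply/seteqP; split=> z /=; rewrite !in_itv.
by apply: measurableX; exact: measurable_itv.
Qed.

Lemma area_rect (x1 x2 y1 y2 : R) : x1 <= x2 -> y1 <= y2 ->
  area [set z : plane R | x1 <= z.1 <= x2 /\ y1 <= z.2 <= y2] = ((x2 - x1) * (y2 - y1))%:E.
Proof.
move=> x12 y12.
have -> : [set z : plane R | x1 <= z.1 <= x2 /\ y1 <= z.2 <= y2] =
   (`[x1, x2]%classic : set mR) `*` (`[y1, y2]%classic : set mR).
  by apply/seteqP; split=> z /=; rewrite !in_itv.
rewrite /area product_measure1E; try exact: measurable_itv.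
have len (a b : R) : a <= b -> lebesgue_measure (`[a, b]%classic : set R) = (b - a)%:E.
  move=> ab; rewrite lebesgue_measure_itv /= lte_fin; case: ltP => // ba.
  by have -> : a = b by [apply/eqP; rewrite eq_le ab]; rewrite subrr.
by rewrite EFinM; congr (_ * _)%E; exact: len.
Qed.

Lemma area_sqr z (e : R) : 0 <= e -> area (sqr z e) = ((e *+ 2) ^+ 2)%:E.
Proof.
move=> e0; rewrite /sqr area_rect; [|lra|lra].
by congr EFin; rewrite expr2 -mulr_natr; ring.
Qed.

Lemma measurable_sqr z (e : R) : planar_measurable (sqr z e).
Proof. exact: measurable_rect. Qed.

(** The product sigma-algebra is generated by rectangles; an open set is the
    union of countably many squares with rational centres. *)
Lemma open_planar_measurable G : open G -> planar_measurable G.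
Proof.
move=> oG; rewrite /planar_measurable.
pose F (n : nat) (q1 q2 : rat) : set (mR * mR) :=
  [set z | sqr ((ratr q1, ratr q2) : plane R) n.+1%:R^-1 z /\
           sqr ((ratr q1, ratr q2) : plane R) n.+1%:R^-1 `<=` G].
have -> : G = \bigcup_n \bigcup_q1 \bigcup_q2 F n q1 q2.
  apply/seteqP; split=> z; last by case=> n _ [q1 _] [q2 _] [+ +] => /[swap]; apply.
  move=> Gz; have /interior_inner[e e0 eG] : interior G z by apply: open_nbhs_nbhs.
  have [n ne] : exists n : nat, n.+1%:R^-1 < e / 2.
    have e20 : 0 < e / 2 by rewrite divr_gt0.
    exists (Num.truncn (e / 2)^-1); rewrite invf_plt ?posrE ?ltr0n //.
    exact: truncnS_gt.
  exists n => //.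
  have : 0 < n.+1%:R^-1 :> R by rewrite invr_gt0 ltr0n.
  rewrite /F; move: (n.+1%:R^-1 : R) ne => d de d0.
  have [q1 h1] := @rat_in_itvoo R (z.1 - d) (z.1 + d) ltac:(lra).
  have [q2 h2] := @rat_in_itvoo R (z.2 - d) (z.2 + d) ltac:(lra).
  rewrite in_itv /= in h1; rewrite in_itv /= in h2.
  move: h1 h2 => /andP[h11 h12] /andP[h21 h22].
  exists q1 => //; exists q2 => //; split.
    by split; apply/andP; split => /=; lra.
  move=> w [/= /andP[w1 w2] /andP[w3 w4]]; apply: eG.
  by split; apply/andP; split; lra.
apply: bigcupT_measurable => n; apply: bigcupT_measurable_rat => q1.
apply: bigcupT_measurable_rat => q2.
have [s|ns] := pselect (sqr ((ratr q1, ratr q2) : plane R) n.+1%:R^-1 `<=` G).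
  rewrite [F _ _ _](_ : _ = sqr ((ratr q1, ratr q2) : plane R) n.+1%:R^-1).
    exact: measurable_sqr.
  by apply/seteqP; split=> w; [case|].
rewrite [F _ _ _](_ : _ = set0) //.
by apply/seteqP; split=> w; [case|].
Qed.

Lemma closed_planar_measurable K : closed K -> planar_measurable K.
Proof.
by move=> cK; rewrite -[K]setCK; apply: measurableC; apply: open_planar_measurable; exact: closed_openC.
Qed.

Lemma compact_planar_measurable K : compact K -> planar_measurable K.
Proof. by move=> cK; apply: closed_planar_measurable; apply: compact_closed => //; exact: norm_hausdorff. Qed.

Lemma le_area A B : planar_measurable A -> planar_measurable B -> A `<=` B ->
  (area A <= area B)%E.
Proof. by move=> mA mB AB; rewrite !area_measureE; apply: le_measure; rewrite ?inE. Qed.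

Lemma area_fin A W : planar_measurable A -> A `<=` sqr ((0, 0) : plane R) W ->
  area A \is a fin_num.
Proof.
move=> mA AW.
have [W0|W0] := leP 0 W; last first.
  have -> : A = set0.
    by apply/seteqP; split=> // z /AW [/= /andP[h1 h2] _]; lra.
  by rewrite area_measureE measure0.
rewrite ge0_fin_numE; last by rewrite area_measureE measure_ge0.
apply: le_lt_trans (le_area mA (measurable_sqr _ W) AW) _.
by rewrite area_sqr // ltry.
Qed.

(** Fubini: almost all vertical slices have at most one point. *)
Lemma area_null A (ev : seq R) : planar_measurable A ->
  (forall x y y', x \notin ev -> A (x, y) -> A (x, y') -> y = y') -> area A = 0%E.
Proof.
move=> mA sl; rewrite /area /product_measure1.
have mf := measurable_fun_xsection (@lebesgue_measure R) mA.
have mev : measurable ([set` ev] : set mR) 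
  by apply: countable_measurable; [move=> t; exact: measurable_set1|exact/finite_set_countable/finite_seq].
have z0 : lebesgue_measure ([set` ev] : set R) = 0%E.
  by apply: countable_lebesgue_measure0; exact/finite_set_countable/finite_seq.
apply: (eq_trans (@ge0_negligible_integral _ _ _ (@lebesgue_measure R) setT [set` ev] _
  mev measurableT mf _ z0)).
  by move=> x _ /=; exact: measure_ge0.
apply: integral0_eq => x [_ /= xev].
have [[y Ay]|nA] := pselect (exists y, A (x, y)).
  apply/eqP; rewrite eq_le measure_ge0 andbT.
  rewrite -(lebesgue_measure_set1 y); apply: le_outer_measure.
  move=> y' /=; rewrite /xsection /= inE => Ay'.
  by apply: (sl x) => //; apply/negP.
have -> : xsection (A : set (mR * mR)) x = set0; last by rewrite measure0.
by apply/seteqP; split=> // y; rewrite /xsection /= inE => Ay; case: nA; exists y.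
Qed.
End AreaMeasure.

Section AreaSums.
Variable R : realType.
Implicit Types (A B G K : set (plane R)) (z w : plane R).
Notation mR := (measurableTypeR R).

Lemma bigsetU_measurable (I : eqType) (A : I -> set (plane R)) (r : seq I) :
  (forall i, i \in r -> planar_measurable (A i)) ->
  planar_measurable (\big[setU/set0]_(i <- r) A i).
Proof.
elim: r => [|i r IH] mA; first by rewrite big_nil; exact: measurable0.
rewrite big_cons; apply: measurableU; first by apply: mA; rewrite mem_head.
by apply: IH => j jr; apply: mA; rewrite inE jr orbT.
Qed.

Lemma area_bigsetU_le (I : eqType) (A : I -> set (plane R)) (r : seq I) :
  (forall i, i \in r -> planar_measurable (A i)) ->
  (area (\big[setU/set0]_(i <- r) A i) <= \sum_(i <- r) area (A i))%E.
Proof.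
elim: r => [|i r IH] mA; first by rewrite !big_nil area_measureE measure0.
rewrite !big_cons.
have mi : planar_measurable (A i) by apply: mA; rewrite mem_head.
have mr j : j \in r -> planar_measurable (A j).
  by move=> jr; apply: mA; rewrite inE jr orbT.
have := measureU2 (area_measure R) mi (bigsetU_measurable mr).
by move/le_trans; apply; exact: leeD2l (IH mr).
Qed.

Lemma area_bigsetU (I : eqType) (A : I -> set (plane R)) (r : seq I) : uniq r ->
  (forall i, i \in r -> planar_measurable (A i)) ->
  (forall i, i \in r -> area (A i) \is a fin_num) ->
  (forall i j, i \in r -> j \in r -> i != j -> area (A i `&` A j) = 0%E) ->
  area (\big[setU/set0]_(i <- r) A i) = (\sum_(i <- r) area (A i))%E.
Proof.
elim: r => [|i r IH] /=; first by rewrite !big_nil area_measureE measure0.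
move=> /andP[ir ur] mA fA dA.
have mi : planar_measurable (A i) by apply: mA; rewrite mem_head.
have mr j : j \in r -> planar_measurable (A j).
  by move=> jr; apply: mA; rewrite inE jr orbT.
have mB := bigsetU_measurable mr.
rewrite !big_cons -IH //; last 2 first.
- by move=> j jr; apply: fA; rewrite inE jr orbT.
- by move=> j k jr kr; apply: dA; rewrite inE ?jr ?kr orbT.
have fi : (area_measure R (A i) < +oo)%E.
  by rewrite -ge0_fin_numE ?measure_ge0 //; apply: fA; rewrite mem_head.
rewrite !area_measureE (measureUfinl mi mB fi).
rewrite [X in (_ - X)%E](_ : _ = 0%E) ?sube0 //.
apply/eqP; rewrite eq_le measure_ge0 andbT.
have -> : A i `&` \big[setU/set0]_(j <- r) A j = \big[setU/set0]_(j <- r) (A i `&` A j).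
  elim: (r) => [|j s IHs]; first by rewrite !big_nil setI0.
  by rewrite !big_cons setIUr IHs.
have mI j : j \in r -> planar_measurable (A i `&` A j).
  by move=> jr; apply: measurableI => //; exact: mr.
apply: le_trans (area_bigsetU_le mI) _.
rewrite big_seq big1 // => j jr; apply: dA; rewrite ?mem_head // ?inE ?jr ?orbT //.
by apply: contraNneq ir => ->.
Qed.

Lemma fine_area_sum_le (I : eqType) (A : I -> set (plane R)) (r : seq I) B W : uniq r ->
  (forall i, i \in r -> planar_measurable (A i)) ->
  (forall i, i \in r -> A i `<=` B) -> planar_measurable B ->
  B `<=` sqr ((0, 0) : plane R) W ->
  (forall i j, i \in r -> j \in r -> i != j -> area (A i `&` A j) = 0%E) ->
  \sum_(i <- r) fine (area (A i)) <= fine (area B).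
Proof.
move=> ur mA AB mB BW dA.
have fA i : i \in r -> area (A i) \is a fin_num.
  by move=> ir; apply: (area_fin (W := W)); [exact: mA|exact: subset_trans (AB _ ir) BW].
have -> : \sum_(i <- r) fine (area (A i)) = fine (\sum_(i <- r) area (A i))%E.
  rewrite big_seq [in RHS]big_seq -sum_fine //.
rewrite -area_bigsetU //.
have mU := bigsetU_measurable mA.
have UB : \big[setU/set0]_(i <- r) A i `<=` B.
  rewrite big_seq; apply: (big_ind (fun X => X `<=` B)) => [z []|X Y XB YB z|i /AB //].
  by case=> [/XB|/YB].
apply: fine_le; [|exact: (area_fin (W := W))|exact: le_area].
by apply: (area_fin (W := W)) => //; exact: subset_trans UB BW.
Qed.

Lemma fine_area_le_cover (I : eqType) (A : I -> set (plane R)) (r : seq I) B :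
  (forall i, i \in r -> planar_measurable (A i)) ->
  (forall i, i \in r -> area (A i) \is a fin_num) ->
  planar_measurable B -> (forall z, B z -> exists2 i, i \in r & A i z) ->
  fine (area B) <= \sum_(i <- r) fine (area (A i)).
Proof.
move=> mA fA mB BA.
have -> : \sum_(i <- r) fine (area (A i)) = fine (\sum_(i <- r) area (A i))%E.
  by rewrite big_seq [in RHS]big_seq -sum_fine.
have fS : (\sum_(i <- r) area (A i))%E \is a fin_num.
  by rewrite big_seq; apply/sum_fin_numP => i ir _; exact: fA.
have le : (area B <= \sum_(i <- r) area (A i))%E.
  apply: le_trans (area_bigsetU_le mA); apply: le_area => //.
    exact: bigsetU_measurable.
  move=> z /BA[i ir Az]; elim: (r) ir => // j s IHs; rewrite inE big_cons.
  by case/orP => [/eqP <-|/IHs]; [left|right].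
apply: fine_le => //; rewrite ge0_fin_numE ?area_measureE ?measure_ge0 //.
by apply: le_lt_trans le _; rewrite ltey_eq fS.
Qed.

(** The closed sets of points at distance at least [1 / n] from the complement
    of [G] increase to [G]. *)
Lemma inner_parallel G W (e : R) : open G -> G `<=` sqr ((0, 0) : plane R) W -> 0 < e ->
  exists d K, [/\ 0 < d, planar_measurable K, K `<=` G, forall z, K z -> sqr z d `<=` G &
    fine (area G) - e <= fine (area K)].
Proof.
move=> oG GW e0.
pose K (n : nat) : set (plane R) := [set z | ball z n.+1%:R^-1 `<=` G].
have mG := open_planar_measurable oG.
have i0 n : 0 < n.+1%:R^-1 :> R by rewrite invr_gt0 ltr0n.
have KG n : K n `<=` G by move=> z; apply; exact: ballxx.
have mK n : planar_measurable (K n).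
  apply: closed_planar_measurable; rewrite -openC.
  have -> : ~` K n = \bigcup_(w in ~` G) ball w n.+1%:R^-1.
    apply/seteqP; split=> z.
      by move=> /existsNP[w /not_implyP[zw nw]]; exists w => //; exact: ball_sym.
    by move=> [w /= nw wz] zG; apply: nw; apply: zG; exact: ball_sym.
  by apply: bigcup_open => w _; exact: ball_open.
have UK : \bigcup_n K n = G.
  apply/seteqP; split=> z; first by case=> n _; exact: KG.
  move=> Gz; have /nbhs_ballP[r /= r0 rG] : nbhs z G by apply: open_nbhs_nbhs.
  have [n nr] : exists n : nat, n.+1%:R^-1 < r.
    exists (Num.truncn r^-1); rewrite invf_plt ?posrE ?ltr0n //.
    exact: truncnS_gt.
  by exists n => //; apply: subset_trans rG; apply: le_ball; exact: ltW.
have fG : area G \is a fin_num by exact: area_fin GW.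
have fK n : area (K n) \is a fin_num.
  by apply: (area_fin (W := W)) => //; exact: subset_trans (KG n) GW.
have cv : (area_measure R \o K) n @[n --> \oo] --> area_measure R (\bigcup_n K n).
  apply: nondecreasing_cvg_mu => //; first by rewrite UK.
  move=> m n mn; apply/subsetPset => z; apply: subset_trans; apply: le_ball.
  by rewrite lef_pV2 ?posrE ?ltr0n // ler_nat.
rewrite UK in cv.
have [n hn] : exists n, fine (area G) - e <= fine (area (K n)).
  have cv' : fine (area (K n)) @[n --> \oo] --> fine (area G).
    by apply: fine_cvg; rewrite fineK.
  have : \forall n \near \oo, fine (area G) - e < fine (area (K n)).
    by apply: (cvgr_gt (fine (area G))) => //; rewrite ltrBlDr ltrDl.
  by case=> N _ /(_ N (leqnn N)) /ltW; exists N.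
exists (n.+1%:R^-1 / 2), (K n); split; [by rewrite divr_gt0|exact: mK|exact: KG| |exact: hn].
move=> z Kz w [/andP[w1 w2] /andP[w3 w4]]; apply: Kz.
have := i0 n; move: (n.+1%:R^-1 : R) w1 w2 w3 w4 => d w1 w2 w3 w4 d0.
by split; rewrite -ball_normE /= ltr_distl; apply/andP; split; clear -w1 w2 w3 w4 d0; lra.
Qed.
End AreaSums.

(** * Lipschitz boundaries have area zero *)

Section LipschitzBoundary.
Variable R : realType.
Implicit Types (A B G K : set (plane R)) (z w x y : plane R).

Lemma bounded_sqr A : bounded_set A -> exists2 W, 0 < W & A `<=` sqr ((0, 0) : plane R) W.
Proof.
move=> /pinfty_ex_gt0[M M0 AM]; exists M => // z /AM /=.
rewrite prod_normE ge_max !ler_norml => /andP[/andP[h1 h2] /andP[h3 h4]].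
by split; apply/andP; split => /=; lra.
Qed.

Lemma sqr_compact z (e : R) : compact (sqr z e).
Proof.
have -> : sqr z e = (`[z.1 - e, z.1 + e]%classic : set R^o) `*` (`[z.2 - e, z.2 + e]%classic : set R^o).
  by apply/seteqP; split=> w /=; rewrite !in_itv.
by apply: compact_setX; exact: segment_compact.
Qed.

Lemma sqr_closed z (e : R) : closed (sqr z e).
Proof. by apply: compact_closed; [exact: norm_hausdorff|exact: sqr_compact]. Qed.

Lemma unit_vector_le1 (e : plane R) : e.1 ^+ 2 + e.2 ^+ 2 = 1 -> `|e.1| <= 1 /\ `|e.2| <= 1.
Proof.
have key (u : R) : u ^+ 2 <= 1 -> `|u| <= 1.
  by rewrite -[u ^+ 2]real_normK ?num_real // expr_le1.
by move=> e1; have h1 := sqr_ge0 e.1; have h2 := sqr_ge0 e.2; split; apply: key; lra.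
Qed.

(** In the rotated coordinates [Z] is part of the graph of [f] over an interval
    of length [D]; for every [N] it is covered by [N + 1] squares of half-side
    [C / N]. *)
Lemma graph_null (Z : set (plane R)) (e x : plane R) (f : R -> R) L (r s0 D : R) :
  planar_measurable Z -> 0 <= r -> Z `<=` sqr x r -> 0 < L -> 0 < D -> e.1 ^+ 2 + e.2 ^+ 2 = 1 ->
  (forall s t, `|f s - f t| <= L * `|s - t|) ->
  (forall y, Z y -> s0 <= y.1 * e.1 + y.2 * e.2 <= s0 + D) ->
  (forall y, Z y -> f (y.1 * e.1 + y.2 * e.2) = - y.1 * e.2 + y.2 * e.1) ->
  area Z = 0%E.
Proof.
move=> mZ r0 Zr L0 D0 e1 fL Zs Zf.
have [a1 a2] := unit_vector_le1 e1.
pose C := D * (1 + L).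
have C0 : 0 < C by rewrite mulr_gt0 //; lra.
have est N : (0 < N)%N -> fine (area Z) <= N.+1%:R * (C / N%:R *+ 2) ^+ 2.
  move=> N0; have N0' : 0 < N%:R :> R by rewrite ltr0n.
  pose c (j : nat) : R := s0 + j%:R * (D / N%:R).
  pose h := C / N%:R.
  have h0 : 0 <= h by rewrite divr_ge0 // ltW.
  pose S (j : nat) := sqr ((c j * e.1 - f (c j) * e.2, c j * e.2 + f (c j) * e.1) : plane R) h.
  have aS j : area (S j) = ((h *+ 2) ^+ 2)%:E by rewrite area_sqr.
  apply: le_trans (@fine_area_le_cover R nat S (iota 0 N.+1) Z _ _ mZ _) _.
  - by move=> i _; exact: measurable_sqr.
  - by move=> i _; rewrite aS.
  - move=> y Zy; have /andP[y1 y2] := Zs y Zy; have yf := Zf y Zy.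
    set s := y.1 * e.1 + y.2 * e.2 in y1 y2 yf.
    set t := - y.1 * e.2 + y.2 * e.1 in yf.
    pose q := (s - s0) / (D / N%:R).
    have DN : 0 < D / N%:R by rewrite divr_gt0.
    have q0 : 0 <= q by rewrite divr_ge0 ?subr_ge0 // ltW.
    pose j := Num.truncn q.
    have /andP[j1 j2] := truncn_itv q0.
    have jN : (j < N.+1)%N.
      rewrite -(ltr_nat R); apply: le_lt_trans j1 _.
      rewrite /q ltr_pdivrMr //; apply: (@le_lt_trans _ _ D); first lra.
      have -> : N.+1%:R * (D / N%:R) = D + D / N%:R.
        by rewrite -natr1 mulrDl mul1r mulrC divfK // lt0r_neq0.
      by rewrite ltrDl.
    exists j; first by rewrite mem_iota.
    have sc : 0 <= s - c j <= D / N%:R.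
      have sE : s - s0 = q * (D / N%:R) by rewrite /q divfK // lt0r_neq0.
      rewrite /c -/j.
      have k1 : j%:R * (D / N%:R) <= q * (D / N%:R) by rewrite ler_pM2r.
      have k2 : q * (D / N%:R) <= (j%:R + 1) * (D / N%:R).
        by rewrite ler_pM2r // natr1 ltW.
      rewrite mulrDl mul1r in k2.
      by apply/andP; split; lra.
    have ns : `|s - c j| <= D / N%:R by rewrite ger0_norm; case/andP: sc.
    have nt : `|t - f (c j)| <= L * (D / N%:R).
      by rewrite -yf; apply: le_trans (fL _ _) _; rewrite ler_wpM2l // ltW.
    have hE : h = D / N%:R + L * (D / N%:R) by rewrite /h /C; ring.
    have b (u v u' v' : R) : `|u| <= 1 -> `|v| <= 1 -> `|u'| <= D / N%:R ->
        `|v'| <= L * (D / N%:R) -> `|u' * u + v' * v| <= h.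
      move=> hu hv hu' hv'; rewrite hE; apply: le_trans (ler_normD _ _) _.
      by rewrite !normrM; apply: lerD; rewrite -[leRHS]mulr1; apply: ler_pM.
    have E1 : y.1 = s * e.1 - t * e.2.
      rewrite -[LHS]mulr1 -e1 /s /t !expr2; ring.
    have E2 : y.2 = s * e.2 + t * e.1.
      rewrite -[LHS]mulr1 -e1 /s /t !expr2; ring.
    have B1 := b e.1 (- e.2) _ _ a1 ltac:(by rewrite normrN) ns nt.
    have B2 := b e.2 e.1 _ _ a2 a1 ns nt.
    rewrite ler_norml in B1; rewrite ler_norml in B2.
    move: B1 B2 => /andP[B11 B12] /andP[B21 B22].
    by rewrite /S; split; rewrite /= ?E1 ?E2; apply/andP; split; clear -B11 B12 B21 B22; lra.
  - under eq_bigr => i _ do rewrite aS /=.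
    by rewrite big_const_seq count_predT size_iota iter_addr addr0 mulr_natl.
have fa0 : fine (area Z) <= 0.
  apply/ler_addgt0Pr => d d0; rewrite add0r.
  pose N := (Num.truncn (8 * C ^+ 2 / d)).+1.
  have N0 : 0 < N%:R :> R by rewrite ltr0n.
  have Nd : 8 * C ^+ 2 / d < N%:R by exact: truncnS_gt.
  rewrite ltr_pdivrMr // in Nd.
  apply: le_trans (est N isT) _.
  have N1 : N.+1%:R <= 2 * N%:R :> R.
    by rewrite -natrM ler_nat; lia.
  apply: (@le_trans _ _ (2 * N%:R * (C / N%:R *+ 2) ^+ 2)).
    by rewrite ler_wpM2r // sqr_ge0.
  have -> : 2 * N%:R * (C / N%:R *+ 2) ^+ 2 = 8 * C ^+ 2 / N%:R.
    by rewrite -mulr_natr; field; rewrite lt0r_neq0.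
  by rewrite ler_pdivrMr // [leRHS]mulrC ltW.
have Zfin : area Z \is a fin_num.
  rewrite ge0_fin_numE ?area_measureE ?measure_ge0 //.
  apply: le_lt_trans (le_area mZ (measurable_sqr x r) Zr) _.
  by rewrite area_sqr // ltry.
by rewrite -(fineK Zfin); congr EFin; apply/eqP; rewrite eq_le fa0 fine_ge0.
Qed.

(** Near [x], a boundary point strictly above the graph would be in the open set
    [G], and one strictly below would have a neighbourhood disjoint from [G]. *)
Lemma boundary_local G x : open G -> lipschitz_boundary G -> (closure G `\` interior G) x ->
  exists2 r, 0 < r & area ((closure G `\` interior G) `&` sqr x r) = 0%E.
Proof.
move=> oG lG Dx; have [e [f [e1 /pinfty_ex_gt0[L L0 lipf] /nbhs_ballP[d /= d0 near]]]] := lG x Dx.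
have fL (s t : R) : `|f s - f t| <= L * `|s - t| by exact: (lipf (s, t)).
have cf : continuous f.
  move=> s; apply/cvgrPdist_le => eps eps0; near=> t.
  apply: le_trans (fL s t) _; rewrite mulrC -ler_pdivlMr //.
  near: t; apply/nbhs_ballP; exists (eps / L) => /=; first by rewrite divr_gt0.
  by move=> u /ltW.
pose s (y : plane R) : R := y.1 * e.1 + y.2 * e.2.
pose t (y : plane R) : R := - y.1 * e.2 + y.2 * e.1.
have cst_ y : s z @[z --> y] --> s y.
  apply: cvgD; apply: cvgM; [exact: cvg_fst|exact: cvg_cst|exact: cvg_snd|exact: cvg_cst].
have ctt y : t z @[z --> y] --> t y.
  apply: cvgD; apply: cvgM; [apply: cvgN; exact: cvg_fst|exact: cvg_cst|exact: cvg_snd|exact: cvg_cst].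
have Di : interior G = G by apply/seteqP; split; [exact: interior_subset|rewrite openE in oG].
pose r := d / 2.
have r0 : 0 < r by rewrite divr_gt0.
exists r => //.
have sub y : sqr x r y -> ball x d y.
  move=> [/andP[h1 h2] /andP[h3 h4]].
  by split; rewrite -ball_normE /= ltr_distl /r; apply/andP; split; rewrite /r in h1 h2 h3 h4; lra.
apply: (@graph_null _ e x f L r (s x - 2 * r) (4 * r)) => //.
- apply: closed_planar_measurable; apply: closedI; last exact: sqr_closed.
  by apply: closedI; [exact: closed_closure|apply: open_closedC; exact: open_interior].
- exact: ltW.
- by rewrite mulr_gt0.
- move=> y [_ [/andP[h1 h2] /andP[h3 h4]]].
  have [a1 a2] := unit_vector_le1 e1.
  have b1 : `|(y.1 - x.1) * e.1| <= r.
    rewrite normrM -[leRHS]mulr1; apply: ler_pM => //.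
    by rewrite ler_norml; apply/andP; split; lra.
  have b2 : `|(y.2 - x.2) * e.2| <= r.
    rewrite normrM -[leRHS]mulr1; apply: ler_pM => //.
    by rewrite ler_norml; apply/andP; split; lra.
  rewrite ler_norml in b1; rewrite ler_norml in b2; rewrite /s.
  by move: b1 b2 => /andP[b11 b12] /andP[b21 b22]; apply/andP; split; clear -b11 b12 b21 b22; lra.
move=> y [[cy ny] ys]; have yb := sub y ys; rewrite Di in ny.
apply/eqP; rewrite eq_le; apply/andP; split; last first.
  rewrite leNgt; apply/negP => lt; apply: ny; exact/(near y yb).
rewrite leNgt; apply/negP => lt.
have : nbhs y [set z | ball x d z /\ t z < f (s z)].
  apply: filterI.
    by apply: open_nbhs_nbhs; split=> //; exact: ball_open.
  have cg : (f (s z) - t z) @[z --> y] --> f (s y) - t y.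
    by apply: cvgB; [apply: (cvg_comp _ _ (cst_ y)); exact: cf|exact: ctt].
  have := @cvgr_gt _ _ _ _ _ _ cg 0; rewrite subr_gt0 => /(_ _ lt) h.
  move: h; apply: filterS => z; rewrite subr_gt0 //.
move=> /cy[z [Gz [zb tz]]].
by have /(near z zb) := Gz; rewrite ltNge (ltW tz).
Unshelve. all: by end_near.
Qed.

Lemma boundary_null G : open G -> bounded_set G -> lipschitz_boundary G ->
  area (closure G `\` G) = 0%E.
Proof.
move=> oG /bounded_sqr[W W0 GW] lG.
have Di : interior G = G by apply/seteqP; split; [exact: interior_subset|rewrite openE in oG].
pose D := closure G `\` interior G.
have -> : closure G `\` G = D by rewrite /D Di.
have cW : closure G `<=` sqr ((0, 0) : plane R) W.
  by have := closureS GW; rewrite -((closure_id _).1 (@sqr_closed _ _)).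
have clD : closed D.
  by apply: closedI; [exact: closed_closure|apply: open_closedC; exact: open_interior].
have coD : compact D.
  by apply: (subclosed_compact clD (@sqr_compact (0, 0) W)) => z [/cW].
have /choice[r Hr] : forall x, exists r, D x -> 0 < r /\ area (D `&` sqr x r) = 0%E.
  move=> x; have [Dx|nD] := pselect (D x); last by exists 0.
  by have [r r0 ar] := boundary_local oG lG Dx; exists r.
pose above (l0 : seq (plane R)) : set (seq (plane R)) :=
  [set l : seq (plane R) | forall x, x \in l0 -> x \in l].
have FF : Filter (filter_from setT above).
  apply: filter_fromT_filter; first by exists [::].
  move=> l1 l2; exists (l1 ++ l2) => l sub; split=> x xl; apply: sub; rewrite mem_cat xl //.
  by rewrite orbT.
have := (compact_near_coveringP D).1 coD _ _
  (fun (l : seq (plane R)) x => exists y : plane R, [/\ y \in l, D y & ball y (r y) x]) FF.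
case.
  move=> x Dx; have [r0 _] := Hr x Dx.
  exists (ball x (r x), above [:: x]); first split.
  - by apply: nbhsx_ballx.
  - by exists [:: x].
  move=> [y l] /= [xy xl]; exists x; split=> //.
  by apply: xl; rewrite mem_head.
move=> F0 _ /(_ F0 (fun x h => h)) DF.
pose F := [seq x <- F0 | `[< D x >]].
have FD x : x \in F -> D x by rewrite mem_filter => /andP[/asboolP].
have mZ x : planar_measurable (D `&` sqr x (r x)).
  by apply: closed_planar_measurable; apply: closedI => //; exact: sqr_closed.
have DU : D `<=` \big[setU/set0]_(x <- F) (D `&` sqr x (r x)).
  move=> y Dy; have [x [xF0 Dx yx]] := DF y Dy.
  have xF : x \in F by rewrite mem_filter xF0 andbT; apply/asboolP.
  have : (D `&` sqr x (r x)) y.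
    split=> //; move: yx => [/=]; rewrite -!ball_normE /= !ltr_distl.
    by move=> /andP[h1 h2] /andP[h3 h4]; split; apply/andP; split; lra.
  move: xF; elim: F {FD} => // j l IHs; rewrite inE big_cons.
  by case/orP => [/eqP <-|/IHs h /h]; [left|right].
have mD := closed_planar_measurable clD.
apply/eqP; rewrite eq_le; apply/andP; split; last by rewrite area_measureE measure_ge0.
apply: le_trans (le_area mD _ DU) _; first exact: bigsetU_measurable.
apply: le_trans (area_bigsetU_le _) _ => //.
rewrite big_seq big1 // => x xF.
by have /Hr[] := FD x xF.
Qed.
End LipschitzBoundary.

(** * Area of trapezoids *)

Section Trapezoid.
Variable R : realType.

Lemma halfplane_closed (h : R * R * R) : closed [set z : plane R | 0 <= hval h z].
Proof.
have -> : [set z : plane R | 0 <= hval h z] = hval h @^-1` [set y : R^o | 0 <= y] by [].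
apply: preimage_closed; last exact: closed_ge.
move=> z _; apply: cvgD; first apply: cvgD.
- exact: cvg_cst.
- by apply: cvgM; [exact: cvg_cst|exact: cvg_fst].
- by apply: cvgM; [exact: cvg_cst|exact: cvg_snd].
Qed.

Lemma polyhedron_closed (hs : seq (R * R * R)) : closed (polyhedron hs).
Proof.
elim: hs => [|h hs IH].
  have -> : polyhedron [::] = (setT : set (plane R)) by apply/seteqP; split.
  exact: closedT.
have -> : polyhedron (h :: hs) = [set w | 0 <= hval h w] `&` polyhedron hs.
  by apply/seteqP; split=> w /=; [move/andP|move=> [? ?]; apply/andP].
by apply: closedI => //; exact: halfplane_closed.
Qed.

Lemma integral_affine (u v A B : R) : u < v ->
  (\int[@lebesgue_measure R]_(x in `[u, v]) (A + B * x)%:E =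
   ((v - u) * (A + B * ((u + v) / 2)))%:E)%E.
Proof.
move=> uv; pose F := fun x : R^o => A * x + B / 2 * x ^+ 2 : R^o.
have dF (x : R^o) : is_derive x (1 : R^o) F (A + B * x).
  rewrite /F; apply: is_derive_eq.
  by rewrite /= /GRing.scale /=; field.
have cont (z : R^o) : F y @[y --> z] --> F z.
  apply: differentiable_continuous; apply/derivable1_diffP.
  by have [] := dF z.
rewrite (@continuous_FTC2 _ _ F) //.
- by rewrite -EFinB /F; congr EFin; field.
- apply: continuous_subspaceT => x; apply: cvgD; first exact: cvg_cst.
  by apply: cvgM; [exact: cvg_cst|exact: cvg_id].
- split; first by move=> x _; have [] := dF x.
    by apply: cvg_at_right_filter; exact: cont.
  by apply: cvg_at_left_filter; exact: cont.
- by move=> x _; rewrite derive1E; have [_ ->] := dF x.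
Qed.

Definition trapezoid (u v p1 q1 p2 q2 : R) : set (plane R) :=
  [set z | u <= z.1 <= v /\ p1 + q1 * z.1 <= z.2 <= p2 + q2 * z.1].

Lemma trapezoid_closed u v p1 q1 p2 q2 : closed (trapezoid u v p1 q1 p2 q2).
Proof.
rewrite (_ : trapezoid _ _ _ _ _ _ =
  polyhedron [:: (- u, 1, 0); (v, -1, 0); (- p1, - q1, 1); (p2, q2, -1)]).
  exact: polyhedron_closed.
apply/seteqP; split=> z /=.
  move=> [/andP[h1 h2] /andP[h3 h4]]; apply/and5P; rewrite /hval /=.
  by split=> //; lra.
by move=> /and5P[]; rewrite /hval /= => h1 h2 h3 h4 _; split; apply/andP; split; lra.
Qed.

Lemma area_trapezoid u v p1 q1 p2 q2 : u < v ->
  (forall x, u <= x <= v -> p1 + q1 * x <= p2 + q2 * x) ->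
  area (trapezoid u v p1 q1 p2 q2) =
    ((v - u) * ((p2 - p1) + (q2 - q1) * ((u + v) / 2)))%:E.
Proof.
move=> uv le12; rewrite -integral_affine // /area /product_measure1.
rewrite [RHS]integral_mkcond; apply: eq_integral => x _ /=; rewrite patchE.
have xs : xsection (trapezoid u v p1 q1 p2 q2 : set (measurableTypeR R * measurableTypeR R)) x =
   if (u <= x <= v) then (`[p1 + q1 * x, p2 + q2 * x]%classic : set R) else set0.
  apply/seteqP; split=> y; rewrite /xsection /= inE /trapezoid /=.
    by move=> [-> h2]; rewrite /= in_itv.
  by case: ifP => // xuv; rewrite /= in_itv /=.
rewrite xs mem_setE in_itv /=; case: ifP => [xuv|_]; last by rewrite measure0.
have le := le12 x xuv.
rewrite lebesgue_measure_itv /= lte_fin; case: ltP => h.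
  by rewrite -EFinB; congr EFin; ring.
by congr EFin; lra.
Qed.
End Trapezoid.

(** * Regular hexagons *)

Section Hexagons.
Variable R : realType.
Implicit Types (a : R) (c z w : plane R).

Definition sqrt3 : R := Num.sqrt 3.

Lemma sqrt3_gt0 : 0 < sqrt3. Proof. by rewrite sqrtr_gt0 ltr0n. Qed.

Lemma sqrt3_sq : sqrt3 * sqrt3 = 3.
Proof. by rewrite -expr2 sqr_sqrtr // ler0n. Qed.

Lemma sqrt3_ge1 : 1 <= sqrt3.
Proof. by rewrite -[1]sqrtr1 ler_wsqrtr // ler1n. Qed.

Lemma sqrt3_le2 : sqrt3 <= 2.
Proof.
have -> : 2 = Num.sqrt (2 ^+ 2) :> R by rewrite sqrtr_sqr ger0_norm.
by rewrite ler_wsqrtr // expr2; lra.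
Qed.

(** The regular hexagon with two vertical sides, of centre [c] and apothem [a]. *)
Definition hexagon c a : set (plane R) :=
  [set z | [/\ - a <= z.1 - c.1 <= a,
     - (2 * a) <= (z.1 - c.1) + sqrt3 * (z.2 - c.2) <= 2 * a &
     - (2 * a) <= (z.1 - c.1) - sqrt3 * (z.2 - c.2) <= 2 * a]].

(** The angle is a third of a right angle; solve the triple angle formula. *)
Lemma cos_sin_pi6 : cos (pi / 6 : R) = sqrt3 / 2 /\ sin (pi / 6 : R) = 1 / 2.
Proof.
have p0 : 0 < pi :> R by exact: pi_gt0.
have c0 : 0 < cos (pi / 6 : R) by apply: cos_gt0_pihalf; apply/andP; split; lra.
have s0 : 0 < sin (pi / 6 : R) by apply: sin_gt0_pi; apply/andP; split; lra.
have h : cos (pi / 6 + (pi / 6 + pi / 6) : R) = 0.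
  by rewrite -(cos_pihalf R); congr cos; field.
have sc := cos2Dsin2 (pi / 6 : R).
rewrite !(cosD, sinD) in h.
set c := cos _ in c0 h sc *; set s := sin _ in s0 h sc *.
have c2 : c ^+ 2 = 3 / 4.
  have : c * (4 * c ^+ 2 - 3) = 0.
    have ss : s * s = 1 - c * c by rewrite -sc !expr2; ring.
    rewrite -h; have -> : c * (c * c - s * s) - s * (s * c + c * s) =
      c * c * c - 3 * c * (s * s) by ring.
    by rewrite ss; ring.
  by move/eqP; rewrite mulf_eq0 gt_eqF //= => /eqP; lra.
have s2 : s ^+ 2 = 1 / 4 by lra.
split.
  apply/eqP; rewrite -(@eqrXn2 _ 2) //; last first.
  - by rewrite divr_ge0 // ltW // sqrt3_gt0.
  - exact: ltW.
  by rewrite c2 expr_div_n (expr2 sqrt3) sqrt3_sq; apply/eqP; field.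
apply/eqP; rewrite -(@eqrXn2 _ 2) //; last exact: ltW.
by rewrite s2; apply/eqP; field.
Qed.

Definition hexagon_vertices c a : seq (plane R) :=
  [:: (c.1 + a, c.2 + a / sqrt3); (c.1, c.2 + 2 * (a / sqrt3));
      (c.1 - a, c.2 + a / sqrt3); (c.1 - a, c.2 - a / sqrt3);
      (c.1, c.2 - 2 * (a / sqrt3)); (c.1 + a, c.2 - a / sqrt3)].

Lemma hexagon_turns_left c a : 0 < a -> turns_left (hexagon_vertices c a).
Proof.
move=> a0; have b0 : 0 < a / sqrt3 by rewrite divr_gt0 ?sqrt3_gt0.
have ab : 0 < a * (a / sqrt3) by rewrite mulr_gt0.
rewrite /hexagon_vertices; move: (a / sqrt3) ab {b0} => b ab.
move=> i j k /andP[ij jk] k6; rewrite /= in k6.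
move: k6 jk ij; case: k => [|[|[|[|[|[|k]]]]]] // _; case: j => [|[|[|[|[|j]]]]] // _;
    case: i => [|[|[|[|i]]]] // _; rewrite /orient /=; lra.
Qed.

Lemma hexagon_region c a : 0 < a -> edge_region (hexagon_vertices c a) = hexagon c a.
Proof.
move=> a0; have q0 := sqrt3_gt0; have q2 := sqrt3_sq.
pose b := a / sqrt3.
have b0 : 0 < b by rewrite divr_gt0.
have aE : a = sqrt3 * b by rewrite /b mulrC divfK // gt_eqF.
have qa : sqrt3 * a = 3 * b by rewrite aE mulrA q2.
apply/seteqP; split=> z.
  pose x := z.1 - c.1; pose y := z.2 - c.2.
  have xE : z.1 = c.1 + x by rewrite /x; ring.
  have yE : z.2 = c.2 + y by rewrite /y; ring.
  move=> h; suff : [/\ - a <= x <= a, - (2 * a) <= x + sqrt3 * y <= 2 * a &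
     - (2 * a) <= x - sqrt3 * y <= 2 * a] by [].
  have := h 0%N isT; have := h 1%N isT; have := h 2%N isT; have := h 3%N isT.
  have := h 4%N isT; have := h 5%N isT.
  rewrite /orient /= -/b xE yE; clearbody x y b; clear xE yE h.
  move=> h5 h4 h3 h2 h1 h0.
  have k5 : 0 <= b * (a - x) by lra.
  have k2 : 0 <= b * (a + x) by lra.
  have f (r : R) : 0 <= b * r -> 0 <= r by rewrite pmulr_rge0.
  have e (u v : R) : b * (sqrt3 * u) = a * u by rewrite aE; ring.
  have k0 : 0 <= b * (2 * a - (x + sqrt3 * y)) by have := e y 0; lra.
  have k1 : 0 <= b * (2 * a + (x - sqrt3 * y)) by have := e y 0; lra.
  have k3 : 0 <= b * (2 * a + (x + sqrt3 * y)) by have := e y 0; lra.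
  have k4 : 0 <= b * (2 * a - (x - sqrt3 * y)) by have := e y 0; lra.
  move: (f _ k0) (f _ k1) (f _ k2) (f _ k3) (f _ k4) (f _ k5) => m0 m1 m2 m3 m4 m5.
  by split; apply/andP; split; clear -m0 m1 m2 m3 m4 m5; lra.
move=> [/andP[m1 m2] /andP[m3 m4] /andP[m5 m6]].
set x := z.1 - c.1 in m1 m2 m3 m4 m5 m6; set y := z.2 - c.2 in m1 m2 m3 m4 m5 m6.
have xE : z.1 = c.1 + x by rewrite /x; ring.
have yE : z.2 = c.2 + y by rewrite /y; ring.
have f (r s : R) : r <= s -> 0 <= b * (s - r) by move=> rs; rewrite mulr_ge0 ?subr_ge0 // ltW.
have e (u : R) : b * (sqrt3 * u) = a * u by rewrite aE; ring.
have := e y; move: (f _ _ m1) (f _ _ m2) (f _ _ m3) (f _ _ m4) (f _ _ m5) (f _ _ m6).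
move=> n1 n2 n3 n4 n5 n6 ey i.
by case: i => [|[|[|[|[|[|i]]]]]] //= _; rewrite /orient /= -/b xE yE; clear -n1 n2 n3 n4 n5 n6 ey; lra.
Qed.

Lemma hexagon_regular c a : 0 < a -> regular_hexagon (hexagon c a).
Proof.
move=> a0; exists c, (2 * (a / sqrt3)), (pi / 6).
have q0 := sqrt3_gt0; have q2 := sqrt3_sq.
split; first by rewrite mulr_gt0 // divr_gt0.
rewrite -hexagon_region // region_hull //; last exact: hexagon_turns_left.
have [c6 s6] := cos_sin_pi6.
pose b := a / sqrt3.
have aE : a = sqrt3 * b by rewrite /b mulrC divfK // gt_eqF.
pose V (i : nat) : plane R := (c.1 + 2 * b * cos (pi / 6 + i%:R * (pi / 3)),
  c.2 + 2 * b * sin (pi / 6 + i%:R * (pi / 3))).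
have v0 : V 0 = (c.1 + a, c.2 + b).
  by rewrite /V mul0r addr0 c6 s6 aE; congr pair; field.
have v1 : V 1 = (c.1, c.2 + 2 * b).
  rewrite /V; have -> : pi / 6 + 1%:R * (pi / 3) = pi / 2 :> R by field.
  by rewrite cos_pihalf sin_pihalf; congr pair; ring.
have v2 : V 2 = (c.1 - a, c.2 + b).
  rewrite /V; have -> : pi / 6 + 2%:R * (pi / 3) = - (pi / 6) + pi :> R by field.
  by rewrite cosDpi sinDpi cosN sinN c6 s6 aE; congr pair; field.
have v3 : V 3 = (c.1 - a, c.2 - b).
  rewrite /V; have -> : pi / 6 + 3%:R * (pi / 3) = (pi / 6) + pi :> R by field.
  by rewrite cosDpi sinDpi c6 s6 aE; congr pair; field.
have v4 : V 4 = (c.1, c.2 - 2 * b).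
  rewrite /V; have -> : pi / 6 + 4%:R * (pi / 3) = (pi / 2) + pi :> R by field.
  by rewrite cosDpi sinDpi cos_pihalf sin_pihalf; congr pair; ring.
have v5 : V 5 = (c.1 + a, c.2 - b).
  rewrite /V; have -> : pi / 6 + 5%:R * (pi / 3) = (- (pi / 6) + pi) + pi :> R by field.
  by rewrite !cosDpi !sinDpi cosN sinN c6 s6 aE; congr pair; field.
congr convex_hull; apply/seteqP; split=> z /=.
  rewrite !inE -/b -v0 -v1 -v2 -v3 -v4 -v5.
  case/or4P => [/eqP ->|/eqP ->|/eqP ->|/or3P[] /eqP ->].
  - by exists (inord 0); rewrite // inordK.
  - by exists (inord 1); rewrite // inordK.
  - by exists (inord 2); rewrite // inordK.
  - by exists (inord 3); rewrite // inordK.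
  - by exists (inord 4); rewrite // inordK.
  - by exists (inord 5); rewrite // inordK.
case=> -[i i6] _ <- /=; rewrite !inE -/b -v0 -v1 -v2 -v3 -v4 -v5.
by move: i i6; do 6 (case=> [_|]; first by rewrite eqxx ?orbT).
Qed.

Lemma hexagon_convex_body c a : 0 < a -> convex_body (hexagon c a).
Proof.
move=> a0; rewrite -hexagon_region //; apply: (@ngon_convex_body _ 6).
by have := is_ngon_region (@hexagon_turns_left c a a0) isT.
Qed.

Lemma hexagon_measurable c a : 0 < a -> planar_measurable (hexagon c a).
Proof. by move=> a0; apply: compact_planar_measurable; case: (hexagon_convex_body c a0). Qed.
End Hexagons.

(** * The honeycomb *)

Section HexagonTiling.
Variable R : realType.
Implicit Types (a : R) (c z w : plane R).
Notation sqrt3 := (sqrt3 R).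

Definition hexagon_area a : R := 6 * a ^+ 2 / sqrt3.

Lemma area_hexagon c a : 0 < a -> area (hexagon c a) = (hexagon_area a)%:E.
Proof.
move=> a0; have q0 := sqrt3_gt0 R.
pose L := trapezoid (c.1 - a) c.1 (c.2 - (2 * a - c.1) / sqrt3) (- sqrt3^-1)
   (c.2 + (2 * a - c.1) / sqrt3) sqrt3^-1.
pose M := trapezoid c.1 (c.1 + a) (c.2 - (2 * a + c.1) / sqrt3) (sqrt3^-1)
   (c.2 + (2 * a + c.1) / sqrt3) (- sqrt3^-1).
have qV : sqrt3 * sqrt3^-1 = 1 by rewrite divff // gt_eqF.
have qV0 : 0 < sqrt3^-1 by rewrite invr_gt0.
pose k := sqrt3^-1; have kE (u : R) : u / sqrt3 = u * k by [].
have HE : hexagon c a = L `|` M.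
  rewrite /L /M !kE -/k; apply/seteqP; split=> z.
    move=> [/andP[m1 m2] /andP[m3 m4] /andP[m5 m6]].
    have f (r s : R) : r <= s -> 0 <= k * (s - r).
      by move=> rs; rewrite mulr_ge0 ?subr_ge0 // ltW.
    have e (u : R) : k * (sqrt3 * u) = u by rewrite mulrA [k * _]mulrC qV mul1r.
    have := e z.2; have := e c.2.
    move: (f _ _ m3) (f _ _ m4) (f _ _ m5) (f _ _ m6) => n3 n4 n5 n6 e1 e2.
    case: (leP z.1 c.1) => zc; [left|right]; split; apply/andP; split;
      clear -m1 m2 n3 n4 n5 n6 e1 e2 zc; lra.
  have f (r s : R) : r <= s -> 0 <= sqrt3 * (s - r).
    by move=> rs; rewrite mulr_ge0 ?subr_ge0 // ltW.
  have e (u : R) : sqrt3 * (k * u) = u by rewrite mulrA qV mul1r.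
  have := e a; have := e c.1; have := e z.1 => e1 e2 e3.
  by case=> -[/andP[m1 m2] /andP[/f m3 /f m4]]; split; apply/andP; split;
    clear -a0 e1 e2 e3 m1 m2 m3 m4; lra.
have aL : area L = (3 * a ^+ 2 / sqrt3)%:E.
  rewrite area_trapezoid; first by congr EFin; field; rewrite gt_eqF.
    by lra.
  move=> x /andP[x1 x2].
  have : 0 <= sqrt3^-1 * (2 * a - c.1 + x) by rewrite mulr_ge0 ?(ltW qV0) //; lra.
  by lra.
have aM : area M = (3 * a ^+ 2 / sqrt3)%:E.
  rewrite area_trapezoid; first by congr EFin; field; rewrite gt_eqF.
    by lra.
  move=> x /andP[x1 x2].
  have : 0 <= sqrt3^-1 * (2 * a + c.1 - x) by rewrite mulr_ge0 ?(ltW qV0) //; lra.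
  by lra.
have mL : planar_measurable L by apply: closed_planar_measurable; exact: trapezoid_closed.
have mM : planar_measurable M by apply: closed_planar_measurable; exact: trapezoid_closed.
have LM0 : area (L `&` M) = 0%E.
  apply: (@area_null _ _ [:: c.1]); first exact: measurableI.
  move=> x y y'; rewrite inE => nx [[/= /andP[_ h1] _] [/= /andP[h2 _] _]].
  by case/eqP: nx; apply/eqP; rewrite eq_le h1 h2.
have fL : (area_measure R L < +oo)%E by rewrite -area_measureE aL ltry.
rewrite HE area_measureE (measureUfinl mL mM fL) -!area_measureE aL aM LM0 sube0.
by rewrite -EFinD /hexagon_area; congr EFin; field; rewrite gt_eqF.
Qed.

Definition unit_apothem : R := Num.sqrt (sqrt3 / 6).

Lemma unit_apothem_gt0 : 0 < unit_apothem.
Proof. by rewrite sqrtr_gt0 divr_gt0 // sqrt3_gt0. Qed.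

Lemma hexagon_area_unit : hexagon_area unit_apothem = 1.
Proof.
have q0 := sqrt3_gt0 R.
rewrite /hexagon_area /unit_apothem sqr_sqrtr; last by rewrite divr_ge0 // ltW.
by field; rewrite gt_eqF.
Qed.

Lemma hexagon_area_scale t a : hexagon_area (t * a) = t ^+ 2 * hexagon_area a.
Proof. by rewrite /hexagon_area; ring. Qed.

Lemma scale_hexagon t c a : 0 < t ->
  scale t (hexagon c a) = hexagon ((t * c.1, t * c.2) : plane R) (t * a).
Proof.
(* the inclusion from left to right, applied also to the inverse ratio *)
have sub u d b : 0 < u -> scale u (hexagon d b) `<=` hexagon ((u * d.1, u * d.2) : plane R) (u * b).
  move=> u0 z [w [/andP[m1 m2] /andP[m3 m4] /andP[m5 m6]] <-].
  have f (r s : R) : r <= s -> 0 <= u * (s - r) by move=> rs; rewrite mulr_ge0 ?subr_ge0 // ltW.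
  move: (f _ _ m1) (f _ _ m2) (f _ _ m3) (f _ _ m4) (f _ _ m5) (f _ _ m6) => n1 n2 n3 n4 n5 n6.
  have -> : u *: w = ((u * w.1, u * w.2) : plane R) by [].
  by split; rewrite /=; apply/andP; split; clear -n1 n2 n3 n4 n5 n6; lra.
move=> t0; have tV (x : R) : t^-1 * (t * x) = x by rewrite mulKf // gt_eqF.
apply/seteqP; split=> [|z hz]; first exact: sub.
exists (t^-1 *: z); last by rewrite scalerA divff ?gt_eqF // scale1r.
have t1 : 0 < t^-1 by rewrite invr_gt0.
have := sub _ ((t * c.1, t * c.2) : plane R) (t * a) t1 (t^-1 *: z); rewrite /= !tV -surjective_pairing; apply.
by exists z.
Qed.

Lemma hexagon_sub_sqr c a z : 0 < a -> hexagon c a z -> hexagon c a `<=` sqr z (4 * a).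
Proof.
move=> a0 [/andP[m1 m2] /andP[m3 m4] /andP[m5 m6]] w [/andP[n1 n2] /andP[n3 n4] /andP[n5 n6]].
split; first by apply/andP; split; lra.
have q1 := sqrt3_ge1 R.
have h1 : sqrt3 * (w.2 - z.2) <= 4 * a by lra.
have h2 : - (4 * a) <= sqrt3 * (w.2 - z.2) by lra.
have key (u : R) : sqrt3 * u <= 4 * a -> u <= 4 * a.
  move=> h; have [u0|u0] := leP u 0; first lra.
  by have : u <= sqrt3 * u; [rewrite ler_peMl // ltW|lra].
have k1 := key _ h1; have k2 : - (w.2 - z.2) <= 4 * a by apply: key; lra.
by apply/andP; split; clear -k1 k2; lra.
Qed.

(** Centres of the honeycomb of apothem [a]. *)
Definition hex_center a (m n : int) : plane R :=
  (a * (2 * m%:~R + 3 * n%:~R), 3 * n%:~R * (a / sqrt3)).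

(** In the oblique coordinates [al], [be] given by the last two quotients, whose
    sum is the first, the cells become the hexagons [|u| <= 1], [|v| <= 1],
    [|u + v| <= 1] around the integer points with [al - be] divisible by 3. *)
Lemma hexagon_centered a m n z : 0 < a -> hexagon (hex_center a m n) a z <->
  [/\ `|z.1 / a - (2 * m + 3 * n)%:~R| <= 1,
      `|(z.1 + sqrt3 * z.2) / (2 * a) - (m + 3 * n)%:~R| <= 1 &
      `|(z.1 - sqrt3 * z.2) / (2 * a) - m%:~R| <= 1].
Proof.
move=> a0; have q0 := sqrt3_gt0 R.
have a20 : 0 < 2 * a by lra.
have E (b u v : R) : 0 < b -> (`|u / b - v| <= 1) = (- b <= u - b * v <= b).
  move=> b0; rewrite ler_norml -(ler_pM2l b0) -[in X in _ && X](ler_pM2l b0).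
  by rewrite mulrBr [b * (u / b)]mulrC divfK ?gt_eqF // mulrN mulr1.
rewrite !E //.
have qn : sqrt3 * (3 * n%:~R * (a / sqrt3)) = 3 * n%:~R * a.
  by field; rewrite gt_eqF.
rewrite /hexagon /hex_center /= !intrD !intrM.
rewrite ![sqrt3 * (z.2 - _)]mulrBr qn; clear qn E.
have -> : (2 : int)%:~R = 2 :> R by [].
have -> : (3 : int)%:~R = 3 :> R by [].
move: (m%:~R) (n%:~R) (sqrt3 * z.2) (z.1) => M N y x.
by split=> -[/andP[m1 m2] /andP[m3 m4] /andP[m5 m6]]; split; apply/andP; split;
  clear -a0 m1 m2 m3 m4 m5 m6; lra.
Qed.

(** Round the two oblique coordinates up or down so that their difference becomes
    divisible by 3. *)
Lemma hexagons_cover a z : 0 < a -> exists m n, hexagon (hex_center a m n) a z.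
Proof.
move=> a0.
pose al := (z.1 + sqrt3 * z.2) / (2 * a); pose be := (z.1 - sqrt3 * z.2) / (2 * a).
have S : z.1 / a = al + be by rewrite /al /be; field; rewrite gt_eqF.
pose i := Num.floor al; pose j := Num.floor be.
have /andP[i1 i2] := floor_itv al; have /andP[j1 j2] := floor_itv be.
have key (s t : int) : (exists n, s = t + 3 * n) -> `|al - s%:~R| <= 1 ->
    `|be - t%:~R| <= 1 -> `|al + be - (s + t)%:~R| <= 1 ->
    exists m n, hexagon (hex_center a m n) a z.
  move=> [n sE] h1 h2 h3; exists t, n; apply/hexagon_centered => //.
  rewrite S -/al -/be; split=> //; last by rewrite -sE.
  by have -> : (2 * t + 3 * n = s + t)%R by rewrite sE; ring.
rewrite -/i -/j !intrD /= in i1 i2 j1 j2.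
have [n ij] : exists n, i = j + 3 * n \/ i = j + 3 * n + 1 \/ i = j + 3 * n + 2.
  by exists ((i - j) %/ 3)%Z; lia.
have nrm (u : R) : -1 <= u -> u <= 1 -> `|u| <= 1 by move=> *; rewrite ler_norml; apply/andP.
case: ij => [e|[e|e]].
- have [fs|fs] := leP (al + be) ((i + j)%:~R + 1).
    apply: (key i j); [by exists n|apply: nrm; lra|apply: nrm; lra|].
    by rewrite intrD in fs *; apply: nrm; lra.
  apply: (key (i + 1) (j + 1)); [by exists n; lia| | |]; rewrite !intrD /=; apply: nrm;
    rewrite ?intrD /= in fs; lra.
- by apply: (key i (j + 1)); [exists n; lia| | |]; rewrite ?intrD /=; apply: nrm; lra.
- by apply: (key (i + 1) j); [exists (n + 1); lia| | |]; rewrite ?intrD /=; apply: nrm; lra.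
Qed.

Lemma int_dist (s t : int) (u : R) : `|u - s%:~R| <= 1 -> `|u - t%:~R| <= 1 ->
  2 <= s - t -> u = s%:~R - 1.
Proof.
rewrite !ler_norml => /andP[h1 h2] /andP[h3 h4].
rewrite -(ler_int R) intrB /= => h; lra.
Qed.

(** One of the three coordinates of the two centres differs by at least 2, so
    the hexagons meet at most along a line. *)
Lemma hexagons_disjoint a m n m' n' : 0 < a -> (m, n) != (m', n') ->
  area (hexagon (hex_center a m n) a `&` hexagon (hex_center a m' n') a) = 0%E.
Proof.
move=> a0 ne; have q0 := sqrt3_gt0 R.
have key (f : plane R -> R) (s t : int) (ev : seq R) :
    (forall u x y y' : R, u = s%:~R - 1 \/ u = t%:~R - 1 -> x \notin ev -> f (x, y) = u -> f (x, y') = u -> y = y') ->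
    (forall z, hexagon (hex_center a m n) a z -> `|f z - s%:~R| <= 1) ->
    (forall z, hexagon (hex_center a m' n') a z -> `|f z - t%:~R| <= 1) ->
    2 <= s - t \/ 2 <= t - s ->
    area (hexagon (hex_center a m n) a `&` hexagon (hex_center a m' n') a) = 0%E.
  move=> fi h h' st; apply: (@area_null _ _ ev).
    by apply: measurableI; exact: hexagon_measurable.
  move=> x y y' xe [/h z1 /h' z2] [/h z3 /h' z4].
  case: st => st.
    by apply: (fi (s%:~R - 1) x) => //; [left|exact: (int_dist z1 z2)|exact: (int_dist z3 z4)].
  by apply: (fi (t%:~R - 1) x) => //; [right|exact: (int_dist z2 z1)|exact: (int_dist z4 z3)].
have qn0 : sqrt3 / (2 * a) != 0 by rewrite mulf_neq0 ?invr_eq0 ?gt_eqF // mulr_gt0.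
have lin (sg : R) u x (y y' : R) : sg * (sqrt3 / (2 * a)) != 0 ->
    (x + sg * (sqrt3 * y)) / (2 * a) = u -> (x + sg * (sqrt3 * y')) / (2 * a) = u -> y = y'.
  move=> sg0 e e'; apply: (mulfI sg0); move: e'; rewrite -e => e'.
  have -> : sg * (sqrt3 / (2 * a)) * y = (x + sg * (sqrt3 * y)) / (2 * a) - x / (2 * a).
    by field; rewrite gt_eqF.
  rewrite -e'; by field; rewrite gt_eqF.
have : [\/ 2 <= (2 * m + 3 * n) - (2 * m' + 3 * n') \/ 2 <= (2 * m' + 3 * n') - (2 * m + 3 * n),
    2 <= (m + 3 * n) - (m' + 3 * n') \/ 2 <= (m' + 3 * n') - (m + 3 * n) |
    2 <= m - m' \/ 2 <= m' - m].
  have ne' : m != m' \/ n != n'.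
    by move: ne; rewrite xpair_eqE negb_and => /orP[]; [left|right].
  have [h|h] := boolP (2 <= m - m'); first by apply: Or33; left.
  have [h1|h1] := boolP (2 <= m' - m); first by apply: Or33; right.
  have [h2|h2] := boolP (2 <= (m + 3 * n) - (m' + 3 * n')); first by apply: Or32; left.
  have [h3|h3] := boolP (2 <= (m' + 3 * n') - (m + 3 * n)); first by apply: Or32; right.
  apply: Or31; lia.
case=> h.
- apply: (key (fun z => z.1 / a) _ _ [seq (a * u) | u <- [:: (2 * m + 3 * n)%:~R - 1; (2 * m' + 3 * n')%:~R - 1]]) h.
  + move=> u x y y' us /= xe xu _; exfalso; move/negP: xe; apply.
    have -> : x = a * u by rewrite -xu mulrC divfK // gt_eqF.
    by rewrite !inE; case: us => ->; rewrite eqxx ?orbT.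
  + by move=> z /(hexagon_centered _ _ _ a0)[].
  + by move=> z /(hexagon_centered _ _ _ a0)[].
- apply: (key (fun z => (z.1 + sqrt3 * z.2) / (2 * a)) _ _ [::]) h.
  + by move=> u x y y' _ _ /= e e'; apply: (lin 1 u x); rewrite ?mul1r.
  + by move=> z /(hexagon_centered _ _ _ a0)[].
  + by move=> z /(hexagon_centered _ _ _ a0)[].
- apply: (key (fun z => (z.1 - sqrt3 * z.2) / (2 * a)) _ _ [::]) h.
  + by move=> u x y y' _ _ /= e e'; apply: (lin (-1) u x); rewrite ?mulN1r ?oppr_eq0.
  + by move=> z /(hexagon_centered _ _ _ a0)[].
  + by move=> z /(hexagon_centered _ _ _ a0)[].
Qed.

Lemma hexagon_self c a : 0 < a -> hexagon c a c.
Proof. by move=> a0; split; rewrite !subrr ?mulr0; apply/andP; split; lra. Qed.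

(** The hexagons of the honeycomb meeting an inner parallel set of [G] are
    contained in [G] when they are small enough. *)
Lemma hexagon_tiling G W (e : R) : open G -> G `<=` sqr ((0, 0) : plane R) W -> 0 < e ->
  exists2 a1, 0 < a1 & forall a, 0 < a < a1 -> exists s : seq (plane R),
    [/\ uniq s, (forall c, c \in s -> hexagon c a `<=` G),
        (forall c c', c \in s -> c' \in s -> c != c' ->
           area (hexagon c a `&` hexagon c' a) = 0%E) &
        fine (area G) - e <= (size s)%:R * hexagon_area a].
Proof.
move=> oG GW e0; have [d [K [d0 mK KG KdG le]]] := inner_parallel oG GW e0.
exists (d / 4); first by rewrite divr_gt0.
move=> a /andP[a0 ad]; have q0 := sqrt3_gt0 R; have q2 := sqrt3_le2 R.
pose B := (Num.truncn (2 * W / a)).+1.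
pose l := [seq i%:Z - B%:Z | i <- iota 0 (2 * B).+1].
(* only centres with bounded indices can be those of hexagons inside [G] *)
have inl (m : int) : `|m%:~R| <= 2 * W / a :> R -> m \in l.
  move=> h; have hB : `|m| <= B%:Z.
    rewrite -(ler_int R) intr_norm; apply: le_trans h (ltW _).
    exact: truncnS_gt.
  rewrite ler_norml in hB; clear -hB; move: hB => /andP[h1 h2].
  by apply/mapP; exists (absz (m + B%:Z)); rewrite ?mem_iota; lia.
pose s0 := [seq hex_center a p.1 p.2 | p <- [seq (m, n) | m <- l, n <- l]].
pose s := undup [seq c <- s0 | `[< hexagon c a `<=` G >]].
have sP c : c \in s -> hexagon c a `<=` G /\ exists m n, c = hex_center a m n.
  rewrite mem_undup mem_filter => /andP[/asboolP cG /mapP[p _ cE]].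
  by split=> //; exists p.1, p.2.
exists s; split.
- exact: undup_uniq.
- by move=> c /sP[].
- move=> c c' /sP[_ [m [n ->]]] /sP[_ [m' [n' ->]]] ne.
  apply: hexagons_disjoint => //; apply: contra ne; rewrite xpair_eqE.
  by case/andP => /eqP -> /eqP ->.
apply: le_trans le _.
have -> : (size s)%:R * hexagon_area a = \sum_(c <- s) fine (area (hexagon c a)).
  rewrite (eq_bigr (fun _ => hexagon_area a)); last by move=> c _; rewrite area_hexagon.
  by rewrite big_const_seq count_predT iter_addr addr0 mulr_natl.
apply: fine_area_le_cover => //.
- by move=> c _; exact: hexagon_measurable.
- by move=> c _; rewrite area_hexagon.
move=> z Kz; have [m [n hz]] := hexagons_cover z a0.
have hG : hexagon (hex_center a m n) a `<=` G.
  apply: subset_trans (hexagon_sub_sqr a0 hz) _; apply: subset_trans (KdG z Kz).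
  by move=> w [/andP[w1 w2] /andP[w3 w4]]; split; apply/andP; split; lra.
exists (hex_center a m n) => //.
rewrite mem_undup mem_filter; apply/andP; split; first exact/asboolP.
have [/= /andP[c1 c2] /andP[c3 c4]] := GW _ (hG _ (hexagon_self _ a0)).
have W0 : 0 <= W by lra.
have n3 : `|3 * n%:~R| <= 2 * W / a :> R.
  rewrite ler_pdivlMr // -[X in _ * X](gtr0_norm a0) -normrM ler_norml.
  have E : 3 * n%:~R * a = sqrt3 * (3 * n%:~R * (a / sqrt3)) by field; rewrite gt_eqF.
  rewrite E; set y := 3 * n%:~R * (a / sqrt3) in c3 c4 *.
  have h1 : sqrt3 * y <= sqrt3 * W by rewrite ler_pM2l //; lra.
  have h2 : sqrt3 * (- W) <= sqrt3 * y by rewrite ler_pM2l //; lra.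
  have h3 : sqrt3 * W <= 2 * W by rewrite ler_wpM2r.
  by apply/andP; split; lra.
have nn : `|n%:~R| <= 2 * W / a :> R.
  apply: le_trans n3; rewrite normrM ger0_norm // ler_peMl //; lra.
have mm : `|m%:~R| <= 2 * W / a :> R.
  have h : `|2 * m%:~R + 3 * n%:~R| <= W / a :> R.
    rewrite ler_pdivlMr // -[X in _ * X](gtr0_norm a0) -normrM ler_norml mulrC.
    by apply/andP; split; lra.
  have : `|2 * m%:~R| <= W / a + 2 * W / a :> R.
    have -> : 2 * m%:~R = (2 * m%:~R + 3 * n%:~R) - 3 * n%:~R :> R by ring.
    exact: le_trans (ler_normB _ _) (lerD h n3).
  have w0 : 0 <= W / a by rewrite divr_ge0 // ltW.
  rewrite normrM ger0_norm // -!mulrA.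
  by move: (W / a) (`|m%:~R| : R) w0 => w x w0; clear -w0; lra.
apply/mapP; exists (m, n) => //; apply/allpairsP; exists (m, n).
by split=> //=; exact: inl.
Qed.
End HexagonTiling.

(** * A weighted power mean inequality *)

Section PowerMean.
Variable R : realType.

(** The tangent at 1 to the convex function [x `^ (- s)]. *)
Lemma powR_tangent (s x : R) : 0 <= s -> 0 < x -> 1 - s * (x - 1) <= x `^ (- s).
Proof.
move=> s0 x0; rewrite /powR gt_eqF //.
apply: le_trans (expR_ge1Dx _); rewrite mulNr lerD2l lerN2 ler_wpM2l //.
have := expR_ge1Dx (ln x); rewrite lnK ?posrE //; lra.
Qed.

(** Under the constraint on [\sum_i B i], the right-hand side is smallest when
    [B i] is proportional to [g i `^ (s + 1)^-1]; compare with the tangents at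
    this minimizer [B0_]. *)
Lemma power_mean (k : nat) (s A : R) (g B : 'I_k -> R) :
  0 < s -> 0 < A -> (forall i, 0 <= g i) -> (forall i, 0 < B i) ->
  \sum_(i < k) B i <= A ->
  ((\sum_(i < k) g i `^ (s + 1)^-1) / A) `^ (s + 1) * A <= \sum_(i < k) g i * B i `^ (- s).
Proof.
move=> s0 A0 g0 B0 BA; set T := \sum_(i < k) _.
have s1 : 0 < s + 1 by rewrite addr_gt0.
have T0 : 0 <= T by apply: sumr_ge0 => i _; exact: powR_ge0.
have [->|Tn] := eqVneq T 0.
  rewrite mul0r powR0 ?gt_eqF // mul0r; apply: sumr_ge0 => i _.
  by rewrite mulr_ge0 // powR_ge0.
have Tp : 0 < T by rewrite lt_neqAle eq_sym Tn.
pose c := (T / A) `^ (s + 1); pose B0_ i := A / T * g i `^ (s + 1)^-1.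
have c0 : 0 <= c by exact: powR_ge0.
have AT : 0 < A / T by rewrite divr_gt0.
have key i : c * (B0_ i - s * (B i - B0_ i)) <= g i * B i `^ (- s).
  have [gi0|gin] := eqVneq (g i) 0.
    rewrite /B0_ gi0 powR0 ?invr_eq0 ?gt_eqF // mulr0 mul0r subr0 sub0r mulrN oppr_le0.
    by rewrite !mulr_ge0 // ltW.
  have gip : 0 < g i by rewrite lt_neqAle eq_sym gin g0.
  have b0 : 0 < B0_ i by rewrite mulr_gt0 // powR_gt0.
  pose x := B i / B0_ i; have x0 : 0 < x by rewrite divr_gt0.
  have BE : B i = B0_ i * x by rewrite /x mulrC divfK // gt_eqF.
  have gE : g i * B0_ i `^ (- s) = c * B0_ i.
    have -> : B0_ i `^ (- s) = B0_ i `^ (- (s + 1)) * B0_ i.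
      rewrite -[X in _ = _ * X]powRr1 ?(ltW b0) // -powRD; last by rewrite (gt_eqF b0) implybT.
      by congr (_ `^ _); ring.
    rewrite mulrA; congr (_ * _); rewrite /B0_ powRM ?(ltW AT) ?powR_ge0 // -powRrM.
    have -> : (s + 1)^-1 * - (s + 1) = -1 by rewrite mulrN mulVf // gt_eqF.
    rewrite powR_inv1 // mulrCA divff // mulr1 /c -invf_div -[_^-1]powR_inv1 ?(ltW AT) //; last first.
      by rewrite divr_ge0 // ltW.
    by rewrite -powRrM mulN1r opprK.
  rewrite BE powRM ?(ltW b0) ?(ltW x0) // mulrA gE.
  have -> : c * (B0_ i - s * (B0_ i * x - B0_ i)) = c * B0_ i * (1 - s * (x - 1)) by ring.
  apply: ler_wpM2l; first by apply: mulr_ge0 => //; exact: ltW.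
  by apply: powR_tangent => //; exact: ltW.
apply: le_trans (ler_sum _ (fun i _ => key i)).
rewrite -mulr_sumr -/c ler_wpM2l //.
have -> : \sum_(i < k) (B0_ i - s * (B i - B0_ i)) =
    (1 + s) * \sum_(i < k) B0_ i - s * \sum_(i < k) B i.
  by rewrite 2!mulr_sumr -sumrB; apply: eq_bigr => i _; ring.
have -> : \sum_(i < k) B0_ i = A by rewrite -mulr_sumr -/T divfK // gt_eqF.
have : 0 <= s * (A - \sum_(i < k) B i) by rewrite mulr_ge0 ?subr_ge0 // ltW.
lra.
Qed.
End PowerMean.

(** * Enlarging cells inside a square *)

Section ClusterCover.
Variable R : realType.
Implicit Types (A B C G K P : set (plane R)) (c z w v : plane R).

Definition rect (x1 x2 y1 y2 : R) : set (plane R) :=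
  [set z | x1 <= z.1 <= x2 /\ y1 <= z.2 <= y2].

Lemma rect_compact x1 x2 y1 y2 : compact (rect x1 x2 y1 y2).
Proof.
have -> : rect x1 x2 y1 y2 = (`[x1, x2]%classic : set R^o) `*` (`[y1, y2]%classic : set R^o).
  by apply/seteqP; split=> w /=; rewrite !in_itv.
by apply: compact_setX; exact: segment_compact.
Qed.

Lemma rect_convex_body x1 x2 y1 y2 : x1 < x2 -> y1 < y2 -> convex_body (rect x1 x2 y1 y2).
Proof.
move=> x12 y12; split; last 2 first.
- exact: rect_compact.
- pose e := Num.min ((x2 - x1) / 2) ((y2 - y1) / 2).
  have e1 : e <= (x2 - x1) / 2 by rewrite ge_min lexx.
  have e2 : e <= (y2 - y1) / 2 by rewrite ge_min lexx orbT.
  exists ((x1 + x2) / 2, (y1 + y2) / 2); apply/interior_inner; exists e.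
    by rewrite lt_min !divr_gt0 ?subr_gt0.
  by move=> w [/= /andP[h1 h2] /andP[h3 h4]]; split; apply/andP; split; lra.
apply/convex_setE => t z w /andP[t0 t1] [/andP[a1 a2] /andP[a3 a4]] [/andP[b1 b2] /andP[b3 b4]].
have f (r s : R) : r <= s -> 0 <= (1 - t) * (s - r) by move=> rs; rewrite mulr_ge0 ?subr_ge0.
have g (r s : R) : r <= s -> 0 <= t * (s - r) by move=> rs; rewrite mulr_ge0 ?subr_ge0.
move: (f _ _ a1) (f _ _ a2) (f _ _ a3) (f _ _ a4) (g _ _ b1) (g _ _ b2) (g _ _ b3) (g _ _ b4).
by move=> *; split; rewrite /segpt /=; apply/andP; split; lra.
Qed.

Lemma avoid_events (ev : seq R) (x d e : R) : d != 0 -> 0 < e ->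
  exists t, 0 < t < e /\ x + t * d \notin ev.
Proof.
move=> d0 e0; pose f (n : nat) := x + e / n.+2%:R * d.
have finj : injective f.
  move=> m n /addrI /(mulIf d0) /(mulfI (lt0r_neq0 e0)) /invr_inj /eqP.
  by rewrite eqr_nat => /eqP[].
have [/allP all_in|/allPn[n _ nev]] := boolP (all (fun n => f n \in ev) (iota 0 (size ev).+1)).
  have := @uniq_leq_size _ [seq f n | n <- iota 0 (size ev).+1] ev.
  rewrite map_inj_uniq // iota_uniq size_map size_iota ltnn => /(_ isT) h.
  by suff : false by []; apply: h => _ /mapP[n nin ->]; exact: all_in.
exists (e / n.+2%:R); split=> //; rewrite divr_gt0 ?ltr0n //=.
by rewrite ltr_pdivrMr ?ltr0n // ltr_pMr // ltr1n.
Qed.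

(** Every point of a convex set with an inner point is a limit of points of the
    set with abscissas outside a given finite set. *)
Lemma closed_off_events C P v (ev : seq R) : closed C -> @convex_set R (plane R) P ->
  inner P v -> (forall z, P z -> z.1 \notin ev -> C z) -> P `<=` C.
Proof.
move=> cC cP [e e0 eP] offC z Pz; apply: contrapT => nC.
have /interior_inner[d d0 dC] : interior (~` C) z.
  by apply: open_nbhs_nbhs; split=> //; exact: closed_openC.
have [w [Pw wz]] : exists w, P w /\ w.1 - z.1 != 0.
  have [vz|vz] := eqVneq (v.1 - z.1) 0.
    exists (v.1 + e, v.2); split; first by apply: eP; split; apply/andP; split => /=; lra.
    by apply/eqP => /= h; lra.
  by exists v; split=> //; apply: eP; split; apply/andP; split; lra.
pose N := 1 + `|w.1 - z.1| + `|w.2 - z.2|.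
have n1 := normr_ge0 (w.1 - z.1); have n2 := normr_ge0 (w.2 - z.2).
have N0 : 0 < N by rewrite /N; lra.
have m0 : 0 < Num.min 1 (d / N) by rewrite lt_min ltr01 divr_gt0.
have [t [/andP[t0 tm] nev]] := avoid_events ev z.1 wz m0.
move: tm; rewrite lt_min => /andP[t1 td].
rewrite ltr_pdivlMr // in td.
have Pt : P (segpt t z w) by have /convex_setE := cP; apply=> //; lra.
have b1 : `|t * (w.1 - z.1)| <= d.
  rewrite normrM gtr0_norm //; apply: le_trans (ltW td); rewrite ler_wpM2l ?(ltW t0) //.
  by rewrite /N; lra.
have b2 : `|t * (w.2 - z.2)| <= d.
  rewrite normrM gtr0_norm //; apply: le_trans (ltW td); rewrite ler_wpM2l ?(ltW t0) //.
  by rewrite /N; lra.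
rewrite ler_norml in b1; rewrite ler_norml in b2.
move: b1 b2 => /andP[b11 b12] /andP[b21 b22].
have : (~` C) (segpt t z w).
  by apply: dC; split; rewrite /segpt /=; apply/andP; split; clear -b11 b12 b21 b22; lra.
apply; apply: offC => //; rewrite /segpt /=.
by have -> : (1 - t) * z.1 + t * w.1 = z.1 + t * (w.1 - z.1) by ring.
Qed.

Lemma null_inner_disjoint A B : planar_measurable A -> planar_measurable B ->
  area (A `&` B) = 0%E -> forall z, inner A z -> inner B z -> False.
Proof.
move=> mA mB AB z iA iB; have [e e0 eAB] := inner_setI iA iB.
have := le_area (measurable_sqr z e) (measurableI _ _ mA mB) eAB.
rewrite AB area_sqr ?(ltW e0) // lee_fin leNgt => /negP; apply.
by rewrite exprn_gt0 // pmulrn_lgt0.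
Qed.

Lemma inner_area_gt0 A W z : planar_measurable A -> A `<=` sqr ((0, 0) : plane R) W ->
  inner A z -> 0 < fine (area A).
Proof.
move=> mA AW [e e0 eA]; apply: (@lt_le_trans _ _ ((e *+ 2) ^+ 2)).
  by rewrite exprn_gt0 // pmulrn_lgt0.
rewrite -[leLHS]/(fine ((e *+ 2) ^+ 2)%:E) -(area_sqr z (ltW e0)).
apply: fine_le; [by rewrite area_sqr // ltW|exact: area_fin AW|].
by apply: le_area => //; exact: measurable_sqr.
Qed.

Lemma area_rectE x1 x2 y1 y2 : x1 <= x2 -> y1 <= y2 ->
  fine (area (rect x1 x2 y1 y2)) = (x2 - x1) * (y2 - y1).
Proof. by move=> x12 y12; rewrite area_rect. Qed.

(** Two rectangles are added to the cells, along the bottom and the top of the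
    square: no enlarged cell can reach beyond them, so the enlarged cells are
    bounded, and being disjoint from the enlarged rectangles they have at most
    the area of the square. *)
Lemma cover_in_rectangle (J : finType) (E : J -> set (plane R)) W : 0 < W ->
  (forall i, convex_body (E i)) -> (forall i, E i `<=` rect (- W) W (- W) W) ->
  (forall i j z, i != j -> inner (E i) z -> inner (E j) z -> False) ->
  exists (P : J -> set (plane R)) (n : J -> nat),
    [/\ forall i, E i `<=` P i, forall i, is_ngon (n i) (P i),
      (\sum_i n i <= 6 * (#|J| + 2))%N,
      forall i, P i `<=` sqr ((0, 0) : plane R) (W + 1) &
      \sum_i fine (area (P i)) <= (2 * W) ^+ 2].
Proof.
move=> W0 cE EW dE.
pose D (i : J + bool) : set (plane R) := match i with
  | inl i => E i
  | inr true => rect (- W) W W (W + 1)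
  | inr false => rect (- W) W (- W - 1) (- W) end.
have cD i : convex_body (D i).
  by case: i => [i|[]]; [exact: cE|apply: rect_convex_body; lra|apply: rect_convex_body; lra].
have innE i z : inner (E i) z -> - W < z.2 < W.
  move=> [e e0 eE].
  have /EW[_ /= /andP[_ h1]] : E i (z.1, z.2 + e) by apply: eE; split; apply/andP; split => /=; lra.
  have /EW[_ /= /andP[h2 _]] : E i (z.1, z.2 - e) by apply: eE; split; apply/andP; split => /=; lra.
  by apply/andP; split; lra.
have dD i j z : i != j -> inner (D i) z -> inner (D j) z -> False.
  case: i j => [i|[]] [j|[]] //= ij.
  - exact: (dE i j).
  - by move=> /innE /andP[_ h] /inner_sub[_ /andP[h' _]]; lra.
  - by move=> /innE /andP[h _] /inner_sub[_ /andP[_ h']]; lra.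
  - by move=> /inner_sub[_ /andP[h' _]] /innE /andP[_ h]; lra.
  - by move=> /inner_sub[_ /andP[h _]] /inner_sub[_ /andP[_ h']]; lra.
  - by move=> /inner_sub[_ /andP[_ h']] /innE /andP[h _]; lra.
  - by move=> /inner_sub[_ /andP[_ h']] /inner_sub[_ /andP[h _]]; lra.
have [hs [ev [h1 h2 h3 h4]]] := convex_bodies_cover cD dD.
pose P i := polyhedron (hs (inl i)).
have Dx i z : D i z -> - W <= z.1 <= W.
  by case: i => [i|[]] //=; [move/EW; case|case|case].
have Dy i z : D i z -> - W - 1 <= z.2 <= W + 1.
  case: i => [i|[]] /=; [move/EW; case|case|case]; move=> _ /andP[? ?];
    by apply/andP; split; lra.
have bot x : - W <= x <= W -> polyhedron (hs (inr false)) (x, - W) /\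
    polyhedron (hs (inr false)) (x, - W - 1).
  by move=> hx; split; apply: h1; split=> //=; apply/andP; split; lra.
have top x : - W <= x <= W -> polyhedron (hs (inr true)) (x, W) /\
    polyhedron (hs (inr true)) (x, W + 1).
  by move=> hx; split; apply: h1; split=> //=; apply/andP; split; lra.
pose Big := rect (- W) W (- W - 1) (W + 1).
have offev i z : P i z -> z.1 \notin ev -> Big z.
  rewrite [z]surjective_pairing /=; move: z.1 z.2 => x y Pz nev.
  case: (h4 x y _ nev Pz) => [[y' Ey]|[j [j' [y1 [y2 [D1 D2 /andP[y1y yy2]]]]]]]; last first.
    have /andP[a1 a2] := Dy _ _ D1; have /andP[b1 b2] := Dy _ _ D2.
    by split; [exact: (Dx _ _ D1)|rewrite /= in a1 b2 *; apply/andP; split; lra].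
  have hx := Dx _ _ Ey; have [_ /andP[e1 e2]] := EW _ _ Ey; rewrite /= in hx e1 e2.
  have [bo bo'] := bot x hx; have [to to'] := top x hx.
  split=> //=; apply/andP; split.
    case: (h3 x (inl i) (inr false) nev isT) => h.
      by have := h _ _ (h1 (inl i) _ Ey) bo'; lra.
    by have := h _ _ Pz bo; lra.
  case: (h3 x (inl i) (inr true) nev isT) => h.
    by have := h _ _ Pz to; lra.
  by have := h _ _ (h1 (inl i) _ Ey) to'; lra.
have inP i : exists z, inner (P i) z.
  have [_ _ [z /interior_inner iz]] := cE i.
  by exists z; apply: inner_subset iz; exact: (h1 (inl i)).
have PB i : P i `<=` Big.
  have [z iz] := inP i.
  apply: (closed_off_events _ _ iz (offev i)).
    by apply: compact_closed; [exact: norm_hausdorff|exact: rect_compact].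
  apply/convex_setE => t u w t01 /polyhedronP Pu /polyhedronP Pw; apply/polyhedronP => h hh.
  have /convex_setE := @halfplane_convex R h; apply; [exact: t01|exact: Pu|exact: Pw].
have BS : Big `<=` sqr ((0, 0) : plane R) (W + 1).
  by move=> z [/andP[a1 a2] /andP[b1 b2]]; split; apply/andP; split => /=;
    clear -a1 a2 b1 b2; lra.
have PS i : P i `<=` sqr ((0, 0) : plane R) (W + 1) by exact: subset_trans (PB i) BS.
have W1 : 0 < W + 1 by lra.
have /choice[n Hn] : forall i, exists n, (n <= size (hs (inl i)))%N /\ is_ngon n (P i).
  by move=> i; have [n n1 n2] := polyhedron_ngon W1 (PS i) (inP i); exists n.
exists P, n; split.
- by move=> i; exact: (h1 (inl i)).
- by move=> i; case: (Hn i).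
- have -> : (#|J| + 2 = #|{: J + bool}|)%N by rewrite card_sum card_bool.
  apply: leq_trans _ h2.
  rewrite big_sumType /=; apply: leq_trans (leq_addr _ _).
  by apply: leq_sum => i _; case: (Hn i).
- exact: PS.
pose Q (i : J + bool) : set (plane R) := match i with inl i => P i | inr b => D (inr b) end.
have QP i : Q i `<=` polyhedron (hs i) by case: i => [i|b] //=; exact: (h1 (inr b)).
have mQ i : planar_measurable (Q i).
  case: i => [i|b] /=; first by apply: closed_planar_measurable; exact: polyhedron_closed.
  by apply: compact_planar_measurable; case: (cD (inr b)).
have mB : planar_measurable Big by exact: measurable_rect.
have QB i : Q i `<=` Big.
  by case: i => [i|[]] /=; [exact: PB|move=> z [/andP[a1 a2] /andP[b1 b2]]; split; apply/andP; split;
    clear -W0 a1 a2 b1 b2; lra..].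
have sm : \sum_i fine (area (Q i)) <= fine (area Big).
  apply: (@fine_area_sum_le R _ Q (index_enum (J + bool)%type) Big (W + 1)) => //.
    exact: index_enum_uniq.
  move=> i j _ _ ij; apply: (@area_null _ _ ev); first exact: (measurableI _ _ (mQ i) (mQ j)).
  move=> x y y' nev [/QP qi /QP qj] [/QP qi' /QP qj'].
  by case: (h3 x i j nev ij) => h; apply/eqP; rewrite eq_le; apply/andP; split; exact: h.
have aB : fine (area Big) = (W - - W) * (W + 1 - (- W - 1)) by apply: area_rectE; clear -W0; lra.
have aT : fine (area (Q (inr true))) = (W - - W) * (W + 1 - W) by rewrite area_rectE //; clear -W0; lra.
have aF : fine (area (Q (inr false))) = (W - - W) * (- W - (- W - 1)).
  by rewrite area_rectE //; clear -W0; lra.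
move: sm aT aF; rewrite big_sumType big_bool [leRHS]aB.
set S := \sum_i _; set t := fine _; set f := fine _ => sm aT aF.
by rewrite expr2; rewrite /= in sm; clear -sm aT aF; lra.
Qed.
End ClusterCover.

(** * Asymptotics of the minimal energy *)

Section Asymptotics.
Variables (R : realType) (Omega : set (plane R)).
Variables (F : set (plane R) -> R) (alpha : R) (gamma : nat -> R).
Hypothesis Omega_open : open Omega.
Hypothesis Omega_bounded : bounded_set Omega.
Hypothesis Omega_nonempty : Omega !=set0.
Hypothesis Omega_lipschitz : lipschitz_boundary Omega.
Hypothesis F_ge0 : forall K, convex_body K -> 0 <= F K.
Hypothesis F_monotone : forall K1 K2, convex_body K1 -> convex_body K2 ->
  K1 `<=` K2 -> F K2 <= F K1.
Hypothesis alpha_gt0 : 0 < alpha.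
Hypothesis F_homogeneous : forall t K, 0 < t -> convex_body K ->
  F (scale t K) = t `^ (- alpha) * F K.
Hypothesis gammaE : forall n, (3 <= n)%N ->
  is_min [set F P * fine (area P) `^ (alpha / 2) | P in is_ngon n] (gamma n).
Hypothesis gamma6 : forall H, unit_regular_hexagon H -> gamma 6%N = F H.
Hypothesis gamma_mean : forall (k : nat) (n : 'I_k -> nat), (0 < k)%N ->
  (forall i, (3 <= n i)%N) ->
  k%:R^-1 * \sum_(i < k) (n i)%:R <= 6 :> R ->
  gamma 6%N `^ (2 / (alpha + 2))
    <= k%:R^-1 * \sum_(i < k) gamma (n i) `^ (2 / (alpha + 2)).

Let s : R := alpha / 2.
Let s_gt0 : 0 < s. Proof. by rewrite divr_gt0. Qed.
Let betaE : 2 / (alpha + 2) = (s + 1)^-1.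
Proof. by rewrite /s; field; rewrite lt0r_neq0 // addr_gt0. Qed.
Let expE : (alpha + 2) / 2 = s + 1. Proof. by rewrite /s; field. Qed.

Let om : R := fine (area Omega).

Lemma gamma_ge0 n : (3 <= n)%N -> 0 <= gamma n.
Proof.
move=> n3; have [[P Pn <-] _] := gammaE n3.
by rewrite mulr_ge0 ?powR_ge0 // F_ge0 //; exact: ngon_convex_body Pn.
Qed.

Let Omega_meas : planar_measurable Omega. Proof. exact: open_planar_measurable. Qed.

Lemma domain_area_gt0 : 0 < om.
Proof.
have [W W0 OW] := bounded_sqr Omega_bounded; have [z Oz] := Omega_nonempty.
apply: (@inner_area_gt0 R Omega W z) => //; apply/interior_inner.
exact: open_nbhs_nbhs.
Qed.

Lemma gamma_le n P W : is_ngon n P -> P `<=` sqr ((0, 0) : plane R) W ->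
  0 < fine (area P) /\ gamma n * fine (area P) `^ (- s) <= F P.
Proof.
move=> Pn PW; have cP := ngon_convex_body Pn; have n3 : (3 <= n)%N by case: Pn.
have [_ coP [z /interior_inner iz]] := cP.
have a0 : 0 < fine (area P).
  exact: (inner_area_gt0 (compact_planar_measurable coP) PW iz).
split=> //; have [_ lb] := gammaE n3.
have h : gamma n <= F P * fine (area P) `^ s by apply: lb; exists P.
rewrite powRN -ler_pdivlMr ?invrK ?invr_gt0 ?powR_gt0 //.
Qed.

(** The complement in a large square of the closure of [Omega] is open; its area
    is the expected one because the boundary of [Omega] has area zero. *)
Lemma exterior_filling (e : R) : 0 < e -> exists W (m : nat) (Q : 'I_m -> set (plane R)),
  0 < W /\
  [/\ Omega `<=` rect (- W) W (- W) W,
      forall j, convex_body (Q j),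
      forall j, Q j `<=` rect (- W) W (- W) W /\ Q j `&` Omega = set0,
      forall i j, i != j -> area (Q i `&` Q j) = 0%E &
      (2 * W) ^+ 2 - om - e <= \sum_j fine (area (Q j))].
Proof.
move=> e0; have [W W0 OW] := bounded_sqr Omega_bounded.
pose B : set (plane R) := ball ((0, 0) : plane R) W.
pose G := B `&` ~` closure Omega.
have GW : G `<=` sqr ((0, 0) : plane R) W.
  move=> z [[+ +] _]; rewrite -!ball_normE /= !sub0r !normrN !ltr_norml.
  by move=> /andP[h1 h2] /andP[h3 h4]; split; apply/andP; split => /=; lra.
have BW z : sqr ((0, 0) : plane R) W z -> rect (- W) W (- W) W z.
  by move=> [/= /andP[h1 h2] /andP[h3 h4]]; split; apply/andP; split; lra.
have oG : open G by apply: openI; [exact: ball_open|apply: closed_openC; exact: closed_closure].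
have aB : area B = ((2 * W) ^+ 2)%:E.
  have -> : B = (`]- W, W[%classic : set R) `*` (`]- W, W[%classic : set R).
    apply/seteqP; split=> z /=; rewrite !in_itv /=.
      by move=> [/=]; rewrite -!ball_normE /= !sub0r !normrN !ltr_norml.
    by move=> [h1 h2]; split; rewrite -ball_normE /= sub0r normrN ltr_norml.
  rewrite /area product_measure1E; try exact: measurable_itv.
  have len : lebesgue_measure (`]- W, W[%classic : set R) = (2 * W)%:E.
    by rewrite lebesgue_measure_itv /= lte_fin ifT; [congr EFin; ring|lra].
  by rewrite expr2 EFinM; congr (_ * _)%E.
have mc : planar_measurable (closure Omega) by apply: closed_planar_measurable; exact: closed_closure.
have mG := open_planar_measurable oG.
have fO : area Omega \is a fin_num by exact: (area_fin Omega_meas OW).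
have ac : (area (closure Omega) <= om%:E)%E.
  have mD : planar_measurable (closure Omega `\` Omega) by exact: measurableD.
  have U : closure Omega = Omega `|` (closure Omega `\` Omega).
    by rewrite setDUK //; exact: subset_closure.
  have h : (area (Omega `|` (closure Omega `\` Omega)) <=
      area Omega + area (closure Omega `\` Omega))%E.
    exact: (measureU2 (area_measure R) Omega_meas mD).
  rewrite U; move: h; rewrite (boundary_null Omega_open Omega_bounded Omega_lipschitz) adde0.
  by rewrite /om fineK.
have fG : area G \is a fin_num by exact: (area_fin mG GW).
have aG : (2 * W) ^+ 2 - om <= fine (area G).
  have : (area B <= area G + area (closure Omega))%E.
    apply: (le_trans _ (measureU2 (area_measure R) mG mc)).
    apply: le_area; [|exact: measurableU|].
      by apply: open_planar_measurable; exact: ball_open.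
    move=> z Bz; have [|] := pselect (closure Omega z); [by right|by left].
  move=> /le_trans /(_ (leeD2l _ ac)); rewrite aB -(fineK fG) -EFinD lee_fin; lra.
have [a1 a10 tile] := hexagon_tiling oG GW e0.
have a2 : 0 < a1 / 2 < a1 by apply/andP; split; lra.
have [sq [us sG sd sa]] := tile _ a2.
have a20 : 0 < a1 / 2 by lra.
pose Q (j : 'I_(size sq)) := hexagon (nth (0, 0) sq j) (a1 / 2).
have cO : Omega `<=` closure Omega by exact: subset_closure.
exists W, (size sq), Q; split=> //; split.
- exact: subset_trans BW.
- by move=> j; exact: hexagon_convex_body.
- move=> j; have sub := sG _ (mem_nth (0, 0) (ltn_ord j)); split.
    by move=> z /sub /GW /BW.
  by apply/seteqP; split=> // z [/sub[_ nz] /cO].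
- move=> i j ij; apply: sd; rewrite ?mem_nth //.
  by rewrite nth_uniq //; exact: ij.
- rewrite (eq_bigr (fun _ => hexagon_area (a1 / 2))); last first.
    by move=> j _; rewrite area_hexagon.
  rewrite sumr_const card_ord -[leRHS]mulr_natl; apply: le_trans sa.
  by rewrite lerD2r.
Qed.

(** Enlarge together the cells of the cluster and the fixed bodies filling the
    outside: the enlarged outer bodies leave to the enlarged cells little more
    area than that of [Omega]. *)
Lemma cluster_sides k (E : 'I_k -> set (plane R)) W m (Q : 'I_m -> set (plane R)) e :
  0 < W -> Omega `<=` rect (- W) W (- W) W ->
  (forall j, convex_body (Q j)) ->
  (forall j, Q j `<=` rect (- W) W (- W) W /\ Q j `&` Omega = set0) ->
  (forall i j, i != j -> area (Q i `&` Q j) = 0%E) ->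
  (2 * W) ^+ 2 - om - e <= \sum_j fine (area (Q j)) ->
  convex_cluster Omega E ->
  exists (n : 'I_k -> nat) (B : 'I_k -> R),
    [/\ forall i, (3 <= n i)%N, (\sum_i n i <= 6 * (k + m + 2))%N,
       forall i, 0 < B i, \sum_i B i <= om + e &
       forall i, gamma (n i) * B i `^ (- s) <= F (E i)].
Proof.
move=> W0 OW cQ QW dQ aQ [cE EO dE].
pose D (i : 'I_k + 'I_m) := match i with inl i => E i | inr j => Q j end.
have cD i : convex_body (D i) by case: i => [i|j]; [exact: cE|exact: cQ].
have DW i : D i `<=` rect (- W) W (- W) W.
  by case: i => [i|j] /=; [exact: subset_trans (EO i) OW|case: (QW j)].
have mD i : planar_measurable (D i) by apply: compact_planar_measurable; case: (cD i).
have dD i j z : i != j -> inner (D i) z -> inner (D j) z -> False.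
  move=> ij; apply: null_inner_disjoint => //.
  case: i j ij => [i|i] [j|j] //= ij.
  - exact: dE.
  - rewrite (_ : _ `&` _ = set0) ?area_measureE ?measure0 //.
    apply/seteqP; split=> // w [/EO Ow Qw].
    by case: (QW j) => _ <-.
  - rewrite (_ : _ `&` _ = set0) ?area_measureE ?measure0 //.
    apply/seteqP; split=> // w [Qw /EO Ow].
    by case: (QW i) => _ <-.
  - exact: dQ.
have [P [n [DP nP sn PW aP]]] := cover_in_rectangle W0 cD DW dD.
exists (fun i => n (inl i)), (fun i => fine (area (P (inl i)))).
rewrite card_sum !card_ord big_sumType /= in sn; rewrite big_sumType /= in aP.
split.
- by move=> i; case: (nP (inl i)).
- by apply: leq_trans sn; exact: leq_addr.
- by move=> i; case: (gamma_le (nP (inl i)) (PW (inl i))).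
- have QP : \sum_j fine (area (Q j)) <= \sum_j fine (area (P (inr j))).
    apply: ler_sum => j _.
    have mP : planar_measurable (P (inr j)).
      by apply: compact_planar_measurable; case: (ngon_convex_body (nP (inr j))).
    apply: fine_le; [|exact: area_fin (PW (inr j))|exact: le_area (mD (inr j)) mP (DP (inr j))].
    exact: (area_fin (mD (inr j)) (subset_trans (DP (inr j)) (PW (inr j)))).
  lra.
- move=> i; have [_ h] := gamma_le (nP (inl i)) (PW (inl i)).
  apply: le_trans h _; apply: F_monotone => //; first exact: ngon_convex_body (nP (inl i)).
  exact: (DP (inl i)).
Qed.

(** The [m] outer bodies raise the mean number of sides slightly above 6;
    adding boundedly many triangles to the list brings it down to 6, at the cost
    of the constant [C]. *)
Lemma cluster_lower_bound (e : R) : 0 < e -> exists2 C, 0 <= C &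
  forall k (E : 'I_k -> set (plane R)), (0 < k)%N -> convex_cluster Omega E ->
    (Num.max 0 (k%:R * gamma 6 `^ (s + 1)^-1 - C) / (om + e)) `^ (s + 1) * (om + e)
      <= \sum_(i < k) F (E i).
Proof.
move=> e0; have [W [m [Q [W0 [OW cQ QW dQ aQ]]]]] := exterior_filling e0.
pose N := (2 * (m + 2))%N.
exists (N%:R * gamma 3 `^ (s + 1)^-1); first by rewrite mulr_ge0 ?powR_ge0.
move=> k E k0 cE.
have [n [B [n3 sn B0 sB FB]]] := cluster_sides W0 OW cQ QW dQ aQ cE.
have oe : 0 < om + e by rewrite addr_gt0 // domain_area_gt0.
apply: le_trans (ler_sum _ (fun i _ => FB i)).
apply: le_trans (power_mean s_gt0 oe (fun i => gamma_ge0 (n3 i)) B0 sB).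
rewrite ler_wpM2r ?(ltW oe) //.
apply: ge0_ler_powR; rewrite ?nnegrE; first by rewrite addr_ge0 // ltW.
- by rewrite divr_ge0 ?(ltW oe) // le_max lexx.
- by rewrite divr_ge0 ?(ltW oe) //; apply: sumr_ge0 => i _; exact: powR_ge0.
rewrite ler_pM2r ?invr_gt0 // ge_max; apply/andP; split.
  by apply: sumr_ge0 => i _; exact: powR_ge0.
(* [N] extra triangles bring the mean number of sides down to 6: the excess
   [6 * (m + 2)] equals [3 * N]. *)
pose n' (i : 'I_(k + N)) := match fintype.split i with inl j => n j | inr _ => 3%N end.
have n'l i : n' (lshift N i) = n i.
  by rewrite /n'; case: split_ordP => j /eqP; rewrite ?eq_shift // => /eqP ->.
have n'r i : n' (rshift k i) = 3%N.
  by rewrite /n'; case: split_ordP => j /eqP; rewrite ?eq_shift.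
have kN0 : 0 < (k + N)%:R :> R by rewrite ltr0n; lia.
have := @gamma_mean (k + N) n' ltac:(lia).
rewrite betaE; set g6 := gamma 6 `^ _; set g3 := gamma 3 `^ _ => gm.
have {}gm : (k + N)%:R * g6 <= \sum_(i < k) gamma (n i) `^ (s + 1)^-1 + N%:R * g3.
  have h : g6 <= (k + N)%:R^-1 * \sum_(i < k + N) gamma (n' i) `^ (s + 1)^-1.
    apply: gm; first by move=> i; rewrite /n'; case: (fintype.split i).
    rewrite -natr_sum ler_pdivrMl // -natrM ler_nat big_split_ord /=.
    rewrite (eq_bigr n); last by move=> i _; rewrite n'l.
    rewrite [X in (_ + X)%N](eq_bigr (fun _ => 3%N)); last by move=> i _; rewrite n'r.
    rewrite sum_nat_const card_ord; move: sn; rewrite /N; move: (\sum_(i < k) n i)%N => S; clear; lia.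
  rewrite ler_pdivlMl // in h; apply: le_trans h _.
  rewrite big_split_ord /= lerD //.
    by apply: ler_sum => i _; rewrite n'l.
  rewrite (eq_bigr (fun _ => g3)); last by move=> i _; rewrite n'r.
  by rewrite sumr_const card_ord mulr_natl.
have g60 : 0 <= g6 by exact: powR_ge0.
have : k%:R * g6 <= (k + N)%:R * g6 by rewrite ler_wpM2r // ler_nat leq_addr.
lra.
Qed.

Let oneX (x : R) : 1 `^ x = 1. Proof. by rewrite powR1. Qed.

Lemma hexagon_energy c t : 0 < t -> F (hexagon c (t * unit_apothem R)) = t `^ (- alpha) * gamma 6.
Proof.
move=> t0; have u0 := unit_apothem_gt0 R.
have -> : hexagon c (t * unit_apothem R) =
    scale t (hexagon ((c.1 / t, c.2 / t) : plane R) (unit_apothem R)).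
  rewrite scale_hexagon //=; congr hexagon; rewrite [LHS]surjective_pairing.
  by congr pair; rewrite mulrC divfK // gt_eqF.
rewrite F_homogeneous //; last exact: hexagon_convex_body.
congr (_ * _); apply/esym/gamma6; split; first exact: hexagon_regular.
by rewrite area_hexagon // hexagon_area_unit.
Qed.

(** Hexagons of area [d * om / k] are small for large [k], and at least [k] of
    them fit in [Omega] since they fill more than the fraction [d] of it. *)
Lemma energy_upper_bound (d : R) : 0 < d < 1 -> \forall k \near \oo,
  (min_energy F Omega k <= (k%:R `^ (s + 1) * om `^ (- s) * (d `^ (- s) * gamma 6))%:E)%E.
Proof.
move=> /andP[d0 d1]; have o0 := domain_area_gt0; have u0 := unit_apothem_gt0 R.
have [W W0 OW] := bounded_sqr Omega_bounded.
have e0 : 0 < (1 - d) * om by rewrite mulr_gt0 // subr_gt0.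
have [a1 a10 tile] := hexagon_tiling Omega_open OW e0.
pose u := unit_apothem R.
exists (Num.truncn (u ^+ 2 * (d * om) / a1 ^+ 2)).+1 => // k /= kN.
have k0 : 0 < k%:R :> R by rewrite ltr0n; exact: leq_trans kN.
pose X := d * om / k%:R; have X0 : 0 < X by rewrite divr_gt0 // mulr_gt0.
pose t := Num.sqrt X; have t0 : 0 < t by rewrite sqrtr_gt0.
have tu : 0 < t * u < a1.
  rewrite mulr_gt0 //= -(@ltr_pXn2r _ 2) ?nnegrE // ?(ltW a10) ?mulr_ge0 ?(ltW t0) ?(ltW u0) //.
  rewrite exprMn sqr_sqrtr ?(ltW X0) // /X mulrAC ltr_pdivrMr // mulrC.
  rewrite [ltRHS]mulrC -ltr_pdivrMr ?exprn_gt0 //.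
  by apply: lt_le_trans (truncnS_gt _) _; rewrite ler_nat.
have [sq [us sG sd sa]] := tile _ tu.
have aX : hexagon_area (t * u) = X.
  by rewrite hexagon_area_scale hexagon_area_unit mulr1 sqr_sqrtr // ltW.
have ks : (k <= size sq)%N.
  rewrite -(ler_nat R); rewrite aX in sa.
  have h : d * om <= (size sq)%:R * X by apply: le_trans sa; rewrite /om; lra.
  by rewrite /X mulrA ler_pdivlMr // [leRHS]mulrC ler_pM2l ?mulr_gt0 // in h.
pose E (i : 'I_k) := hexagon (nth (0, 0) sq i) (t * u).
have iq (i : 'I_k) : (i < size sq)%N by exact: leq_trans ks.
have cE : convex_cluster Omega E.
  have /andP[tu0 _] := tu; split.
  - by move=> i; exact: hexagon_convex_body.
  - by move=> i; apply: sG; exact: mem_nth.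
  - move=> i j ij; apply: sd; rewrite ?mem_nth //.
    by rewrite nth_uniq //; exact: ij.
apply: ereal_inf_lbound; exists E => //; congr EFin.
rewrite (eq_bigr (fun _ => X `^ (- s) * gamma 6)); last first.
  move=> i _; rewrite /E hexagon_energy //; congr (_ * _).
  by rewrite /t -powR12_sqrt ?(ltW X0) // -powRrM; congr (_ `^ _); rewrite /s; field.
rewrite sumr_const card_ord -[LHS]mulr_natl /X.
have -> : (d * om / k%:R) `^ (- s) = d `^ (- s) * om `^ (- s) * k%:R `^ s.
  rewrite powRM ?invr_ge0 ?mulr_ge0 ?(ltW d0) ?(ltW o0) ?(ltW k0) //.
  rewrite powRM ?(ltW d0) ?(ltW o0) //; congr (_ * _).
  by rewrite -powR_inv1 ?(ltW k0) // -powRrM mulN1r opprK.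
rewrite powRD; last by rewrite (gt_eqF k0) implybT.
by rewrite powRr1 ?(ltW k0) //; ring.
Qed.

Lemma min_energy_ge0 k : (0 <= min_energy F Omega k)%E.
Proof.
apply: le_ereal_inf_tmp => _ [E [cE _ _] <-].
by rewrite lee_fin; apply: sumr_ge0 => i _; exact: F_ge0.
Qed.

(** The bound of [cluster_lower_bound] is weaker than the claimed one for
    [gamma 6] through the constants [e] and [C]; each of them is allowed to cost
    the factor [r], the square root of [b / gamma 6]. *)
Lemma energy_lower_bound (b : R) : b < gamma 6 -> \forall k \near \oo,
  ((k%:R `^ (s + 1) * om `^ (- s) * b)%:E <= min_energy F Omega k)%E.
Proof.
move=> bg; have o0 := domain_area_gt0.
have [b0|b0] := leP b 0.
  exists 0%N => // k _; apply: le_trans (min_energy_ge0 k); rewrite lee_fin.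
  by rewrite mulr_ge0_le0 // mulr_ge0 // powR_ge0.
have s1 : 0 < s + 1 by rewrite addr_gt0.
have g0 : 0 < gamma 6 by exact: lt_trans bg.
pose g := gamma 6; rewrite -/g in bg g0.
pose r := Num.sqrt (b / g).
have bg1 : b / g < 1 by rewrite ltr_pdivrMr // mul1r.
have r0 : 0 < r by rewrite sqrtr_gt0 divr_gt0.
have r1 : r < 1 by rewrite -sqrtr1 ltr_sqrt.
have rr : r * r = b / g by rewrite -expr2 sqr_sqrtr // ltW // divr_gt0.
(* so that [((om + e) / om) `^ (- s) = r] *)
pose e := om * (r `^ (- s^-1) - 1).
have e0 : 0 < e.
  rewrite mulr_gt0 // subr_gt0 powRN invf_gt1 ?powR_gt0 //.
  rewrite -[ltRHS](oneX s^-1); apply: gt0_ltr_powR; rewrite ?nnegrE ?(ltW r0) //.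
  by rewrite invr_gt0.
have [C C0 lb] := cluster_lower_bound e0.
(* the factor that the sum of the [gamma 6 `^ (s + 1)^-1] may lose to [C] *)
pose q := r `^ (s + 1)^-1.
have q1 : q < 1.
  rewrite -[ltRHS](oneX (s + 1)^-1); apply: gt0_ltr_powR; rewrite ?nnegrE ?(ltW r0) //.
  by rewrite invr_gt0.
pose gb := g `^ (s + 1)^-1; have gb0 : 0 < gb by rewrite powR_gt0.
have D0 : 0 < gb * (1 - q) by rewrite mulr_gt0 // subr_gt0.
exists (Num.truncn (C / (gb * (1 - q)))).+1 => // k /= kN.
have k0 : 0 < k%:R :> R by rewrite ltr0n; exact: leq_trans kN.
have kC : C <= k%:R * (gb * (1 - q)).
  rewrite -ler_pdivrMr //; apply: ltW; apply: lt_le_trans (truncnS_gt _) _.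
  by rewrite ler_nat.
apply: le_ereal_inf_tmp => _ [E cE <-]; rewrite lee_fin.
apply: le_trans (lb k E _ cE); last by rewrite -(ltr_nat R).
have oe : om + e = om * r `^ (- s^-1) by rewrite /e; ring.
have oe0 : 0 < om + e by rewrite addr_gt0.
pose T := k%:R * (gb * q).
have T0 : 0 <= T by rewrite !mulr_ge0 ?powR_ge0 // ltW.
have -> : k%:R `^ (s + 1) * om `^ (- s) * b = (T / (om + e)) `^ (s + 1) * (om + e).
  have sV : (s + 1)^-1 * (s + 1) = 1 by rewrite mulVf // gt_eqF.
  have TE : T `^ (s + 1) = k%:R `^ (s + 1) * (g * r).
    rewrite powRM ?mulr_ge0 ?powR_ge0 ?(ltW k0) // powRM ?powR_ge0 // -!powRrM sV.
    by rewrite !powRr1 // ltW.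
  rewrite powRM ?invr_ge0 ?(ltW oe0) // TE -[(om + e)^-1]powR_inv1 ?(ltW oe0) // -powRrM.
  rewrite -[X in _ = _ * X](powRr1 (ltW oe0)) -[RHS]mulrA -powRD; last first.
    by rewrite (gt_eqF oe0) implybT.
  have -> : -1 * (s + 1) + 1 = - s by ring.
  rewrite oe powRM ?powR_ge0 ?(ltW o0) // -powRrM.
  have -> : - s^-1 * - s = 1 by rewrite mulrNN mulVf // gt_eqF.
  rewrite powRr1 ?(ltW r0) //.
  have -> : b = g * (r * r) by rewrite rr mulrC divfK // gt_eqF.
  by ring.
rewrite ler_wpM2r ?(ltW oe0) //.
have le : T / (om + e) <= Num.max 0 (k%:R * gamma 6 `^ (s + 1)^-1 - C) / (om + e).
  rewrite ler_pM2r ?invr_gt0 // le_max; apply/orP; right.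
  by rewrite /T -/g -/gb; lra.
apply: ge0_ler_powR; rewrite ?nnegrE ?(ltW s1) //; first by rewrite divr_ge0 // ltW.
by rewrite divr_ge0 ?(ltW oe0) // le_max lexx.
Qed.

Lemma normalized_energy_cvg :
  ((om `^ (alpha / 2) / k%:R `^ ((alpha + 2) / 2))%:E * min_energy F Omega k)%E
    @[k --> \oo] --> (gamma 6)%:E.
Proof.
rewrite expE -/s; have o0 := domain_area_gt0; have g0 : 0 <= gamma 6 by exact: gamma_ge0.
pose L (k : nat) : \bar R := ((om `^ s / k%:R `^ (s + 1))%:E * min_energy F Omega k)%E.
have norm (k : nat) (x : R) : (0 < k)%N ->
    om `^ s / k%:R `^ (s + 1) * (k%:R `^ (s + 1) * om `^ (- s) * x) = x.
  move=> k0; have k0' : 0 < k%:R :> R by rewrite ltr0n.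
  have := powR_gt0 (s + 1) k0'; have := powR_gt0 s o0; rewrite powRN.
  move: (om `^ s) (k%:R `^ (s + 1)) => p q p0 q0.
  by field; rewrite !gt_eqF.
have cf (k : nat) : 0 <= om `^ s / k%:R `^ (s + 1) by rewrite divr_ge0 ?powR_ge0.
have up (eta : R) : 0 < eta -> \forall k \near \oo, (L k <= (gamma 6 + eta)%:E)%E.
  (* the denominator allows [gamma 6] to vanish *)
  move=> eta0; pose x := 1 + eta / (gamma 6 + 1).
  have g1 : 0 < gamma 6 + 1 by rewrite ltr_wpDl.
  have x1 : 1 < x by rewrite ltrDl divr_gt0.
  have x0 : 0 < x by exact: lt_trans x1.
  pose d := x `^ (- s^-1).
  have d01 : 0 < d < 1.
    rewrite powR_gt0 //= /d powRN invf_lt1 ?powR_gt0 //.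
    rewrite -[ltLHS](oneX s^-1); apply: gt0_ltr_powR; rewrite ?nnegrE ?(ltW x0) //.
    by rewrite invr_gt0.
  have ds : d `^ (- s) = x.
    by rewrite -powRrM mulrNN mulVf ?gt_eqF // powRr1 // ltW.
  have := energy_upper_bound d01; rewrite ds => -[N _ hN].
  exists N.+1 => // k /= kN; have k0 : (0 < k)%N by exact: leq_ltn_trans kN.
  apply: le_trans (lee_wpmul2l _ (hN k (ltnW kN))) _; first by rewrite lee_fin.
  rewrite -EFinM norm // lee_fin /x mulrDl mul1r lerD2l.
  rewrite mulrAC ler_pdivrMr //; lra.
have low (eta : R) : 0 < eta -> \forall k \near \oo, ((gamma 6 - eta)%:E <= L k)%E.
  move=> eta0; have lt : gamma 6 - eta < gamma 6 by rewrite ltrBlDr ltrDl.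
  have [N _ hN] := energy_lower_bound lt.
  exists N.+1 => // k /= kN; have k0 : (0 < k)%N by exact: leq_ltn_trans kN.
  apply: le_trans _ (lee_wpmul2l _ (hN k (ltnW kN))); last by rewrite lee_fin.
  by rewrite -EFinM norm.
have fin : \forall k \near \oo, L k \is a fin_num.
  near=> k; rewrite fin_numE; apply/andP; split.
    have : ((gamma 6 - 1)%:E <= L k)%E by near: k; exact: low.
    by case: (L k).
  have : (L k <= (gamma 6 + 1)%:E)%E by near: k; exact: up.
  by case: (L k).
apply/fine_cvgP; split; first exact: fin.
apply/cvgrPdist_le => eta eta0; near=> k.
have Lf : L k \is a fin_num by near: k; exact: fin.
have l1 : ((gamma 6 - eta)%:E <= L k)%E by near: k; exact: low.
have l2 : (L k <= (gamma 6 + eta)%:E)%E by near: k; exact: up.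
rewrite -(fineK Lf) !lee_fin in l1 l2.
by rewrite /= -/(L k) ler_distlC; apply/andP; split; lra.
Unshelve. all: by end_near.
Qed.
End Asymptotics.

Theorem theorem2 (R : realType) (Omega : set (plane R))
  (F : set (plane R) -> R) (alpha : R) (gamma : nat -> R)
  (Omega_open : open Omega)
  (Omega_bounded : bounded_set Omega)
  (Omega_nonempty : Omega !=set0)
  (Omega_lipschitz : lipschitz_boundary Omega)
  (F_ge0 : forall K, convex_body K -> 0 <= F K)
  (F_monotone : forall K1 K2, convex_body K1 -> convex_body K2 ->
     K1 `<=` K2 -> F K2 <= F K1)
  (alpha_gt0 : 0 < alpha)
  (F_homogeneous : forall t K, 0 < t -> convex_body K ->
     F (scale t K) = t `^ (- alpha) * F K)
  (gammaE : forall n, (3 <= n)%N ->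
     is_min [set F P * fine (area P) `^ (alpha / 2) | P in is_ngon n] (gamma n))
  (gamma6 : forall H, unit_regular_hexagon H -> gamma 6%N = F H)
  (gamma_mean : forall (k : nat) (n : 'I_k -> nat), (0 < k)%N ->
     (forall i, (3 <= n i)%N) ->
     k%:R^-1 * \sum_(i < k) (n i)%:R <= 6 :> R ->
     gamma 6%N `^ (2 / (alpha + 2))
       <= k%:R^-1 * \sum_(i < k) gamma (n i) `^ (2 / (alpha + 2))) :
  forall H : set (plane R), unit_regular_hexagon H ->
    ((fine (area Omega) `^ (alpha / 2) / k%:R `^ ((alpha + 2) / 2))%:E
       * min_energy F Omega k)%E @[k --> \oo] --> (F H)%:E.
Proof.
by move=> H /gamma6 <-; apply: normalized_energy_cvg.
Qed.
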